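(* There are absolute constants (hidden in the $O(\cdot)$ and $\Omega(\cdot)$ below) such that the following holds. Given a positive semidefinite $\mathbf{A}\in\mathbb{R}^{n\times n}$, $\mathbf{x}\in\mathbb{R}^n$, and $0<\epsilon<1$, there exists an algorithm running on a computer with $B=\Omega\left(\log\left(\frac{n\max(\|\mathbf{A}\|,1)}{\epsilon}\right)\right)$ bits of precision which returns $\mathbf{y}$ satisfying $\|\exp(-\mathbf{A})\mathbf{x}-\mathbf{y}\|\le\epsilon\|\mathbf{x}\|$ in $$O\left(\left[(\mathrm{mv}(\mathbf{A})+n)\log\left(\frac{n\max(\|\mathbf{A}\|,1)}{\epsilon}\right)\sqrt{\frac{\|\mathbf{A}\|}{\log(1/\epsilon)}+1}+\log^2\left(\frac{n\max(\|\mathbf{A}\|,1)}{\epsilon}\right)\right]\cdot\log\frac{1}{\epsilon}\right)$$ time, where $\mathrm{mv}(\mathbf{A})$ is the time required to multiply $\mathbf{A}$ by a vector.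
   Context: $\|\cdot\|$ is the Euclidean norm for vectors and the spectral norm for matrices. Floating-point model: a computer with $b$ bits of precision has relative precision $\epsilon_{mach}=2^{-b}$, meaning that for $\circ\in\{+,-,\times,\div\}$ the computed value is $\mathrm{fl}(x\circ y)=(1+\delta)(x\circ y)$ and $\mathrm{fl}(\sqrt{x})=(1+\delta)\sqrt{x}$ with $|\delta|\le\epsilon_{mach}$. Products with the input matrix satisfy $\|\mathrm{fl}(\mathbf{A}\mathbf{w})-\mathbf{A}\mathbf{w}\|\le 2n^{3/2}\|\mathbf{A}\|\|\mathbf{w}\|\epsilon_{mach}$ for all $\mathbf{w}\in\mathbb{R}^n$ and cost $\mathrm{mv}(\mathbf{A})$. Overflow and underflow are ignored. Runtimes are in the unit-cost RAM model (each scalar operation costs $O(1)$), and evaluating the required scalar functions (such as exponentials) to relative error $\epsilon_{mach}$ costs $O(1)$. Asymptotic notation: the number of bits is a suitable (sufficiently large) absolute constant times the indicated expression; each logarithm inside $O(\cdot)$ or $\Omega(\cdot)$ is read as at least $1$. *)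

(* Defs.v *)
From mathcomp Require Import all_boot all_order all_algebra.
From mathcomp Require Import all_classical all_reals all_analysis.
Set Implicit Arguments.
Unset Strict Implicit.
Unset Printing Implicit Defensive.
Import Order.TTheory GRing.Theory Num.Theory.
Import numFieldNormedType.Exports.
Local Open Scope classical_set_scope.
Local Open Scope ring_scope.

(* The library norm on matrices is the max norm, hence the next two
   definitions. *)
Definition enorm {R : realType} {n : nat} (v : 'cV[R]_n) : R :=
  Num.sqrt (\sum_(i < n) v i 0 ^+ 2).

Definition specnorm {R : realType} {n : nat} (A : 'M[R]_n) : R :=
  sup [set enorm (A *m v) | v in [set v : 'cV[R]_n | enorm v <= 1]].

Definition psd {R : realType} {n : nat} (A : 'M[R]_n) : Prop :=
  A^T = A /\ forall v : 'cV[R]_n, 0 <= (v^T *m A *m v) 0 0.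

Definition expmx {R : realType} {n : nat} (A : 'M[R]_n) : 'M[R]_n :=
  limn (series (fun k : nat => (k`!%:R)^-1 *: A ^+ k)).

(* Logarithms inside O(.) and Omega(.) are read as at least 1. *)
Definition log1 {R : realType} (t : R) : R := Num.max 1 (ln t).

(** Unit-cost RAM programs.  A program is finite syntax that does not mention
    the dimension or any real number.  The store consists of natural-number
    registers and of countably many real arrays.  A real operand [(a, i)] is
    the cell of array [a] whose index is the content of register [i], which
    gives indirect addressing.  Register arithmetic is exact, but restricted to
    addition and truncated subtraction; a register is turned into a real only
    with rounding, and a real is never turned into a register. *)
Inductive binop := Add | Sub | Mul | Div.

Inductive unop := Sqrt | Exp | Ln | Sin | Cos | Atan.

Definition cell : Type := (nat * nat)%type.

Inductive instr :=
  | IConst of nat & nat         (* register := literal *)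
  | IAdd of nat & nat & nat     (* destination first, here and below *)
  | ISub of nat & nat & nat
  | RCopy of cell & cell
  | ROfNat of cell & nat
  | RBin of binop & cell & cell & cell
  | RUn of unop & cell & cell
  | MatVec of nat & nat.        (* on the first n cells of two arrays *)

Inductive test :=
  | ILt of nat & nat
  | RLt of cell & cell.

Inductive prog :=
  | Do of instr
  | Seq of prog & prog
  | If of test & prog & prog
  | While of test & prog.

Record store (R : Type) := Store {
  ireg : nat -> nat;
  rarr : nat -> nat -> R
}.

(** The rounded operations of the computer, among them the product with the
    input matrix, together with the time [mvtime] of that product. *)
Record machine (R : realType) (n : nat) := Machine {
  fl_bin : binop -> R -> R -> R;
  fl_un : unop -> R -> R;
  fl_nat : nat -> R;
  fl_mv : 'cV[R]_n -> 'cV[R]_n;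
  mvtime : nat
}.

Section Precision.
Context {R : realType}.

Definition bin_exact (o : binop) (x y : R) : R :=
  match o with Add => x + y | Sub => x - y | Mul => x * y | Div => x / y end.

Definition un_exact (o : unop) (x : R) : R :=
  match o with
  | Sqrt => Num.sqrt x | Exp => expR x | Ln => ln x
  | Sin => sin x | Cos => cos x | Atan => atan x
  end.

(* Outside these domains the library functions are total by convention, and the
   result of the machine is left unconstrained. *)
Definition bin_dom (o : binop) (y : R) : Prop :=
  match o with Div => y <> 0 | _ => True end.

Definition un_dom (o : unop) (x : R) : Prop :=
  match o with Sqrt => 0 <= x | Ln => 0 < x | _ => True end.

Definition rounds_to (u v w : R) : Prop :=
  exists2 d : R, `|d| <= u & w = (1 + d) * v.

(** [M] computes with relative precision [u] and its matrix is [A]. *)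
Definition has_precision (n : nat) (u : R) (A : 'M[R]_n) (M : machine R n) :=
  [/\ forall o x y, bin_dom o y ->
        rounds_to u (bin_exact o x y) (fl_bin M o x y),
      forall o x, un_dom o x -> rounds_to u (un_exact o x) (fl_un M o x),
      forall k : nat, rounds_to u k%:R (fl_nat M k) &
      forall w : 'cV[R]_n, enorm (fl_mv M w - A *m w)
        <= 2 * n%:R `^ (3 / 2) * specnorm A * enorm w * u].

End Precision.

Section Semantics.
Context {R : realType} {n : nat} (M : machine R n).
Implicit Types (s : store R) (c d e : cell).

Definition iset s (i k : nat) : store R :=
  Store (fun j => if j == i then k else ireg s j) (rarr s).

Definition rget s c : R := rarr s c.1 (ireg s c.2).

Definition rset s c (x : R) : store R :=
  Store (ireg s) (fun a j =>
    if (a == c.1) && (j == ireg s c.2) then x else rarr s a j).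

Definition vget s (a : nat) : 'cV[R]_n := \col_(i < n) rarr s a i.

Definition vset s (a : nat) (v : 'cV[R]_n) : store R :=
  Store (ireg s) (fun b j =>
    if (b == a) then (if insub j is Some i then v i 0 else rarr s b j)
    else rarr s b j).

Definition step (op : instr) s : store R :=
  match op with
  | IConst i k => iset s i k
  | IAdd i j k => iset s i (ireg s j + ireg s k)%N
  | ISub i j k => iset s i (ireg s j - ireg s k)%N
  | RCopy c d => rset s c (rget s d)
  | ROfNat c i => rset s c (fl_nat M (ireg s i))
  | RBin o c d e => rset s c (fl_bin M o (rget s d) (rget s e))
  | RUn o c d => rset s c (fl_un M o (rget s d))
  | MatVec a b => vset s a (fl_mv M (vget s b))
  end.

Definition cost (op : instr) : nat :=
  if op is MatVec _ _ then mvtime M else 1%N.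

Definition holds (b : test) s : bool :=
  match b with
  | ILt i j => (ireg s i < ireg s j)%N
  | RLt c d => rget s c < rget s d
  end.

(** [exec p s t s']: started in [s], the program [p] halts after time [t] in
    the store [s']. *)
Inductive exec : prog -> store R -> nat -> store R -> Prop :=
  | ExecDo op s : exec (Do op) s (cost op) (step op s)
  | ExecSeq p q s t1 s1 t2 s2 :
      exec p s t1 s1 -> exec q s1 t2 s2 -> exec (Seq p q) s (t1 + t2) s2
  | ExecThen b p q s t s1 :
      holds b s -> exec p s t s1 -> exec (If b p q) s t.+1 s1
  | ExecElse b p q s t s1 :
      ~~ holds b s -> exec q s t s1 -> exec (If b p q) s t.+1 s1
  | ExecStop b p s : ~~ holds b s -> exec (While b p) s 1 s
  | ExecLoop b p s t1 s1 t2 s2 :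
      holds b s -> exec p s t1 s1 -> exec (While b p) s1 t2 s2 ->
      exec (While b p) s (t1 + t2).+1 s2.

(* Executions are deterministic, so the existence of a halting execution is
   termination, and its final store is the result of the run. *)
Lemma exec_det p s t1 s1 t2 s2 :
  exec p s t1 s1 -> exec p s t2 s2 -> t1 = t2 /\ s1 = s2.
Proof.
move=> ex; elim: ex t2 s2 => {p s t1 s1};
  intros;
  match goal with |- ?t = ?t2 /\ _ =>
    match goal with H : exec _ _ t2 _ |- _ => inversion H; subst; clear H end
  end;
  try by match goal with h : is_true (holds _ _), h' : is_true (~~ _) |- _ =>
    rewrite h in h' end.
all: repeat match goal with
  IH : (forall t s, exec ?p ?s0 t s -> _), H : exec ?p ?s0 _ _ |- _ =>
    case: (IH _ _ H) => ? ?; subst; clear H end.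
all: by [].
Qed.

End Semantics.

(** Conventions for input and output: the dimension is in register 0, the vector
    [x] in array 0, the accuracy in cell 0 of array 1, everything else being
    0; the result is left in array 2.  The matrix is available only through
    [MatVec], and neither its norm nor the precision is given. *)
Definition input {R : realType} {n : nat} (x : 'cV[R]_n) (eps : R) : store R :=
  Store (fun i => if i == 0%N then n else 0%N)
    (fun a j => match a with
      | 0%N => if insub j is Some i then x i 0 else 0
      | 1%N => if j == 0%N then eps else 0
      | _ => 0
      end).

Definition output {R : realType} (n : nat) (s : store R) : 'cV[R]_n :=
  vget s 2.

(* Main.v *)
(** With [P = 1 - A / (2 h)], the vectors [t k = T_k(P) x] (Chebyshev) satisfy
    [t (k+1) = 2 P (t k) - t (k-1)] and
    [exp(-A) x = sum_k exp(-2h) I_|k|(2h) t |k|], the sum being over all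
    integers and [I] the modified Bessel functions.  The program computes the
    weights by Miller's algorithm: the recurrence
    [c (k-1) = (k / h) c k + c (k+1)] is run downwards from [c (K+1) = 0], and
    the result is normalized at the end.  All its terms are positive, so it is
    insensitive to rounding.

    Neither Bessel functions nor a spectral decomposition occur in the proof.
    For large [N], [exp(-A) x] is close to [(1 - A / N)^N x], and a step
    [1 - A / N = (1 - p) + p P], with [p = 2h / N], acts on the index [k] of
    [t k] as a step of a lazy random walk on the integers.  The law of the walk
    after [N] steps satisfies, up to [O(1/N)], Miller's recurrence; two
    solutions of it agree once normalized, because the difference of suitable
    multiples vanishes at [0] and alternates in sign.  Killing the walk at
    [K + 1] and using that [1 - A / N] is a contraction, whatever the value of
    [h], one sees that the error is governed by the largest [|t k|], the
    probability of being killed, and the rounding errors in the recurrence for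
    [t].  Hence the result can be trusted as soon as all the computed [t k]
    have norm [O(|x|)].  The program checks this and doubles [h] when it fails,
    which cannot happen once [4 h] exceeds the norm of [A]. *)

Require Import Defs.
From mathcomp Require Import all_boot all_order all_algebra.
From mathcomp Require Import all_classical all_reals all_analysis.
From mathcomp Require Import ring lra zify.
Set Implicit Arguments.
Unset Strict Implicit.
Unset Printing Implicit Defensive.
Import Order.TTheory GRing.Theory Num.Theory.
Import numFieldNormedType.Exports.
Local Open Scope ring_scope.

(** [N] occurs only in the analysis. It is chosen after the run, so large that the [O(1/N)] defect
    of the walk's recurrence drops below the rounding error of Miller's, and the distance left to
    the exponential is an arbitrary [eta]. All other errors must then stay bounded as [N] grows;
    they do because the walk moves with probability [p = 2h / N] only, and [N * p = 2h]. The cut-off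
    is [K = 4J] with [J ^ 2 >= 16 h H], where [600 * exp (- 2H) <= eps]. The walk has variance about
    [2h]; tilting it by [rho = 1 + sqrt (H / h)] costs a factor [exp H] and gains at least
    [exp (3H)] beyond [K], so it is killed with probability [O(exp (- 2H))]. The same [J] makes
    Miller's sequence decay by a factor [exp (2H)] before [K], so that the arbitrary top value does
    not matter. A failed attempt certifies [4h < |A|]. Hence [h] stays [O(H + max (|A|, 1))], and a
    degree [O(sqrt (h H))] gives the square root in the time bound, while the number of doublings
    gives a logarithmic factor. *)

(** * Lazy random walks on the integers *)

(* Symmetric sequences on the integers are stored on [nat]; [wt] counts the
   indices [k] and [- k]. *)
Definition wt {R : realFieldType} (k : nat) : R := if k is 0 then 1 else 2.

Lemma wt_ge0 (R : realFieldType) k : 0 <= wt k :> R.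
Proof. by case: k => [|k] /=. Qed.

Lemma sum_wt (R : realFieldType) K :
  \sum_(k < K.+1) wt k = (2 * K + 1)%:R :> R.
Proof.
elim: K => [|K IH]; first by rewrite big_ord_recl big_ord0 /= addr0.
by rewrite big_ord_recr /= IH /= !natrD !natrM -[K.+1]addn1 natrD; ring.
Qed.

Section Walk.
Context {R : realFieldType}.
Variable p : R.

Definition walk_op (f : nat -> R) (k : nat) : R :=
  (1 - p) * f k + (if k is j.+1 then p / 2 * (f j + f j.+2) else p * f 1%N).

(** Summation by parts: [walk_op] is self-adjoint for the weights [wt], up to the flow through the
    end [K]. This moves a step of the walk from the law to a test function. *)
Lemma walk_op_parts (w f : nat -> R) K :
  \sum_(k < K.+1) wt k * walk_op w k * f k =
  \sum_(k < K.+1) wt k * w k * walk_op f k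
    + p * (w K.+1 * f K - w K * f K.+1).
Proof.
elim: K => [|K IH].
  by rewrite !big_ord_recl !big_ord0 /= /walk_op /=; ring.
by rewrite big_ord_recr IH [in RHS]big_ord_recr /= /walk_op /=; field.
Qed.

Fixpoint walk (s : nat) : nat -> R :=
  if s is r.+1 then walk_op (walk r) else fun k => (k == 0%N)%:R.

(* The walk killed outside of [- K .. K]. *)
Fixpoint kwalk (K s : nat) : nat -> R :=
  if s is r.+1 then fun k => if (k <= K)%N then walk_op (kwalk K r) k else 0
  else fun k => (k == 0%N)%:R.

Definition kmass (K s : nat) : R := \sum_(k < K.+1) wt k * kwalk K s k.

Lemma kwalk_out K s : kwalk K s K.+1 = 0.
Proof. by case: s => //= s; rewrite ltnn. Qed.

Lemma sum_kwalkS K s (f : nat -> R) :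
  \sum_(k < K.+1) wt k * kwalk K s.+1 k * f k =
  \sum_(k < K.+1) wt k * kwalk K s k * walk_op f k - p * (kwalk K s K * f K.+1).
Proof.
rewrite (eq_bigr (fun k : 'I_K.+1 => wt k * walk_op (kwalk K s) k * f k)).
  by rewrite walk_op_parts kwalk_out mul0r sub0r mulrN.
by move=> k _ /=; rewrite -ltnS ltn_ord.
Qed.

Lemma kmass0 K : kmass K 0 = 1.
Proof.
rewrite /kmass big_ord_recl big1 => [|k _] /=; last by rewrite mulr0.
by rewrite addr0 mulr1.
Qed.

Lemma walk_op_cst c k : walk_op (fun=> c) k = c.
Proof. by case: k => [|k]; rewrite /walk_op /=; field. Qed.

(** The walk leaves at both ends, each with probability [p / 2], hence the factor [p]. *)
Lemma kmassS K s : kmass K s.+1 = kmass K s - p * kwalk K s K.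
Proof.
have := sum_kwalkS K s (fun=> 1).
under eq_bigr do rewrite mulr1; rewrite -/(kmass K s.+1) => ->.
under eq_bigr do rewrite walk_op_cst mulr1.
by rewrite mulr1.
Qed.

Lemma walk_supp s k : (s < k)%N -> walk s k = 0.
Proof.
elim: s k => [|s IH] [|k] //= sk.
by rewrite /walk_op /= !IH ?(mulr0, addr0) //; lia.
Qed.

Lemma walk_mass s K : (s <= K)%N -> \sum_(k < K.+1) wt k * walk s k = 1.
Proof.
elim: s K => [|s IH] K sK.
  by rewrite big_ord_recl big1 => [|k _] /=; rewrite ?mulr0 // addr0 mulr1.
have /= := walk_op_parts (walk s) (fun=> 1) K.
under eq_bigr do rewrite mulr1; move=> ->.
under eq_bigr do rewrite walk_op_cst mulr1.
by rewrite (IH K (ltnW sK)) !walk_supp ?subrr ?mul0r ?mulr0 ?subr0 ?addr0 //; lia.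
Qed.

(** The generating function of [walk s] is [G ^ s] with [G(y) = 1 - p + p / 2 * (y + 1 / y)]; the
    identity compares coefficients in [y (G ^ (s+1))' = (s+1) G ^ s * y G']. It is the discrete form
    of [(2k / z) I_k = I_(k-1) - I_(k+1)]. *)
Lemma walk_rec s k :
  k.+1%:R * walk s.+1 k.+1 = s.+1%:R * p / 2 * (walk s k - walk s k.+2).
Proof.
elim: s k => [|s IH] k.
  by case: k => [|[|k]]; rewrite /= /walk_op /=; field.
have E1 := IH k; have E2 := IH k.+1.
(* Each neighbour is given its own index as factor, the form to which the induction hypothesis
   applies. *)
have -> : k.+1%:R * walk s.+2 k.+1 = (1 - p) * (k.+1%:R * walk s.+1 k.+1)
   + p / 2 * (k%:R * walk s.+1 k + walk s.+1 k
              + (k.+2%:R * walk s.+1 k.+2 - walk s.+1 k.+2)).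
  by rewrite {1}/walk /= -/walk /walk_op -!natr1; ring.
rewrite E1 E2 -[s.+2%:R]natr1.
case: k {E1 E2} => [|k]; last rewrite IH.
  by rewrite /= /walk_op /=; field.
by rewrite /= /walk_op /=; field.
Qed.

(** * Positivity, mass and escape probability of the walk *)

Section Positive.
Hypotheses (p_ge0 : 0 <= p) (p_lt1 : p < 1).

Lemma walk_op_ge0 (f : nat -> R) k : (forall j, 0 <= f j) -> 0 <= walk_op f k.
Proof.
move=> f0; rewrite /walk_op addr_ge0 ?mulr_ge0 ?subr_ge0 ?(ltW p_lt1) //.
by case: k => [|k]; rewrite mulr_ge0 ?addr_ge0 // divr_ge0.
Qed.

Lemma walk_op_le (f g : nat -> R) k :
  (forall j, f j <= g j) -> walk_op f k <= walk_op g k.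
Proof.
move=> fg; rewrite /walk_op lerD ?ler_wpM2l ?subr_ge0 ?(ltW p_lt1) //.
by case: k => [|k]; rewrite ler_wpM2l ?lerD // divr_ge0.
Qed.

Lemma walk_ge0 s k : 0 <= walk s k.
Proof. by elim: s k => [|s IH] k //=; rewrite walk_op_ge0. Qed.

Lemma kwalk_ge0 K s k : 0 <= kwalk K s k.
Proof.
by elim: s k => [|s IH] k //=; case: ifP => // _; rewrite walk_op_ge0.
Qed.

Lemma kwalk_le K s k : kwalk K s k <= walk s k.
Proof.
elim: s k => [|s IH] k //=; case: ifP => _; first exact: walk_op_le.
by apply: walk_op_ge0 => j; apply: walk_ge0.
Qed.

Lemma walk0_gt0 s : 0 < walk s 0.
Proof.
elim: s => [|s IH] /=; first exact: ltr01.
by rewrite /walk_op ltr_pwDl ?mulr_ge0 ?walk_ge0 ?mulr_gt0 ?subr_gt0.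
Qed.

Lemma walk_mass_le s K : \sum_(k < K.+1) wt k * walk s k <= 1.
Proof.
rewrite -(@walk_mass s (maxn s K)) ?leq_maxl //.
rewrite -!(big_mkord xpredT (fun k => wt k * walk s k)).
have KM : (K.+1 <= (maxn s K).+1)%N by rewrite ltnS leq_maxr.
rewrite [leRHS](big_cat_nat (n := K.+1)) //= lerDl sumr_ge0 // => k _.
by rewrite mulr_ge0 ?wt_ge0 ?walk_ge0.
Qed.

Lemma kmass_le1 K s : kmass K s <= 1.
Proof.
apply: le_trans (walk_mass_le s K); apply: ler_sum => k _.
by rewrite ler_wpM2l ?wt_ge0 ?kwalk_le.
Qed.

(* The potential [rho ^ k + rho ^- k] is an eigenfunction of [walk_op]. *)
Lemma kmass_hit K s (rho : R) : 1 <= rho ->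
  (1 - kmass K s) * rho ^+ K.+1
    <= 2 * (1 + p * (rho - 1) ^+ 2 / (2 * rho)) ^+ s.
Proof.
move=> rho1; have rho0 : 0 < rho by apply: lt_le_trans rho1.
pose f k : R := rho ^+ k + rho ^- k.
pose g := 1 + p * (rho - 1) ^+ 2 / (2 * rho).
have g1 : 1 <= g.
  rewrite /g lerDl; apply: divr_ge0; first exact: mulr_ge0 (sqr_ge0 _).
  by apply: mulr_ge0 (ltW rho0).
have fE k : walk_op f k = g * f k.
  case: k => [|k]; rewrite /walk_op /f /g ?expr0 ?invr1 ?expr1.
    by field; rewrite gt_eqF.
  rewrite !exprS !invfM; have rk : rho ^+ k != 0 by rewrite expf_neq0 ?gt_eqF.
  by field; rewrite rk gt_eqF.
have f0 k : 0 <= f k by rewrite addr_ge0 ?invr_ge0 ?exprn_ge0 ?(ltW rho0).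
(* The killed mass is kept, frozen at the value [f K.+1]. The total starts at [2] and grows at most
   by [g] per step, since freezing only loses a factor [g >= 1]. *)
have pot : (\sum_(k < K.+1) wt k * kwalk K s k * f k)
    + (1 - kmass K s) * f K.+1 <= 2 * g ^+ s.
  elim: s => [|s IH].
    rewrite kmass0 subrr mul0r addr0 big_ord_recl big1 => [|k _] /=.
      by rewrite /f !expr0 invr1 !mulr1 mul1r addr0.
    by rewrite mulr0 mul0r.
  rewrite sum_kwalkS kmassS.
  under eq_bigr do rewrite fE mulrCA.
  rewrite -mulr_sumr; have -> : 2 * g ^+ s.+1 = g * (2 * g ^+ s).
    by rewrite exprS mulrCA.
  apply: le_trans (ler_wpM2l (le_trans ler01 g1) IH).
  have := kmass_le1 K s; have := f0 K.+1; rewrite -subr_ge0 => fK mK.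
  have : (g - 1) * ((1 - kmass K s) * f K.+1) >= 0.
    by rewrite !mulr_ge0 ?subr_ge0 // -subr_ge0.
  by lra.
apply: le_trans pot; rewrite -[leLHS]add0r lerD ?sumr_ge0 //.
  by move=> k _; rewrite !mulr_ge0 ?wt_ge0 ?kwalk_ge0.
rewrite ler_wpM2l ?subr_ge0 ?kmass_le1 // /f lerDl.
by rewrite invr_ge0 exprn_ge0 ?ltW.
Qed.

End Positive.
End Walk.

(** * Three-term recurrences *)

Section Recurrence.
Context {R : realFieldType}.

Lemma sum_wt_pairs (a : nat -> R) K :
  \sum_(k < K.+1) wt k * a k = \sum_(k < K) (a k + a k.+1) + a K.
Proof.
elim: K => [|K IH]; first by rewrite big_ord_recl !big_ord0 /= mul1r addr0 add0r.
by rewrite big_ord_recr IH [in RHS]big_ord_recr /=; ring.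
Qed.

(* The sums [a k + a k.+1] grow by the factor [1 + kap] whenever [k] decreases
   by 2, as long as [k >= 2 * J]. *)
Lemma backward_growth (a : nat -> R) (J : nat) (z kap : R) :
  (0 < J)%N -> 0 < z -> 0 <= kap -> kap * z <= 2 * J%:R ->
  (forall k, 0 <= a k) ->
  (forall k, (k < 4 * J)%N -> k.+1%:R / z * a k.+1 + a k.+2 <= a k) ->
  (8 * J + 1)%:R * (a (4 * J)%N + a (4 * J).+1) * (1 + kap) ^+ J
    <= 4 * \sum_(k < (4 * J).+1) wt k * a k.
Proof.
move=> J0 z0 kap0 kapz a0 arec.
pose m k := a k + a k.+1.
have m0 k : 0 <= m k by rewrite addr_ge0.
have mono k : (k < 4 * J)%N -> m k.+1 <= m k.
  move=> kJ; rewrite /m; have := arec k kJ.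
  have : 0 <= k.+1%:R / z * a k.+1 by rewrite mulr_ge0 // divr_ge0 // ltW.
  by lra.
(* The recurrences at [k] and [k.+1] are added, and [mono] is used once. *)
have mono2 k : (k.+1 < 4 * J)%N -> (1 + k.+1%:R / z) * m k.+2 <= m k.
  move=> kJ; have := arec k (ltnW kJ); have := arec k.+1 kJ.
  have := mono k.+1 kJ; rewrite /m -[k.+2%:R]natr1 => h1 h2 h3.
  have k0 : 0 <= k.+1%:R / z by rewrite divr_ge0 // ltW.
  have := ler_wpM2l k0 h1.
  have : 0 <= 1 / z * a k.+2 by rewrite mulr_ge0 // divr_ge0 // ltW.
  by move: h2; rewrite mulrDl; lra.
have pow i : (i <= J)%N -> (1 + kap) ^+ i * m (4 * J)%N <= m (4 * J - 2 * i)%N.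
  elim: i => [|i IH] iJ; first by rewrite expr0 mul1r subn0.
  have -> : (4 * J - 2 * i.+1)%N = (4 * J - 2 * i).-2 by lia.
  have kE : (4 * J - 2 * i)%N = (4 * J - 2 * i).-2.+2 by lia.
  move: (IH (ltnW iJ)); rewrite kE; set k := _.-2 => IHi.
  have kJ : (k.+1 < 4 * J)%N by lia.
  have k2 : (2 * J <= k.+1)%N by lia.
  apply: le_trans (mono2 k kJ); rewrite exprS -mulrA.
  apply: (@le_trans _ _ ((1 + kap) * m k.+2)).
    by rewrite ler_wpM2l // addr_ge0.
  rewrite ler_wpM2r // lerD2l ler_pdivlMr //; apply: le_trans kapz _.
  by rewrite -natrM ler_nat.
have mdec i j : (i + j <= 4 * J)%N -> m (i + j)%N <= m i.
  elim: j => [|j IH] ij; first by rewrite addn0.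
  by rewrite addnS (le_trans (mono _ _)) ?IH //; lia.
(* The [2J + 1] sums [m i] with [i <= 2J] are all at least [m (2J)]; the factor [4] of the statement
   turns [2J + 1] into [8J + 1]. *)
have big : (2 * J + 1)%:R * m (2 * J)%N <= \sum_(k < (4 * J).+1) wt k * a k.
  rewrite sum_wt_pairs -(big_mkord xpredT m) (big_cat_nat (n := (2 * J + 1)%N)) //=; last lia.
  rewrite -addrA -[leLHS]addr0 lerD //; last first.
    by rewrite addr_ge0 // sumr_ge0.
  rewrite big_mkord mulr_natl -[X in _ *+ X]card_ord -sumr_const.
  apply: ler_sum => i _; have i2 := ltn_ord i.
  by have := mdec i (2 * J - i)%N; rewrite subnKC; [apply; lia | lia].
have := pow J (leqnn J); have -> : (4 * J - 2 * J = 2 * J)%N by lia.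
move=> pJ; apply: le_trans (ler_wpM2l _ big) => //.
rewrite mulrA -mulrA [m _ * _]mulrC -/(m _) -natrM.
apply: le_trans (ler_wpM2l (ler0n R _) pJ) _.
by rewrite ler_wpM2r // ler_nat; lia.
Qed.

(* [F k = c k * q 0 - c 0 * q k] solves the recurrence with [F 0 = 0], so it
   alternates in sign and its size grows with [k]. *)
Lemma casorati_bound (c q alpha gam : nat -> R) (Gam : R) K :
  (forall k, 0 <= c k) -> (forall k, 0 <= q k) ->
  (forall k, (k < K)%N -> 0 <= alpha k) ->
  (forall k, (k < K)%N -> 1 <= gam k <= Gam) -> 1 <= Gam ->
  (forall k, (k < K)%N -> c k = alpha k * c k.+1 + gam k * c k.+2) ->
  (forall k, (k < K)%N -> q k = alpha k * q k.+1 + gam k * q k.+2) ->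
  forall k, (k <= K)%N -> `|c k * q 0 - c 0 * q k|
    <= Gam ^+ K * ((c K + c K.+1) * q 0 + c 0 * (q K + q K.+1)).
Proof.
move=> c0 q0 al0 gamP Gam1 crec qrec.
pose F k := c k * q 0 - c 0 * q k.
have Frec k : (k < K)%N -> F k = alpha k * F k.+1 + gam k * F k.+2.
  by move=> kK; rewrite /F (crec k kK) (qrec k kK); ring.
have alt k : (k <= K)%N -> F k * F k.+1 <= 0.
  elim: k => [|k IH] kK; first by rewrite /F mulrC subrr mulr0.
  have /andP[g1 _] := gamP k kK.
  have g0 : 0 < gam k by apply: lt_le_trans g1.
  rewrite -(pmulr_rle0 _ g0).
  have -> : gam k * (F k.+1 * F k.+2) = F k * F k.+1 - alpha k * F k.+1 ^+ 2.
    by rewrite [F k]Frec //; ring.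
  rewrite subr_le0 (le_trans (IH (ltnW kK))) //.
  by rewrite mulr_ge0 ?sqr_ge0 ?al0.
(* By [alt], [F k] and [- alpha k * F k.+1] do not have opposite signs, so there is no cancellation
   in their sum [gam k * F k.+2]. *)
have grow k : (k < K)%N -> `|F k| <= Gam * `|F k.+2|.
  move=> kK; have /andP[g1 gG] := gamP k kK.
  have g0 : 0 <= gam k by apply: le_trans g1.
  apply: (@le_trans _ _ (gam k * `|F k.+2|)); last by rewrite ler_wpM2r.
  rewrite -{1}(ger0_norm g0) -normrM -ler_sqr ?nnegrE // !real_normK ?num_real //.
  have -> : gam k * F k.+2 = F k - alpha k * F k.+1 by rewrite [F k]Frec //; ring.
  have := alt k (ltnW kK); rewrite -oppr_ge0 => /(mulr_ge0 (al0 k kK)).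
  have := sqr_ge0 (alpha k * F k.+1).
  by rewrite [X in _ -> _ -> _ <= X]sqrrB; lra.
set X := (c K + c K.+1) * q 0 + c 0 * (q K + q K.+1).
have FX : `|F K| <= X /\ `|F K.+1| <= X.
  have h k : `|F k| <= c k * q 0 + c 0 * q k.
    by rewrite /F (le_trans (ler_normB _ _)) // !ger0_norm ?mulr_ge0.
  split; apply: le_trans (h _) _; rewrite /X;
  have := mulr_ge0 (c0 K) (q0 0%N); have := mulr_ge0 (c0 K.+1) (q0 0%N);
  have := mulr_ge0 (c0 0%N) (q0 K); have := mulr_ge0 (c0 0%N) (q0 K.+1); by lra.
have X0 : 0 <= X by case: FX => /(le_trans (normr_ge0 _)).
have main i : (i <= K)%N ->
    `|F (K - i)%N| <= Gam ^+ i * X /\ `|F (K - i).+1| <= Gam ^+ i * X.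
  elim: i => [|i IH] iK; first by rewrite subn0 expr0 mul1r.
  have [IH1 IH2] := IH (ltnW iK).
  have e : (K - i = (K - i.+1).+1)%N by lia.
  rewrite e in IH1 IH2; split; last first.
    by apply: (le_trans IH1); rewrite exprS -mulrA ler_peMl // mulr_ge0 // exprn_ge0 //
      (le_trans _ Gam1).
  apply: le_trans (grow _ _) _; first by lia.
  by rewrite exprS -mulrA ler_wpM2l // (le_trans _ Gam1).
move=> k kK; have [] := main (K - k)%N (leq_subr _ _).
rewrite subKn // => h _; apply: (le_trans h).
by rewrite ler_wpM2r // ler_weXn2l ?leq_subr.
Qed.

(** By [casorati_bound] the sequences [c] and [q] are nearly proportional, hence close once
    normalized. As [w <= q <= q / Sq], going from [q / Sq] to [w] costs exactly the mass missing
    from [w]. In the application [q] is the law of the walk and [w] that of the killed walk. *)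
Lemma coef_close (c q w alpha gam : nat -> R) (Gam del : R) K :
  (forall k, 0 <= c k) -> (forall k, 0 <= q k) -> 0 < q 0 -> 0 < c 0 ->
  (forall k, (k < K)%N -> 0 <= alpha k) ->
  (forall k, (k < K)%N -> 1 <= gam k <= Gam) -> 1 <= Gam -> Gam ^+ K <= 2 ->
  (forall k, (k < K)%N -> c k = alpha k * c k.+1 + gam k * c k.+2) ->
  (forall k, (k < K)%N -> q k = alpha k * q k.+1 + gam k * q k.+2) ->
  let Sc := \sum_(k < K.+1) wt k * c k in
  let Sq := \sum_(k < K.+1) wt k * q k in
  0 <= del -> del <= 1 / 4 ->
  (2 * K + 1)%:R * (c K + c K.+1) <= del * Sc ->
  (2 * K + 1)%:R * (q K + q K.+1) <= del * Sq ->
  Sq <= 1 -> (forall k, w k <= q k) ->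
  \sum_(k < K.+1) wt k * `|c k / Sc - w k|
    <= 16 * del + (1 - \sum_(k < K.+1) wt k * w k).
Proof.
move=> c0 q0 q00 c00 al0 gamP Gam1 GamK crec qrec Sc Sq del0 del4 cdel qdel Sq1 wq.
have Sgt (a : nat -> R) : (forall k, 0 <= a k) -> 0 < a 0 ->
    0 < \sum_(k < K.+1) wt k * a k.
  move=> a0 a00; rewrite big_ord_recl /= mul1r ltr_pwDl // sumr_ge0 // => k _.
  by rewrite mulr_ge0.
have Sc0 : 0 < Sc by apply: Sgt.
have Sq0 : 0 < Sq by apply: Sgt.
pose f k := c k * q 0 - c 0 * q k.
set a := Sc * q 0; set b := c 0 * Sq.
have a0 : 0 < a by apply: mulr_gt0.
have b0 : 0 <= b by rewrite mulr_ge0 // ltW.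
have fsum : \sum_(k < K.+1) wt k * `|f k| <= 2 * del * (a + b).
  apply: (@le_trans _ _ (\sum_(k < K.+1) wt k *
      (2 * ((c K + c K.+1) * q 0 + c 0 * (q K + q K.+1))))).
    apply: ler_sum => k _; rewrite ler_wpM2l ?wt_ge0 //.
    have kK : (k <= K)%N by rewrite -ltnS.
    apply: le_trans (casorati_bound c0 q0 al0 gamP Gam1 crec qrec kK) _.
    by rewrite ler_wpM2r // addr_ge0 // mulr_ge0 // addr_ge0.
  rewrite -mulr_suml sum_wt.
  have := ler_wpM2r (q0 0%N) cdel; have := ler_wpM2l (c0 0%N) qdel.
  by rewrite /a /b; lra.
have ab : `|a - b| <= 2 * del * (a + b).
  apply: le_trans fsum.
  have -> : a - b = \sum_(k < K.+1) wt k * f k.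
    rewrite /a /b /Sc /Sq mulr_suml mulr_sumr -sumrB.
    by apply: eq_bigr => k _; rewrite /f; ring.
  apply: le_trans (ler_norm_sum _ _ _) _; apply: ler_sum => k _.
  by rewrite normrM ger0_norm ?wt_ge0.
(* [del <= 1 / 4] makes [a] and [b] comparable, so that errors relative to [a + b] become errors
   relative to [a]. *)
have b3a : b <= 3 * a.
  have h : 2 * del * (a + b) <= 1 / 2 * (a + b).
    by rewrite ler_wpM2r ?addr_ge0 ?(ltW a0) //; lra.
  by move: (le_trans ab h); rewrite ler_norml => /andP[h1 h2]; lra.
have cq : \sum_(k < K.+1) wt k * `|c k / Sc - q k / Sq| <= 16 * del.
  apply: (@le_trans _ _ (4 * del * (a + b) / a)); last first.
    by rewrite ler_pdivrMr //; have := ler_wpM2l del0 b3a; lra.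
  rewrite ler_pdivlMr // mulr_suml.
  apply: (@le_trans _ _ (\sum_(k < K.+1)
     ((wt k * q k / Sq) * `|a - b| + wt k * `|f k|))).
    apply: ler_sum => k _; rewrite -mulrA -[X in _ <= X + _]mulrA.
    rewrite -[wt k * _ * _]mulrA -mulrDr ler_wpM2l ?wt_ge0 //.
    rewrite -{1}(ger0_norm (ltW a0)) -normrM.
    have -> : (c k / Sc - q k / Sq) * a = q k / Sq * (b - a) + f k.
      by rewrite /f /a /b; field; rewrite !gt_eqF.
    rewrite (le_trans (ler_normD _ _)) // lerD2r normrM distrC ger0_norm ?mulrA //.
    by rewrite divr_ge0 // ltW.
  rewrite big_split /= -!mulr_suml -/Sq divff ?gt_eqF // mul1r.
  by rewrite (le_trans (lerD ab fsum)) //; lra.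
apply: (@le_trans _ _ (\sum_(k < K.+1)
   (wt k * `|c k / Sc - q k / Sq| + wt k * (q k / Sq - w k)))).
  apply: ler_sum => k _; rewrite -mulrDr ler_wpM2l ?wt_ge0 //.
  have -> : c k / Sc - w k = (c k / Sc - q k / Sq) + (q k / Sq - w k) by ring.
  rewrite (le_trans (ler_normD _ _)) // lerD2l ger0_norm //.
  rewrite subr_ge0 (le_trans (wq k)) // ler_pdivlMr //.
  by rewrite ler_piMr.
rewrite big_split /= lerD //.
under eq_bigr do rewrite mulrBr mulrA.
by rewrite sumrB -mulr_suml -/Sq divff ?gt_eqF.
Qed.

End Recurrence.

(** * Euclidean norm *)

(** Common core of the Cauchy-Schwarz inequalities for [dot] and for the form of [A]. When [c < 0],
    or [c = 0] and [b != 0], a [t] is exhibited at which the quadratic is negative. *)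
Lemma discr_le (R : realFieldType) (a b c : R) :
  (forall t, 0 <= a + 2 * t * b + t ^+ 2 * c) -> b ^+ 2 <= a * c.
Proof.
move=> h; have a0 : 0 <= a by have := h 0; rewrite expr2; lra.
have [c0|c0|c0] := ltgtP c 0.
- exfalso; pose t := (2 * `|b| + a + 1 - c) / - c.
  have nc0 : 0 < - c by lra.
  have t1 : 1 <= t by rewrite ler_pdivlMr // mul1r; have := normr_ge0 b; lra.
  have tc : t * c = - (2 * `|b| + a + 1 - c) by rewrite /t; field; rewrite lt_eqF.
  have h1 := h t; have bn : b <= `|b| := ler_norm b.
  have h2 : t * b <= t * `|b| by rewrite ler_wpM2l //; lra.
  have h3 : a <= t * a by rewrite ler_peMl.
  have h4 : 0 < t * (1 - c) by rewrite mulr_gt0 //; lra.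
  have h5 : t ^+ 2 * c = t * (t * c) by ring.
  by move: h1; rewrite h5 tc; lra.
- have := h (- b / c); have -> : a + 2 * (- b / c) * b + (- b / c) ^+ 2 * c
    = (a * c - b ^+ 2) / c by field; rewrite gt_eqF.
  by rewrite pmulr_lge0 ?invr_gt0 // subr_ge0.
- rewrite c0 mulr0; have [->|b0] := eqVneq b 0; first by rewrite expr0n.
  have := h (- (a + 1) / (2 * b)); rewrite c0 mulr0 addr0.
  have -> : a + 2 * (- (a + 1) / (2 * b)) * b = -1 by field.
  by lra.
Qed.

Section Euclid.
Context {R : realType} {n : nat}.
Implicit Types u v w : 'cV[R]_n.

Definition dot u v : R := \sum_(i < n) u i 0 * v i 0.

Lemma dotC u v : dot u v = dot v u.
Proof. by apply: eq_bigr => i _; rewrite mulrC. Qed.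

Lemma dotDl u v w : dot (u + v) w = dot u w + dot v w.
Proof. by rewrite -big_split; apply: eq_bigr => i _; rewrite mxE mulrDl. Qed.

Lemma dotZl a u w : dot (a *: u) w = a * dot u w.
Proof. by rewrite mulr_sumr; apply: eq_bigr => i _; rewrite mxE mulrA. Qed.

Lemma dotDr u v w : dot u (v + w) = dot u v + dot u w.
Proof. by rewrite dotC dotDl !(dotC u). Qed.

Lemma dotZr a u w : dot u (a *: w) = a * dot u w.
Proof. by rewrite dotC dotZl dotC. Qed.

Lemma dotNl u v : dot (- u) v = - dot u v.
Proof. by rewrite -scaleN1r dotZl mulN1r. Qed.

Lemma dotNr u v : dot u (- v) = - dot u v.
Proof. by rewrite dotC dotNl dotC. Qed.

Lemma dot_ge0 u : 0 <= dot u u.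
Proof. by apply: sumr_ge0 => i _; rewrite -expr2 sqr_ge0. Qed.

Lemma dot_mx u v : dot u v = (u^T *m v) 0 0.
Proof. by rewrite mxE; apply: eq_bigr => i _; rewrite mxE. Qed.

Lemma dot_adj (A : 'M[R]_n) u v : dot (A *m u) v = dot u (A^T *m v).
Proof. by rewrite !dot_mx trmx_mul mulmxA. Qed.

Lemma enorm_ge0 u : 0 <= enorm u.
Proof. exact: sqrtr_ge0. Qed.

Lemma sqr_enorm u : enorm u ^+ 2 = dot u u.
Proof.
by rewrite sqr_sqrtr; [apply: eq_bigr => i _; rewrite expr2 |
  apply: sumr_ge0 => i _; rewrite sqr_ge0].
Qed.

Lemma enorm_sqr_le u (a : R) : 0 <= a -> (enorm u <= a) = (dot u u <= a ^+ 2).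
Proof. by move=> a0; rewrite -sqr_enorm ler_sqr // nnegrE enorm_ge0. Qed.

Lemma dot_le u v : dot u v <= enorm u * enorm v.
Proof.
have h : dot u v ^+ 2 <= (enorm u * enorm v) ^+ 2.
  rewrite exprMn !sqr_enorm; apply: discr_le => t.
  have := dot_ge0 (u + t *: v).
  by rewrite !dotDl !dotDr !dotZl !dotZr (dotC v u); congr (_ <= _); ring.
apply: le_trans (ler_norm _) _.
by rewrite -ler_sqr ?nnegrE ?mulr_ge0 ?enorm_ge0 // real_normK ?num_real.
Qed.

Lemma enormD u v : enorm (u + v) <= enorm u + enorm v.
Proof.
rewrite enorm_sqr_le ?addr_ge0 ?enorm_ge0 // !dotDl !dotDr (dotC v u).
by rewrite sqrrD !sqr_enorm; have := dot_le u v; lra.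
Qed.

Lemma enormZ a u : enorm (a *: u) = `|a| * enorm u.
Proof.
apply/eqP; rewrite -(@eqrXn2 _ 2) // ?mulr_ge0 ?enorm_ge0 //.
by rewrite exprMn !sqr_enorm dotZl dotZr real_normK ?num_real // mulrA.
Qed.

Lemma enormN u : enorm (- u) = enorm u.
Proof. by rewrite -scaleN1r enormZ normrN1 mul1r. Qed.

Lemma enorm0 : enorm (0 : 'cV[R]_n) = 0.
Proof. by rewrite -(scale0r 0) enormZ normr0 mul0r. Qed.

Lemma enormB u v : enorm (u - v) <= enorm u + enorm v.
Proof. by rewrite (le_trans (enormD _ _)) // enormN. Qed.

Lemma enorm_sum (I : Type) (r : seq I) (P : pred I) (F : I -> 'cV[R]_n) :
  enorm (\sum_(i <- r | P i) F i) <= \sum_(i <- r | P i) enorm (F i).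
Proof.
elim/big_ind2: _ => [|x1 x2 y1 y2 h1 h2|//]; first by rewrite enorm0.
by apply: le_trans (enormD _ _) _; rewrite lerD.
Qed.

Lemma enorm_le_entry u v : (forall i, `|u i 0| <= `|v i 0|) -> enorm u <= enorm v.
Proof.
move=> uv; rewrite enorm_sqr_le ?enorm_ge0 // sqr_enorm; apply: ler_sum => i _.
by rewrite -!expr2 -[_ ^+ 2]real_normK ?num_real // -[leRHS]real_normK ?num_real // ler_sqr
  ?nnegrE.
Qed.

Definition absv u : 'cV[R]_n := \col_i `|u i 0|.

Lemma enorm_absv u : enorm (absv u) = enorm u.
Proof.
by apply/eqP; rewrite eq_le !enorm_le_entry // => i; rewrite mxE normr_id.
Qed.

Lemma entry_le_enorm u i : `|u i 0| <= enorm u.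
Proof.
rewrite -ler_sqr ?nnegrE ?enorm_ge0 // sqr_enorm real_normK ?num_real //.
by rewrite /dot (bigD1 i) //= -expr2 lerDl sumr_ge0 // => j _; rewrite -expr2 sqr_ge0.
Qed.

Lemma mulmx_sum_col (A : 'M[R]_n) u : A *m u = \sum_j u j 0 *: col j A.
Proof.
apply/colP => i; rewrite mxE summxE; apply: eq_bigr => j _.
by rewrite !mxE mulrC.
Qed.

Lemma specnorm_has_sup (A : 'M[R]_n) :
  has_sup [set enorm (A *m v) | v in [set v : 'cV[R]_n | enorm v <= 1]]%classic.
Proof.
split.
  by exists (enorm (A *m 0)), 0 => //=; rewrite enorm0 ler01.
exists (\sum_j enorm (col j A)) => _ [v /= v1 <-].
rewrite mulmx_sum_col (le_trans (enorm_sum _ _ _)) //; apply: ler_sum => j _.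
rewrite enormZ ler_piMl ?enorm_ge0 // (le_trans _ v1) //.
exact: entry_le_enorm.
Qed.

Lemma specnorm_ge0 (A : 'M[R]_n) : 0 <= specnorm A.
Proof.
apply: le_trans (enorm_ge0 (A *m 0)) _.
by apply: ub_le_sup; [case: (specnorm_has_sup A) | exists 0 => //=; rewrite enorm0 ler01].
Qed.

Lemma enorm_eq0 u : enorm u = 0 -> u = 0.
Proof.
move=> u0; apply/colP => i; rewrite mxE; apply/eqP.
by rewrite -normr_eq0 eq_le normr_ge0 andbT -u0 entry_le_enorm.
Qed.

Lemma specnormP (A : 'M[R]_n) u : enorm (A *m u) <= specnorm A * enorm u.
Proof.
have [u0|u0] := eqVneq (enorm u) 0.
  by rewrite u0 mulr0 (enorm_eq0 u0) mulmx0 enorm0.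
have up : 0 < enorm u by rewrite lt_neqAle eq_sym u0 enorm_ge0.
rewrite -ler_pdivrMr //.
have -> : enorm (A *m u) / enorm u = enorm (A *m ((enorm u)^-1 *: u)).
  by rewrite -scalemxAr enormZ ger0_norm ?invr_ge0 ?enorm_ge0 // mulrC.
apply: ub_le_sup; first by case: (specnorm_has_sup A).
exists ((enorm u)^-1 *: u) => //=.
by rewrite enormZ ger0_norm ?invr_ge0 ?enorm_ge0 // mulVf.
Qed.

(** * The quadratic form of a positive semidefinite matrix *)

Section PSD.
Variable A : 'M[R]_n.
Hypothesis psdA : psd A.

Lemma psd_dot_ge0 u : 0 <= dot u (A *m u).
Proof. by case: psdA => _ /(_ u); rewrite -mulmxA dot_mx. Qed.

Lemma psd_dotC u v : dot (A *m u) v = dot u (A *m v).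
Proof. by case: psdA => AT _; rewrite dot_adj AT. Qed.

(** Cauchy-Schwarz for the form [dot u (A *m v)], at [u] and [A *m u]. It expresses [A ^ 2 <= |A| A]
    and takes the place of a spectral decomposition. *)
Lemma psd_dot_sqr u : dot (A *m u) (A *m u) <= specnorm A * dot u (A *m u).
Proof.
set v := A *m u.
have h : dot v v ^+ 2 <= dot u v * dot v (A *m v).
  apply: discr_le => t; have := psd_dot_ge0 (u + t *: v).
  rewrite mulmxDr -scalemxAr -/v !dotDl !dotDr !dotZl !dotZr.
  by rewrite -(psd_dotC u v) -/v; congr (_ <= _); ring.
have [v0|v0] := eqVneq (dot v v) 0.
  by rewrite v0 mulr_ge0 ?specnorm_ge0 ?psd_dot_ge0.
have vp : 0 < dot v v by rewrite lt_neqAle eq_sym v0 dot_ge0.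
rewrite -(ler_pM2r vp) -expr2 (le_trans h) //.
rewrite [specnorm A * _]mulrC -mulrA ler_wpM2l ?psd_dot_ge0 //.
apply: le_trans (dot_le _ _) _; rewrite -sqr_enorm expr2 mulrCA.
by rewrite ler_wpM2l ?enorm_ge0 ?specnormP.
Qed.

Definition shrink (z : R) u := u - z^-1 *: (A *m u).

(** In the expanded square, [|A u| ^ 2 / z ^ 2] does not exceed the cross term
    [2 / z * dot u (A *m u)], by [psd_dot_sqr]. *)
Lemma shrink_le z u : 0 < z -> specnorm A <= 2 * z -> enorm (shrink z u) <= enorm u.
Proof.
move=> z0 Az; rewrite enorm_sqr_le ?enorm_ge0 // sqr_enorm /shrink.
rewrite !(dotDl, dotDr, dotNl, dotNr, dotZl, dotZr) psd_dotC.
have h : z^-1 * dot (A *m u) (A *m u) <= 2 * dot u (A *m u).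
  rewrite mulrC ler_pdivrMr // (le_trans (psd_dot_sqr u)) //.
  by rewrite mulrAC ler_wpM2r ?psd_dot_ge0 // .
have := ler_wpM2l (ltW (_ : 0 < z^-1)) h; rewrite invr_gt0 => /(_ z0).
rewrite -psd_dotC; lra.
Qed.

Lemma shrinkC z u v : dot (shrink z u) v = dot u (shrink z v).
Proof. by rewrite /shrink dotDl dotDr dotNl dotNr dotZl dotZr psd_dotC. Qed.

Lemma shrinkD z u v : shrink z (u + v) = shrink z u + shrink z v.
Proof. by rewrite /shrink mulmxDr scalerDr opprD addrACA. Qed.

Lemma shrinkZ z a u : shrink z (a *: u) = a *: shrink z u.
Proof. by rewrite /shrink -scalemxAr scalerBr !scalerA mulrC. Qed.

Lemma shrinkN z u : shrink z (- u) = - shrink z u.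
Proof. by rewrite -scaleN1r shrinkZ scaleN1r. Qed.

End PSD.
End Euclid.

(** * Chebyshev recurrence *)

Section Cheb.
Context {R : realType} {n : nat}.
Variables (A : 'M[R]_n) (psdA : psd A).
Implicit Types u v w : 'cV[R]_n.

Lemma dot_sqrD u v : dot (u + v) (u + v) = dot u u + 2 * dot u v + enorm v ^+ 2.
Proof. by rewrite sqr_enorm !(dotDl, dotDr) (dotC v u); ring. Qed.

(* Exactly recurrent vectors are [t k = T_k(P) x]; with [b k = U_{k-1}(P) x]
   the pair [(t, b)] is rotated by each step, so that
   [|t|^2 + |b|^2 - |P b|^2] is preserved. *)
Lemma chebyshev_stable (z xi : R) (t : nat -> 'cV[R]_n) m :
  (forall v, enorm (shrink A z v) <= enorm v) ->
  (0 < m)%N -> enorm (t 1%N - shrink A z (t 0%N)) <= xi ->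
  (forall k, (k.+1 < m)%N ->
     enorm (t k.+2 - (2 *: shrink A z (t k.+1) - t k)) <= xi) ->
  enorm (t m) <= enorm (t 0%N) + m%:R ^+ 2 * xi.
Proof.
move=> Pc m0 h0 hk; set P := shrink A z in Pc h0 hk.
have PD u v : P (u + v) = P u + P v by apply: shrinkD.
have PN u : P (- u) = - P u by apply: shrinkN.
have PC u v : dot (P u) v = dot u (P v) by apply: shrinkC.
have P0 : P 0 = 0 by rewrite /P /shrink mulmx0 scaler0 subr0.
clearbody P.
have xi0 : 0 <= xi by apply: le_trans h0; rewrite enorm_ge0.
pose b := fix b k := if k is j.+1 then t j + P (b j) else 0 : 'cV[R]_n.
(* The defect in [T_(k+1) = P T_k - (1 - P ^ 2) U_(k-1)]. A step applies the contraction [P] to it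
   and adds one local error, so it grows linearly in [k], and the sum of the defects
   quadratically. *)
pose d k := t k.+1 - P (t k) + (b k - P (P (b k))).
have dE k : (k < m)%N -> enorm (d k) <= k.+1%:R * xi.
  elim: k => [|k IH] km.
    by rewrite /d /= !P0 !subr0 addr0 mul1r.
  have -> : d k.+1 = P (d k) + (t k.+2 - (2 *: P (t k.+1) - t k)).
    rewrite /d /= !(PD, PN) scaler_nat mulr2n.
    by apply/colP => i; rewrite !mxE; ring.
  rewrite (le_trans (enormD _ _)) // -[k.+2%:R]natr1 mulrDl mul1r lerD ?hk //.
  exact: le_trans (Pc _) (IH (ltnW km)).
pose N k := dot (t k) (t k) + dot (b k) (b k) - dot (P (b k)) (P (b k)).
have beta k : dot (P (b k)) (P (b k)) <= dot (b k) (b k).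
  by rewrite -!sqr_enorm ler_sqr ?nnegrE ?enorm_ge0.
have main k : (k <= m)%N -> N k <= (enorm (t 0%N) + k%:R ^+ 2 * xi) ^+ 2.
  elim: k => [|k IH] km.
    have d00 : dot (0 : 'cV[R]_n) 0 = 0 by rewrite -(sqr_enorm (0 : 'cV[R]_n)) enorm0 expr0n.
    by rewrite /N /= P0 d00 expr0n mul0r addr0 subr0 addr0 sqr_enorm.
  have {IH} := IH (ltnW km); set r := enorm _ + _ => IH.
  have r0 : 0 <= r by rewrite addr_ge0 ?enorm_ge0 ?mulr_ge0 ?sqr_ge0.
  pose a := P (b k.+1) - b k.
  have tE : t k.+1 = a + d k.
    rewrite /a /d /= !(PD, PN).
    by apply/colP => i; rewrite !mxE; ring.
  (* The exact step from the pair of index [k] leads to [a] and [b k.+1] and preserves the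
     invariant; [t k.+1] differs from [a] by the defect only. *)
  have rot : dot a a + (dot (b k.+1) (b k.+1) - dot (P (b k.+1)) (P (b k.+1))) = N k.
    rewrite /N /a !(dotDl, dotDr, dotNl, dotNr) (dotC (b k) (P (b k.+1))).
    rewrite (PC (b k.+1) (b k)).
    by rewrite /= !(PD, dotDl, dotDr) (dotC (P (b k)) (t k)); ring.
  have ar : enorm a <= r.
    rewrite enorm_sqr_le // (le_trans _ IH) // -rot lerDl subr_ge0 //.
  have nd := dE k km; have d0 := enorm_ge0 (d k).
  apply: (@le_trans _ _ ((r + enorm (d k)) ^+ 2)).
    have -> : N k.+1 = N k + 2 * dot a (d k) + enorm (d k) ^+ 2.
      by rewrite -rot /N tE dot_sqrD; ring.
    rewrite sqrrD; have := dot_le a (d k); have := ler_wpM2r d0 ar.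
    by lra.
  rewrite ler_sqr ?nnegrE ?addr_ge0 ?enorm_ge0 ?mulr_ge0 ?sqr_ge0 //.
  rewrite /r -addrA lerD2l (le_trans (lerD (lexx _) nd)) //.
  rewrite -mulrDl ler_wpM2r // -natrX -natrX -natrD ler_nat; lia.
have r0 : 0 <= enorm (t 0%N) + m%:R ^+ 2 * xi.
  by rewrite addr_ge0 ?enorm_ge0 // mulr_ge0 ?sqr_ge0.
rewrite enorm_sqr_le //; apply: le_trans (main m (leqnn m)).
by rewrite /N -addrA lerDl subr_ge0.
Qed.

Lemma shrink_sum z (I : finType) (a : I -> R) (F : I -> 'cV[R]_n) :
  shrink A z (\sum_i a i *: F i) = \sum_i a i *: shrink A z (F i).
Proof.
elim/big_rec2: _ => [|i u v _ <-]; first by rewrite /shrink mulmx0 scaler0 subr0.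
by rewrite shrinkD shrinkZ.
Qed.

(* [shrink A N u = (1 - p) u + p (shrink A z u)] with [p = z / N]: one step of
   the lazy walk on the indices [k] of [T_k] multiplies by [shrink A N]. *)
Lemma kwalk_approx (z xi B p : R) (N K : nat) (t : nat -> 'cV[R]_n) s :
  0 < z -> z < N%:R ->
  (forall v, enorm (shrink A N%:R v) <= enorm v) ->
  enorm (t 1%N - shrink A z (t 0%N)) <= xi ->
  (forall k, (k < K)%N ->
     enorm (t k.+2 - (2 *: shrink A z (t k.+1) - t k)) <= xi) ->
  enorm (t K.+1) <= B ->
  p = z / N%:R ->
  enorm (\sum_(k < K.+1) (wt k * kwalk p K s k) *: t k
         - iter s (shrink A N%:R) (t 0%N))
    <= s%:R * (p * xi) + (1 - kmass p K s) * B.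
Proof.
move=> z0 zN Nc h0 hk hB pE0.
have N0 : 0 < N%:R :> R by apply: lt_trans zN.
have p0 : 0 <= p by rewrite pE0 divr_ge0 // ltW.
have p1 : p < 1 by rewrite pE0 ltr_pdivrMr // mul1r.
have xi0 : 0 <= xi by apply: le_trans h0; rewrite enorm_ge0.
elim: s => [|s IH].
  rewrite /= kmass0 subrr !mul0r addr0 big_ord_recl big1 => [|k _] /=.
    by rewrite mulr1 scale1r addr0 subrr enorm0.
  by rewrite mulr0 scale0r.
(* How far a step of the walk on the indices fails to act as [shrink A N]. The bound carries the
   factor [p], so [N] steps contribute [N * p * xi = z * xi], whatever [N]. *)
pose e k : 'cV[R]_n := (\col_i walk_op p (fun j => t j i 0) k) - shrink A N%:R (t k).
have eP k : (k <= K)%N -> enorm (e k) <= p * xi.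
  have pE u i j : (shrink A N%:R u) i j = (1 - p) * u i j + p * (shrink A z u) i j.
    rewrite !mxE pE0; field; rewrite (gt_eqF N0) (gt_eqF z0) //.
  case: k => [|k] kK.
    have -> : e 0%N = p *: (t 1%N - shrink A z (t 0%N)).
      apply/colP => i; rewrite /e mxE [X in _ + X]mxE pE mxE /walk_op.
      by rewrite [RHS]mxE [X in _ = _ * X]mxE [X in _ = _ * (_ + X)]mxE; ring.
    by rewrite enormZ ger0_norm // ler_wpM2l.
  have -> : e k.+1 = (p / 2) *: (t k.+2 - (2 *: shrink A z (t k.+1) - t k)).
    apply/colP => i; rewrite /e mxE [X in _ + X]mxE pE mxE /walk_op.
    have E3 : (t k.+2 - (2 *: shrink A z (t k.+1) - t k)) i 0
       = t k.+2 i 0 - (2 * (shrink A z (t k.+1)) i 0 - t k i 0).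
      by move: (shrink A z (t k.+1)) => v; rewrite !mxE.
    by rewrite [RHS]mxE E3; field.
  rewrite enormZ ger0_norm ?divr_ge0 // -mulrA ler_wpM2l //.
  by have := hk k kK; lra.
set w := kwalk p K s in IH *.
have w0 k : 0 <= w k by apply: kwalk_ge0.
(* [sum_kwalkS] moves the step onto [t]; the last term is the mass killed in this step. *)
have step : \sum_(k < K.+1) (wt k * kwalk p K s.+1 k) *: t k =
    shrink A N%:R (\sum_(k < K.+1) (wt k * w k) *: t k)
    + (\sum_(k < K.+1) (wt k * w k) *: e k - (p * w K) *: t K.+1).
  rewrite shrink_sum addrA -big_split /=; apply/colP => i.
  rewrite summxE mxE summxE [X in _ + X]mxE [X in _ + - X]mxE.
  under eq_bigr do rewrite mxE.
  rewrite (sum_kwalkS p K s (fun k => t k i 0)) -/w mulrA; congr (_ - _).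
  apply: eq_bigr => k _; rewrite -scalerDr mxE; congr (_ * _).
  by rewrite /e addrC subrK mxE.
rewrite step iterS addrAC -[- shrink _ _ _]shrinkN -shrinkD.
apply: (le_trans (enormD _ _)).
apply: (le_trans (lerD (Nc _) (enormB _ _))).
apply: (@le_trans _ _ ((s%:R * (p * xi) + (1 - kmass p K s) * B) + (p * xi + p * w K * B))).
  apply: lerD => //; apply: lerD.
    apply: (@le_trans _ _ (\sum_(k < K.+1) (wt k * w k) * (p * xi))).
      apply: le_trans (enorm_sum _ _ _) _; apply: ler_sum => k _.
      rewrite enormZ ger0_norm ?mulr_ge0 ?wt_ge0 // ler_wpM2l ?mulr_ge0 ?wt_ge0 //.
      by apply: eP; rewrite -ltnS.
    rewrite -mulr_suml ler_piMl ?mulr_ge0 //.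
    exact: kmass_le1.
  by rewrite enormZ ger0_norm ?mulr_ge0 // ler_wpM2l ?mulr_ge0.
rewrite kmassS -/w -natr1; lra.
Qed.

End Cheb.

(** * The matrix exponential as a limit of powers *)

Lemma exp_coeff_series_le (R : realType) (a : R) m : 0 <= a ->
  series (exp_coeff a) m <= expR a.
Proof.
move=> a0; apply: nondecreasing_cvgn_le (is_cvg_series_exp_coeff a) m.
apply/nondecreasing_seqP => k; rewrite !seriesEnat /= big_nat_recr //= lerDl.
by rewrite /exp_coeff /= divr_ge0 ?exprn_ge0.
Qed.

(** The ratio of the coefficients of [(1 - A / N) ^ N] to those of the exponential series. *)
Lemma ffact_ratio (R : realFieldType) (N k : nat) : (0 < N)%N -> (k <= N)%N ->
  (1 - k%:R ^+ 2 / N%:R : R) <= (N ^_ k)%:R / N%:R ^+ k <= (1 : R).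
Proof.
move=> N0; have Np : 0 < N%:R :> R by rewrite ltr0n.
elim: k => [|k IH] kN.
  by rewrite ffactn0 expr0 divr1 lexx andbT lerBlDr lerDl divr_ge0 ?sqr_ge0.
have {IH} /andP[h1 h2] := IH (ltnW kN).
have -> : (N ^_ k.+1)%:R / N%:R ^+ k.+1
   = (N ^_ k)%:R / N%:R ^+ k * (1 - k%:R / N%:R) :> R.
  rewrite ffactnSr natrM natrB ?(ltnW kN) // exprS.
  by field; rewrite ?expf_neq0 gt_eqF.
set r := _ / _ ^+ _ in h1 h2 *.
have r0 : 0 <= r by rewrite divr_ge0 ?exprn_ge0.
have k0 : 0 <= k%:R / N%:R :> R by rewrite divr_ge0.
have k1 : k%:R / N%:R <= 1 :> R by rewrite ler_pdivrMr // mul1r ler_nat ltnW.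
apply/andP; split; last by rewrite mulr_ile1 // ?subr_ge0 // gerBl.
have e : k.+1%:R ^+ 2 / N%:R = k%:R ^+ 2 / N%:R + 2 * (k%:R / N%:R) + N%:R^-1 :> R.
  by rewrite -natr1; field; rewrite gt_eqF.
have i0 : 0 <= N%:R^-1 :> R by rewrite invr_ge0.
have := ler_piMl k0 h2.
by rewrite e mulrBr mulr1; lra.
Qed.

Section Exp.
Context {R : realType} {n : nat}.
Variable A : 'M[R]_n.
Implicit Types x : 'cV[R]_n.

Definition mpow x k : 'cV[R]_n := iter k (fun u => - (A *m u)) x.

Lemma mpow_expr x k : mpow x k = (- A) ^+ k *m x.
Proof.
elim: k => [|k IH]; first by rewrite /= expr0 mul1mx.
by rewrite /= IH exprS -mulmxA -mulNmx mulmxA.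
Qed.

Lemma enorm_mpow x k : enorm (mpow x k) <= specnorm A ^+ k * enorm x.
Proof.
elim: k => [|k IH]; first by rewrite expr0 mul1r.
rewrite /= enormN (le_trans (specnormP _ _)) // exprS -mulrA.
by rewrite ler_wpM2l ?specnorm_ge0.
Qed.

Lemma iter_shrink z x s :
  iter s (shrink A z) x = \sum_(k < s.+1) ('C(s, k)%:R / z ^+ k) *: mpow x k.
Proof.
elim: s => [|s IH].
  by rewrite big_ord_recl big_ord0 /= bin0 expr0 divr1 scale1r addr0.
rewrite iterS IH big_ord_recl [in RHS]big_ord_recl /= !bin0 !expr0 !divr1 !scale1r.
rewrite /bump /=.
have -> : \sum_(i < s.+1) ('C(s.+1, 1 + i)%:R / z ^+ (1 + i)) *: mpow x (1 + i) =
  \sum_(i < s.+1) ('C(s, i.+1)%:R / z ^+ i.+1) *: mpow x i.+1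
  - z^-1 *: (A *m \sum_(i < s.+1) ('C(s, i)%:R / z ^+ i) *: mpow x i).
  rewrite -scalerN mulmx_sumr -sumrN scaler_sumr -big_split /=.
  apply: eq_bigr => i _; rewrite !add1n binS natrD mulrDl scalerDl; congr (_ + _).
  rewrite -scalemxAr -scalerN scalerA; congr (_ *: _).
  by rewrite exprS invfM mulrCA.
rewrite addrA /shrink; congr (_ - _ *: (A *m _)).
  by rewrite [in RHS]big_ord_recr /= bin_small // mul0r scale0r addr0.
by rewrite [in RHS]big_ord_recl /= bin0 expr0 divr1 scale1r.
Qed.

Definition exp_partial m : 'M[R]_n :=
  series (fun k : nat => (k`!%:R)^-1 *: (- A) ^+ k) m.

Lemma exp_partial_mul x m :
  exp_partial m *m x = \sum_(k < m) (k`!%:R)^-1 *: mpow x k.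
Proof.
rewrite /exp_partial seriesEnat /= big_mkord mulmx_suml.
by apply: eq_bigr => k _; rewrite -scalemxAl mpow_expr.
Qed.

Lemma shrink_exp_partial x N : (0 < N)%N ->
  enorm (iter N (shrink A N%:R) x - exp_partial N.+1 *m x)
   <= expR (4 * specnorm A) * enorm x / N%:R.
Proof.
move=> N0; have Np : 0 < N%:R :> R by rewrite ltr0n.
rewrite iter_shrink exp_partial_mul -sumrB.
have a0 := specnorm_ge0 A.
have := @exp_coeff_series_le R (4 * specnorm A) N.+1.
rewrite mulr_ge0 // => /(_ isT) eh.
rewrite ler_pdivlMr // (le_trans _ (ler_wpM2r (enorm_ge0 x) eh)) //.
rewrite seriesEnat /= big_mkord mulr_suml.
rewrite (le_trans (ler_wpM2r (ltW Np) (enorm_sum _ _ _))) // mulr_suml.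
apply: ler_sum => k _; rewrite -scalerBl enormZ /exp_coeff /=.
have kN : (k <= N)%N by rewrite -ltnS.
have /andP[h1 h2] := @ffact_ratio R N k N0 kN.
have f0 : 0 < k`!%:R :> R by rewrite ltr0n fact_gt0.
have -> : 'C(N, k)%:R / N%:R ^+ k - k`!%:R^-1
   = ((N ^_ k)%:R / N%:R ^+ k - 1) / k`!%:R :> R.
  rewrite -bin_ffact natrM; field.
  by rewrite (gt_eqF f0) expf_neq0 // gt_eqF.
rewrite normrM normfV (ger0_norm (ltW f0)) distrC ger0_norm ?subr_ge0 //.
have h3 : (1 - (N ^_ k)%:R / N%:R ^+ k) * N%:R <= k%:R ^+ 2 :> R.
  by rewrite -ler_pdivlMr //; lra.
(* Turns the errors [k ^ 2 / (N * k!)] into the terms of the exponential series at [4 * |A|],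
   divided by [N]. *)
have h4 : k%:R ^+ 2 <= 4 ^+ k :> R.
  rewrite -!natrX ler_nat (_ : 4 = 2 ^ 2)%N // -expnM mulnC expnM leq_exp2r //.
  by rewrite leq_eqVlt ltn_expl ?orbT.
rewrite exprMn.
have E1 : (1 - (N ^_ k)%:R / N%:R ^+ k) / k`!%:R * enorm (mpow x k) * N%:R
  = ((1 - (N ^_ k)%:R / N%:R ^+ k) * N%:R) * (enorm (mpow x k) / k`!%:R) by ring.
rewrite E1 [leRHS](_ : _ = 4 ^+ k * (specnorm A ^+ k * enorm x / k`!%:R)); last by ring.
rewrite ler_pM ?mulr_ge0 ?invr_ge0 ?enorm_ge0 ?(ltW f0) ?subr_ge0 ?(ltW Np) //.
  exact: le_trans h3 h4.
by rewrite ler_wpM2r ?invr_ge0 ?(ltW f0) ?enorm_mpow.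
Qed.

(** An entry of a power is at most the norm of a column, hence at most [|A| ^ k]: each series of
    entries is dominated by the exponential series at [|A|], and there are finitely many entries. *)
Lemma expmx_entry_cvg : forall e : R, 0 < e ->
  exists m0, forall m, (m0 <= m)%N ->
    forall i j, `|expmx (- A) i j - exp_partial m i j| <= e.
Proof.
pose u i j k : R := (k`!%:R)^-1 * ((- A) ^+ k) i j.
have ucvg i j : cvgn (series (u i j)).
  apply: normed_cvg; apply: series_le_cvg (is_cvg_series_exp_coeff (specnorm A)).
  - by move=> k /=.
  - by move=> k; rewrite /exp_coeff /= divr_ge0 ?exprn_ge0 ?specnorm_ge0.
  - move=> k; rewrite /exp_coeff /= normrM ger0_norm ?invr_ge0 // mulrC.
    rewrite ler_wpM2r ?invr_ge0 //.
    pose dj : 'cV[R]_n := delta_mx j 0.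
    have -> : ((- A) ^+ k) i j = (mpow dj k) i 0.
      rewrite mpow_expr mxE (bigD1 j) //= !mxE !eqxx mulr1 big1 ?addr0 //.
      by move=> l lj; rewrite !mxE (negPf lj) mulr0.
    apply: le_trans (entry_le_enorm _ _) _; apply: le_trans (enorm_mpow _ _) _.
    rewrite ler_piMr ?exprn_ge0 ?specnorm_ge0 // enorm_sqr_le // expr1n.
    rewrite /dot (bigD1 j) //= !mxE !eqxx mulr1 big1 ?addr0 //.
    by move=> l lj; rewrite !mxE (negPf lj) mulr0.
pose E : 'M[R]_n := \matrix_(i, j) limn (series (u i j)).
have pE m i j : exp_partial m i j = series (u i j) m.
  rewrite /exp_partial !seriesEnat /= summxE.
  by apply: eq_bigr => k _; rewrite mxE.
have ent (e : R) : 0 < e ->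
   (\forall m \near \oo, forall i j, `|E i j - exp_partial m i j| < e)%classic.
  move=> e0; apply: filter_forall => i; apply: filter_forall => j.
  have := ucvg i j => /cvgrPdist_lt /(_ e e0); apply: filterS => m.
  by rewrite mxE pE.
have cE : (exp_partial @ \oo --> E)%classic.
  apply/cvg_ballP => e e0; have := ent e e0; apply: filterS => m h.
  by split => // i j; apply: h.
have -> : expmx (- A) = E by apply: cvg_lim => //; exact: norm_hausdorff.
move=> e e0; have [m0 _ h] := ent e e0; exists m0 => m mm i j.
exact: ltW (h m mm i j).
Qed.

Lemma shrink_iter_cvg x (eta : R) : 0 < eta ->
  exists N0, forall N, (N0 <= N)%N ->
    enorm (expmx (- A) *m x - iter N (shrink A N%:R) x) <= eta.
Proof.
move=> eta0.
(* Converts an entrywise error of the matrix into the norm error of its product with [x]; the added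
   ones keep [c] positive. *)
pose c := (1 + \sum_j `|x j 0|) * (1 + enorm (const_mx 1 : 'cV[R]_n)).
have s0 : 0 <= \sum_j `|x j 0| by rewrite sumr_ge0.
have n0 := enorm_ge0 (const_mx 1 : 'cV[R]_n).
have c0 : 0 < c by rewrite mulr_gt0 // ltr_wpDr.
have ec0 : 0 < eta / 2 / c by rewrite !divr_gt0.
have [m0 hm] := expmx_entry_cvg ec0.
pose D := expR (4 * specnorm A) * enorm x.
have D0 : 0 <= D by rewrite mulr_ge0 ?expR_ge0 ?enorm_ge0.
exists (maxn (maxn m0 1) (Num.truncn (D / (eta / 2))).+1) => N.
rewrite !geq_max -andbA => /and3P[m0N N0 hN].
have Np : 0 < N%:R :> R by rewrite ltr0n.
have h1 := shrink_exp_partial x N0.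
have h2 : enorm (expmx (- A) *m x - exp_partial N.+1 *m x) <= eta / 2.
  rewrite -mulmxBl.
  apply: (@le_trans _ _ (enorm ((eta / 2 / c * \sum_j `|x j 0|) *: (const_mx 1 : 'cV[R]_n)))).
    apply: enorm_le_entry => i; rewrite !mxE mulr1.
    rewrite [leRHS]ger0_norm ?mulr_ge0 ?invr_ge0 ?(ltW c0) ?(ltW eta0) //.
    apply: le_trans (ler_norm_sum _ _ _) _; rewrite mulr_sumr; apply: ler_sum => j _.
    rewrite normrM ler_wpM2r // !mxE; apply: hm.
    by rewrite (leq_trans m0N).
  rewrite enormZ ger0_norm ?mulr_ge0 ?invr_ge0 ?(ltW c0) ?(ltW eta0) //.
  rewrite [leRHS](_ : _ = eta / 2 / c * c); last by rewrite divfK // gt_eqF.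
  rewrite -[leLHS]mulrA ler_wpM2l ?mulr_ge0 ?invr_ge0 ?(ltW c0) ?(ltW eta0) //.
  by rewrite /c ler_pM // lerDr.
have h3 : D / N%:R <= eta / 2.
  rewrite ler_pdivrMr // mulrC -ler_pdivrMr ?divr_gt0 //.
  by rewrite (le_trans (ltW (truncnS_gt _))) // ler_nat.
rewrite -(subrK (exp_partial N.+1 *m x) (expmx _ *m x)) -addrA.
rewrite (le_trans (enormD _ _)) // -[_ *m x - iter _ _ _]opprB enormN.
by have := le_trans h1 h3; lra.
Qed.

End Exp.

(** * Miller's algorithm *)

Section Backward.
Context {T : Type}.
Variables (zero : T) (f : nat -> T -> T -> T).

(** The step [f] is a parameter because the same downward recursion is run with exact and with
    rounded operations. *)
Fixpoint backpair (K : nat) (a : T) (i : nat) : T * T :=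
  if i is j.+1 then
    let: (c1, c2) := backpair K a j in (f (K - i) c1 c2, c1)
  else (a, zero).

Definition backseq K a k : T := if (k <= K)%N then (backpair K a (K - k)).1 else zero.

Lemma backpair_snd K a i : (i <= K)%N ->
  backpair K a i = (backseq K a (K - i), backseq K a (K - i).+1).
Proof.
move=> iK; rewrite /backseq leq_subr subKn //.
case: i iK => [|i] iK; first by rewrite subn0 ltnn.
have -> : ((K - i.+1).+1 <= K)%N by lia.
have -> : (K - (K - i.+1).+1 = i)%N by lia.
by rewrite /=; case: (backpair K a i).
Qed.

Lemma backseq_top K a : backseq K a K = a.
Proof. by rewrite /backseq leqnn subnn. Qed.

Lemma backseq_out K a : backseq K a K.+1 = zero.
Proof. by rewrite /backseq ltnn. Qed.

Lemma backseq_rec K a k : (k < K)%N ->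
  backseq K a k = f k (backseq K a k.+1) (backseq K a k.+2).
Proof.
move=> kK; have := @backpair_snd K a (K - k.+1) (leq_subr _ _).
rewrite subKn // => e; rewrite {1}/backseq ltnW //.
have -> : (K - k = (K - k.+1).+1)%N by lia.
by rewrite /= e; congr f; lia.
Qed.

End Backward.

Lemma pow1D_le (R : realFieldType) (v : R) (k : nat) : 0 <= v -> k%:R * v <= 1 / 2 ->
  (1 + v) ^+ k <= 1 + 2 * k%:R * v.
Proof.
move=> v0; elim: k => [|k IH] kv; first by rewrite expr0 mulr0 mul0r addr0.
have kv' : k%:R * v <= 1 / 2.
  by apply: le_trans kv; rewrite ler_wpM2r // ler_nat.
rewrite exprSr (le_trans (ler_wpM2r _ (IH kv'))) ?addr_ge0 //.
by rewrite -natr1; have := ler_wpM2r v0 kv'; lra.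
Qed.

Lemma pow1B_ge (R : realFieldType) (v : R) (k : nat) : 0 <= v <= 1 ->
  1 - k%:R * v <= (1 - v) ^+ k.
Proof.
move=> /andP[v0 v1]; elim: k => [|k IH]; first by rewrite expr0 mul0r subr0.
rewrite exprSr; have v1' : 0 <= 1 - v by rewrite subr_ge0.
apply: le_trans (ler_wpM2r v1' IH).
have : 0 <= k%:R * v * v by rewrite !mulr_ge0.
by rewrite -natr1; lra.
Qed.

Lemma expR_half_le (R : realType) (kap : R) : 0 <= kap <= 1 ->
  expR (kap / 2) <= 1 + kap.
Proof.
move=> /andP[k0 k1]; have := expR_ge1Dx (- (kap / 2)).
rewrite expRN => h; have e0 := expR_gt0 (kap / 2).
have h2 : (1 + - (kap / 2)) * expR (kap / 2) <= 1.
  by rewrite -ler_pdivlMr // mul1r.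
have h3 : 0 < 1 + - (kap / 2) by lra.
rewrite -(ler_pM2l h3) (le_trans h2) //.
by have := ler_wpM2r k0 k1; lra.
Qed.

Lemma ge0_of_rec (R : realFieldType) (K : nat) (a : nat -> R) : 0 <= a K -> 0 <= a K.+1 ->
  (forall k, (k < K)%N -> 0 <= a k.+1 -> 0 <= a k.+2 -> 0 <= a k) ->
  forall k, (k <= K.+1)%N -> 0 <= a k.
Proof.
move=> aK aK1 ar.
have main i : (i <= K)%N -> 0 <= a (K - i)%N /\ 0 <= a (K - i).+1.
  elim: i => [|i IH] iK; first by rewrite subn0.
  have [h1 h2] := IH (ltnW iK).
  have e : (K - i = (K - i.+1).+1)%N by lia.
  rewrite e in h1 h2; split => //; apply: ar => //; lia.
move=> k; rewrite leq_eqVlt => /orP[/eqP -> //|]; rewrite ltnS => kK.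
by have [] := main (K - k)%N (leq_subr _ _); rewrite subKn.
Qed.

(** [6 * v] is the rounding error of a step; one more [v] pays for [al] and [ga] in place of [kh]
    and [1], and the last one for the second-order terms. *)
Lemma rec_perturb (R : realFieldType) (v al ga kh a b r : R) :
  0 <= v -> v <= 1 / 32 -> 0 <= kh -> 0 <= a -> 0 <= b ->
  (1 - v) * kh <= al <= (1 + v) * kh -> 1 <= ga <= 1 + v ->
  (1 - 6 * v) * (kh * a + b) <= r <= (1 + 6 * v) * (kh * a + b) ->
  (1 - 8 * v) * (al * a + ga * b) <= r <= (1 + 8 * v) * (al * a + ga * b).
Proof.
move=> v0 v1 kh0 a0 b0 /andP[a1 a2] /andP[g1 g2] /andP[r1 r2].
have vv : v * v <= v * (1 / 32) by rewrite ler_wpM2l.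
have vv0 : 0 <= v * v by rewrite mulr_ge0.
apply/andP; split.
  apply: le_trans r1; rewrite !mulrDr !mulrA lerD // ler_wpM2r //.
    apply: le_trans (ler_wpM2l (_ : 0 <= 1 - 8 * v) a2) _; first lra.
    by rewrite mulrA ler_wpM2r //; lra.
  by apply: le_trans (ler_wpM2l (_ : 0 <= 1 - 8 * v) g2) _; lra.
apply: (le_trans r2); rewrite !mulrDr !mulrA lerD // ler_wpM2r //.
  apply: le_trans (ler_wpM2l (_ : 0 <= 1 + 8 * v) a1); last lra.
  by rewrite mulrA ler_wpM2r //; lra.
by apply: le_trans (ler_wpM2l (_ : 0 <= 1 + 8 * v) g1); lra.
Qed.

Lemma quad_le J : (J * 2 <= (4 * J).+1)%N.
Proof. lia. Qed.

Section Miller.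
Context {R : realType}.
(* [v] bounds the relative error of a step of the computed sequence [ch], and
   [kap] is the square root of [H / h] in the application. *)
Variables (h kap H v z p : R) (J K N : nat) (ch : nat -> R).
Hypotheses (KE : K = (4 * J)%N) (zE : z = 2 * h) (pE : p = z / N%:R).
Hypotheses (J0 : (0 < J)%N) (h0 : 0 < h) (kap0 : 0 < kap) (kap1 : kap <= 1).
Hypotheses (kapz : kap ^+ 2 * z <= 2 * H) (kapJ : 4 * H <= kap * J%:R).
Hypotheses (kapJz : kap * z <= 2 * J%:R) (H0 : 16 * expR (- (2 * H)) <= 1).
Hypotheses (v0 : 0 < v) (Kv : K%:R * (8 * v) <= 1 / 4).
Hypothesis N_big : (z + 2 * K%:R + 2) * 2 <= N%:R * v.
Hypotheses (chK : 0 < ch K) (chK1 : ch K.+1 = 0).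
Hypothesis ch_rec : forall k, (k < K)%N ->
  (1 - 6 * v) * (k.+1%:R / h * ch k.+1 + ch k.+2) <= ch k
   <= (1 + 6 * v) * (k.+1%:R / h * ch k.+1 + ch k.+2).

(** The exact recurrence of the law after [N] steps, found by eliminating [walk p N.+1] between
    [walk_rec] and the definition of the walk. For large [N] the coefficients tend to Miller's
    [k.+1 / h] and [1]. *)
Let alpha (k : nat) : R := k.+1%:R / h * ((N%:R - z) / (N%:R - k%:R)).
Let gam (k : nat) : R := (N%:R + k.+2%:R) / (N%:R - k%:R).

Let K0 : (0 < K)%N. Proof. by rewrite KE muln_gt0. Qed.

Let v_small : v <= 1 / 32.
Proof.
have K1 : 1 <= K%:R :> R by rewrite ler1n.
by have := ler_wpM2r (mulr_ge0 (ler0n R 8) (ltW v0)) K1; move: Kv; lra.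
Qed.

Let z0 : 0 < z. Proof. by rewrite zE mulr_gt0. Qed.

Let N_gt : z + 2 * K%:R + 2 < N%:R.
Proof.
have s0 : 0 < z + 2 * K%:R + 2 by have := ler0n R K; have := z0; lra.
have : N%:R * v <= N%:R * (1 / 32) by rewrite ler_wpM2l.
by move: N_big; lra.
Qed.

Let N0 : 0 < N%:R :> R.
Proof. by have := N_gt; have := z0; have := ler0n R K; lra. Qed.

Let p_ge0 : 0 <= p. Proof. by rewrite pE divr_ge0 ?(ltW z0) ?(ltW N0). Qed.

Let p_lt1 : p < 1.
Proof.
by rewrite pE ltr_pdivrMr // mul1r; have := N_gt; have := ler0n R K; lra.
Qed.

Let NkE k : (k < K)%N -> 0 < N%:R - k%:R :> R /\ k%:R <= K%:R :> R.
Proof.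
move=> kK; have kK' : k%:R <= K%:R :> R by rewrite ler_nat ltnW.
by split => //; have := N_gt; have := z0; have := ler0n R K; lra.
Qed.

Let ratio_bnd k : (k < K)%N ->
  1 - v <= (N%:R - z) / (N%:R - k%:R) <= 1 + v.
Proof.
move=> kK; have [Nk kK'] := NkE kK; rewrite ler_pdivlMr // ler_pdivrMr //.
have := N_big; have := z0; have := ler0n R k; have := ltW v0 => v0' k0 z0' NB.
have := mulr_ge0 v0' k0; have : v * k%:R <= 1 * k%:R by rewrite ler_wpM2r //; have :=
  v_small; lra.
by move=> *; apply/andP; split; lra.
Qed.

Let alpha_bnd k : (k < K)%N ->
  (1 - v) * (k.+1%:R / h) <= alpha k <= (1 + v) * (k.+1%:R / h).
Proof.
move=> /ratio_bnd /andP[r1 r2].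
have kh : 0 <= k.+1%:R / h by rewrite divr_ge0 // ltW.
by rewrite /alpha ![_ * (k.+1%:R / h)]mulrC !ler_wpM2l.
Qed.

Let gam_bnd k : (k < K)%N -> 1 <= gam k <= 1 + v.
Proof.
move=> kK; have [Nk kK'] := NkE kK; rewrite /gam ler_pdivlMr // ler_pdivrMr //.
have k0 := ler0n R k; have e : k.+2%:R = k%:R + 2 :> R by rewrite -addn2 natrD.
have : v * k%:R <= 1 * k%:R by rewrite ler_wpM2r //; have := v_small; lra.
by have := N_big; have := z0; rewrite e => *; apply/andP; split; lra.
Qed.

Let alpha0 k : (k < K)%N -> 0 <= alpha k.
Proof.
move=> kK; have /andP[a _] := alpha_bnd kK; apply: le_trans a.
by rewrite mulr_ge0 ?divr_ge0 ?(ltW h0) //; have := v_small; lra.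
Qed.

Let q := walk p N.

Let q_rec k : (k < K)%N -> q k = alpha k * q k.+1 + gam k * q k.+2.
Proof.
move=> kK; have [Nk _] := NkE kK.
have := walk_rec p N k; rewrite /= /walk_op -/q => e.
apply: (mulfI (lt0r_neq0 (_ : 0 < N%:R - k%:R))) => //.
apply: (mulfI (lt0r_neq0 (_ : 0 < p / 2))); first by rewrite pE !divr_gt0.
(* The last bracket is the one that vanishes by [walk_rec]. *)
have -> : p / 2 * ((N%:R - k%:R) * q k) =
   k.+1%:R * (1 - p) * q k.+1 + p / 2 * (N%:R + k.+2%:R) * q k.+2
   + (N.+1%:R * p / 2 * (q k - q k.+2)
      - k.+1%:R * ((1 - p) * q k.+1 + p / 2 * (q k + q k.+2))).
  by rewrite -[N.+1%:R]natr1 -[k.+2%:R]natr1 -[k.+1%:R]natr1; ring.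
rewrite e subrr addr0 /alpha /gam pE zE; field.
by rewrite !gt_eqF.
Qed.

(** An intermediary: it has the top value of [ch] and differs from it by small relative errors,
    while it obeys the recurrence of the law [q], as [coef_close] requires. *)
Let c := backseq 0 (fun k a b => alpha k * a + gam k * b) K (ch K).

Let c_rec k : (k < K)%N -> c k = alpha k * c k.+1 + gam k * c k.+2.
Proof. exact: backseq_rec. Qed.

Let c0 k : 0 <= c k.
Proof.
have [kK|kK] := leqP k K.+1; last by rewrite /c /backseq leqNgt ltnW.
apply: ge0_of_rec kK; rewrite ?/c ?backseq_top ?backseq_out ?(ltW chK) //.
move=> j jK h1 h2; rewrite backseq_rec //; have /andP[g _] := gam_bnd jK.
exact: addr_ge0 (mulr_ge0 (alpha0 jK) h1) (mulr_ge0 (le_trans ler01 g) h2).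
Qed.

Let ch0 k : (k <= K.+1)%N -> 0 <= ch k.
Proof.
apply: ge0_of_rec; rewrite ?chK1 ?(ltW chK) // => j jK h1 h2.
have /andP[g _] := ch_rec jK; apply: le_trans g; rewrite mulr_ge0 //.
  by have := v_small; lra.
by rewrite addr_ge0 // mulr_ge0 // divr_ge0 // ltW.
Qed.

Let grow_of_rec (a : nat -> R) : (forall k, 0 <= a k) ->
  (forall k, (k < K)%N -> a k = alpha k * a k.+1 + gam k * a k.+2) ->
  forall k, (k < K)%N -> k.+1%:R / z * a k.+1 + a k.+2 <= a k.
Proof.
move=> a0 ar k kK; rewrite (ar k kK).
have /andP[al _] := alpha_bnd kK; have /andP[ga _] := gam_bnd kK.
rewrite lerD ?ler_wpM2r // ?ler_peMl // (le_trans _ al) //.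
have -> : k.+1%:R / z = (1 / 2) * (k.+1%:R / h) by rewrite zE; field; rewrite gt_eqF.
by rewrite ler_wpM2r ?divr_ge0 ?(ltW h0) //; have := v_small; lra.
Qed.

Let c00 : 0 < c 0.
Proof.
have main i : (i <= K)%N -> 0 < c (K - i)%N + c (K - i).+1.
  elim: i => [|i IH] iK; first by rewrite subn0 /c backseq_top backseq_out addr0.
  have {}IH := IH (ltnW iK).
  have e := esym (subnSK iK).
  rewrite e in IH; apply: (lt_le_trans IH).
  have kK : (K - i.+1 < K)%N by rewrite ltn_subrL.
  rewrite addrC lerD2r; apply: le_trans (grow_of_rec c0 c_rec kK).
  by rewrite lerDr mulr_ge0 // divr_ge0 // ltW.

have := grow_of_rec c0 c_rec K0; apply: lt_le_trans.
have := main K.-1; have -> : (K - K.-1 = 1)%N by rewrite -{1}(prednK K0) subSnn.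
move=> /(_ (leq_pred _)); have [->|c1] := eqVneq (c 1%N) 0.
  by rewrite mulr0 !add0r.
by move=> _; rewrite ltr_pwDl // mulr_gt0 ?divr_gt0 // lt_neqAle eq_sym c1 c0.
Qed.

(** All terms are nonnegative, so the relative errors of at most [8 * v] per step just multiply,
    without cancellation. *)
Let ch_close k : (k <= K)%N -> `|ch k - c k| <= K%:R * (16 * v) * c k.
Proof.
move=> kK; have v8 : 0 <= 8 * v <= 1 by have := v_small; have := v0; lra.
have main i : (i <= K)%N ->
   ((1 - 8 * v) ^+ i * c (K - i)%N <= ch (K - i)%N <= (1 + 8 * v) ^+ i * c (K - i)%N)
   /\ ((1 - 8 * v) ^+ i * c (K - i).+1 <= ch (K - i).+1 <= (1 + 8 * v) ^+ i * c (K - i).+1).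
  case/andP: v8 => v80 v81.
  elim: i => [|i IH] iK.
    by rewrite subn0 !expr0 !mul1r /c backseq_top backseq_out chK1 !lexx.
  have [/andP[h1 h2] /andP[h3 h4]] := IH (ltnW iK).
  have e := esym (subnSK iK).
  rewrite e in h1 h2 h3 h4.
  have kK' : (K - i.+1 < K)%N by rewrite ltn_subrL.
  move: (K - i.+1)%N e kK' h1 h2 h3 h4 => j e jK h1 h2 h3 h4.
  have /andP[r1 r2] := ch_rec jK.
  have /andP[a1 a2] := alpha_bnd jK; have /andP[g1 g2] := gam_bnd jK.
  have p1 : 0 <= (1 - 8 * v) ^+ i by rewrite exprn_ge0 // subr_ge0.
  have p2 : 0 <= (1 + 8 * v) ^+ i by rewrite exprn_ge0 // addr_ge0.
  have a0 := alpha0 jK; have g0 : 0 <= gam j by apply: le_trans g1.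
  have cj1 := c0 j.+1; have cj2 := c0 j.+2.
  have hj1 : 0 <= ch j.+1 by apply: ch0; rewrite ltnS ltnW.
  have hj2 : 0 <= ch j.+2 by apply: ch0.
  have vs := v_small; have v0' := ltW v0.
  have kh0 : 0 <= j.+1%:R / h by rewrite divr_ge0 // ltW.
  have /andP[lo hi] := rec_perturb v0' vs kh0 hj1 hj2 (alpha_bnd jK) (gam_bnd jK) (ch_rec jK).
  split; apply/andP; split.
  - apply: le_trans lo; rewrite c_rec // exprS -mulrA ler_wpM2l ?subr_ge0 //.
    by rewrite mulrDr lerD // mulrCA ler_wpM2l.
  - apply: (le_trans hi); rewrite c_rec // exprS -mulrA ler_wpM2l ?addr_ge0 //.
    by rewrite [leRHS]mulrDr lerD // [leRHS]mulrCA ler_wpM2l.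
  - apply: le_trans h1; rewrite exprS -mulrA ler_piMl ?mulr_ge0 //.
    by rewrite lerBlDr lerDl.
  - apply: (le_trans h2); rewrite exprS -[leRHS]mulrA ler_peMl ?mulr_ge0 //.
    by rewrite lerDl.
have [/andP[h1 h2] _] := main (K - k)%N (leq_subr _ _).
rewrite subKn // in h1 h2.
set i := (K - k)%N in h1 h2.
have iK : i%:R * (8 * v) <= K%:R * (8 * v).
  by rewrite ler_wpM2r ?ler_nat ?leq_subr //; case/andP: v8.
have v80 : 0 <= 8 * v by case/andP: v8.
have Kv0 := mulr_ge0 (ler0n R K) (ltW v0).
have l1 : (1 - 8 * v) ^+ i >= 1 - K%:R * (16 * v).
  apply: le_trans (pow1B_ge i v8); lra.
have l2 : (1 + 8 * v) ^+ i <= 1 + K%:R * (16 * v).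
  have iv : i%:R * (8 * v) <= 1 / 2 by move: Kv; lra.
  by apply: (le_trans (pow1D_le v80 iv)); lra.
have := ler_wpM2r (c0 k) l1; have := ler_wpM2r (c0 k) l2.
by rewrite ler_norml => *; apply/andP; split; lra.
Qed.

Let kapJ_exp : expR (2 * H) <= (1 + kap) ^+ J.
Proof.
apply: (@le_trans _ _ (expR (kap / 2) ^+ J)); last first.
  by rewrite lerXn2r ?nnegrE ?expR_ge0 ?addr_ge0 ?(ltW kap0) // expR_half_le // (ltW kap0).
rewrite -expRM_natl ler_expR mulrA mulrC; move: kapJ; lra.
Qed.

(** [kmass_hit] at [rho = 1 + kap]: the growth of the potential is at most [exp H] because
    [kap ^ 2 * z <= 2 * H], while [rho ^+ K.+1 >= exp (3 * H)]. *)
Let hit_le : 1 - kmass p K N <= 2 * expR (- (2 * H)).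
Proof.
have rho1 : 1 <= 1 + kap by rewrite lerDl ltW.
have h1 := kmass_hit p_ge0 p_lt1 K N rho1.
have h2 : (1 + p * (1 + kap - 1) ^+ 2 / (2 * (1 + kap))) ^+ N <= expR H.
  apply: (@le_trans _ _ (expR (p * (1 + kap - 1) ^+ 2 / (2 * (1 + kap))) ^+ N)).
    rewrite lerXn2r ?nnegrE ?expR_ge0 ?expR_ge1Dx //.
    by rewrite addr_ge0 // divr_ge0 ?mulr_ge0 ?sqr_ge0 //; have := kap0; lra.
  rewrite -expRM_natl ler_expR.
  have -> : 1 + kap - 1 = kap by ring.
  rewrite pE.
  have -> : N%:R * (z / N%:R * kap ^+ 2 / (2 * (1 + kap))) = (kap ^+ 2 * z) / (2 * (1 + kap)).
    by field; rewrite !gt_eqF //; have := kap0; lra.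
  have H0' : 0 <= H by rewrite -(pmulr_rge0 _ (ltr0Sn _ 1)) (le_trans _ kapz) // mulr_ge0
    ?sqr_ge0 ?(ltW z0).
  rewrite ler_pdivrMr; last by have := kap0; lra.
  by rewrite (le_trans kapz) //; have := mulr_ge0 H0' (ltW kap0); lra.
have e0 := expR_gt0 H.
have e3 : expR (3 * H) <= (1 + kap) ^+ K.+1.
  have ge1 : 1 <= (1 + kap) ^+ J by rewrite exprn_ege1.
  apply: (@le_trans _ _ ((1 + kap) ^+ (J * 2))).
    rewrite exprM (le_trans _ (lerXn2r 2 _ _ kapJ_exp)) ?nnegrE ?expR_ge0 ?exprn_ge0
      ?(le_trans _ rho1) //.
    rewrite -expRM_natl ler_expR.
    have H0' : 0 <= H by rewrite -(pmulr_rge0 _ (ltr0Sn _ 1)) (le_trans _ kapz) // mulr_ge0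
      ?sqr_ge0 ?(ltW z0).
    lra.
  by rewrite ler_weXn2l // KE quad_le.
have m0 : 0 <= 1 - kmass p K N by rewrite subr_ge0 kmass_le1.
have h3 := le_trans (ler_wpM2l m0 e3) (le_trans h1 (ler_wpM2l _ h2)).
rewrite -(ler_pM2r (expR_gt0 (3 * H))) (le_trans (h3 _)) // -mulrA -expRD.
by have -> : - (2 * H) + 3 * H = H by ring.
Qed.

(** [66 = 16 * 4 + 2]: [coef_close] with [del = 4 * exp (- 2 H)], where [4] is the factor of
    [backward_growth], plus the killed mass. Only [c'], not [ch], has to depend on [N]. *)
Lemma miller_accuracy : exists c' : nat -> R,
  [/\ forall k, 0 <= c' k, 0 < c' 0,
   forall k, (k <= K)%N -> `|ch k - c' k| <= K%:R * (16 * v) * c' k,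
   \sum_(k < K.+1) wt k * `|c' k / (\sum_(k < K.+1) wt k * c' k) - kwalk p K N k|
     <= 66 * expR (- (2 * H)) &
   1 - kmass p K N <= 2 * expR (- (2 * H))].
Proof.
exists c; split; [exact: c0 | exact: c00 | exact: ch_close | | exact: hit_le].
have q0 k : 0 <= q k by apply: walk_ge0.
pose del := 4 * expR (- (2 * H)).
have E0 := expR_gt0 (- (2 * H)).
have gr (a : nat -> R) : (forall k, 0 <= a k) ->
    (forall k, (k < K)%N -> a k = alpha k * a k.+1 + gam k * a k.+2) ->
    (2 * K + 1)%:R * (a K + a K.+1) <= del * \sum_(k < K.+1) wt k * a k.
  move=> a0 ar; have := @backward_growth _ a J z kap J0 z0 (ltW kap0) kapJz a0.
  rewrite -KE => /(_ (grow_of_rec a0 ar)).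
  rewrite (_ : 8 * J + 1 = 2 * K + 1)%N; last by rewrite KE mulnA.
  move=> g; rewrite /del mulrAC expRN ler_pdivlMr ?expR_gt0 //.
  by apply: le_trans g; rewrite ler_wpM2l // mulr_ge0 // addr_ge0.
have Kv2 : (1 + v) ^+ K <= 2.
  have Kv1 : K%:R * v <= 1 / 2 by move: Kv; have := mulr_ge0 (ler0n R K) (ltW v0); lra.
  by apply: le_trans (pow1D_le (ltW v0) Kv1) _; lra.
apply: le_trans (@coef_close _ c q (kwalk p K N) alpha gam (1 + v) del K c0 q0 _
  c00 alpha0 gam_bnd _ Kv2 c_rec q_rec _ _ (gr c c0 c_rec) (gr q q0 q_rec) _ _) _.
- exact: walk0_gt0.
- by rewrite lerDl ltW.
- by rewrite /del mulr_ge0 // ltW.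
- by rewrite /del; move: H0; lra.
- exact: walk_mass_le.
- by move=> k; apply: kwalk_le.
- by have := hit_le; rewrite /del /kmass; lra.
Qed.

End Miller.

(** * Rounding errors *)

Lemma rounds_err (R : realType) (u v w : R) : rounds_to u v w -> `|w - v| <= u * `|v|.
Proof.
case=> d du ->; have -> : (1 + d) * v - v = d * v by ring.
by rewrite normrM ler_wpM2r.
Qed.

Lemma rounds_pos (R : realType) (u v w : R) : 0 <= v -> rounds_to u v w ->
  (1 - u) * v <= w <= (1 + u) * v.
Proof.
move=> v0 [d]; rewrite ler_norml => /andP[d1 d2] ->.
by rewrite !ler_wpM2r //; lra.
Qed.

Lemma enorm_le3 (R : realType) n (e a b c : 'cV[R]_n) (x y z : R) :
  0 <= x -> 0 <= y -> 0 <= z ->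
  (forall i, `|e i 0| <= x * `|a i 0| + y * `|b i 0| + z * `|c i 0|) ->
  enorm e <= x * enorm a + y * enorm b + z * enorm c.
Proof.
move=> x0 y0 z0 h.
apply: (@le_trans _ _ (enorm (x *: absv a + y *: absv b + z *: absv c))).
  apply: enorm_le_entry => i; apply: (le_trans (h i)).
  by rewrite !mxE ler_norm.
rewrite (le_trans (enormD _ _)) // enormZ enorm_absv (ger0_norm z0) lerD2r.
by rewrite (le_trans (enormD _ _)) // !enormZ !enorm_absv !ger0_norm.
Qed.

Section Rounding.
Context {R : realType} {n : nat}.
Variables (M : machine R n) (A : 'M[R]_n) (u : R).
Hypotheses (prec : has_precision u A M) (u0 : 0 < u) (u1 : u <= 1 / 16).

Let flb o x y : bin_dom o y -> rounds_to u (bin_exact o x y) (fl_bin M o x y).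
Proof. by case: prec => + _ _ _; apply. Qed.

(** An entry of [2 P a - b], with [2 P a = 2 a - A a / h]; [g] is the entry of the computed product
    [A a]. *)
Definition step_entry (h a g b : R) : R :=
  fl_bin M Defs.Sub (fl_bin M Defs.Sub (fl_bin M Add a a) (fl_bin M Div g h)) b.

Lemma step_entry_err h a g b : 0 < h ->
  `|step_entry h a g b - (2 * a - g / h - b)|
    <= 8 * u * `|a| + 4 * u / h * `|g| + 4 * u * `|b|.
Proof.
move=> h0; rewrite /step_entry.
have h0' : h <> 0 by move=> e; rewrite e ltxx in h0.
have r1 := rounds_err (@flb Add a a I).
have r2 := rounds_err (@flb Div g h h0').
have /= -> : 4 * u / h * `|g| = 4 * u * `|g / h|.
  by rewrite normrM normfV (gtr0_norm h0); ring.
rewrite /= in r1 r2.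
move: (fl_bin M Add a a) (fl_bin M Div g h) (g / h) r1 r2 => w1 w2 gh r1 r2.
have r3 := rounds_err (@flb Defs.Sub w1 w2 I).
move: (fl_bin M Defs.Sub w1 w2) r3 => w3 /= r3.
have r4 := rounds_err (@flb Defs.Sub w3 b I).
move: (fl_bin M Defs.Sub w3 b) r4 => w4 /= r4.
have u0' := ltW u0.
have uu : u * u <= u * (1 / 16) by rewrite ler_wpM2l.
have aE : `|a + a| = 2 * `|a| by rewrite -mulr2n normrMn mulr_natl.
rewrite aE in r1.
have n1 : `|w1| <= `|w1 - (a + a)| + 2 * `|a|.
  by rewrite -aE -{1}(subrK (a + a) w1) ler_normD.
have n2 : `|w2| <= `|w2 - gh| + `|gh| by rewrite -{1}(subrK gh w2) ler_normD.
have n3 : `|w3| <= `|w3 - (w1 - w2)| + `|w1 - w2|.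
  by rewrite -{1}(subrK (w1 - w2) w3) ler_normD.
have n12 := ler_normB w1 w2.
have n3b := ler_normB w3 b.
have tri : `|w4 - (2 * a - gh - b)| <=
   `|w4 - (w3 - b)| + (`|w3 - (w1 - w2)| + (`|w1 - (a + a)| + `|w2 - gh|)).
  have -> : w4 - (2 * a - gh - b) = (w4 - (w3 - b)) +
     ((w3 - (w1 - w2)) + ((w1 - (a + a)) - (w2 - gh))) by ring.
  rewrite (le_trans (ler_normD _ _)) // lerD2l (le_trans (ler_normD _ _)) //.
  by rewrite lerD2l ler_normB.
pose P := 2 * `|a| + `|gh|.
have P0 : 0 <= P by rewrite addr_ge0 ?mulr_ge0.
have P1 : `|w1 - w2| <= (1 + u) * P by rewrite /P; lra.
have P3 : `|w3 - (w1 - w2)| <= u * ((1 + u) * P).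
  by rewrite (le_trans r3) // ler_wpM2l.
have P4 : `|w4 - (w3 - b)| <= u * ((1 + u) * ((1 + u) * P) + `|b|).
  by rewrite (le_trans r4) // ler_wpM2l //; lra.
have b0 := normr_ge0 b; have ub := mulr_ge0 u0' b0.
have uP := ler_wpM2r P0 uu.
have uuP := ler_wpM2l u0' uP.
have vP := mulr_ge0 u0' P0.
suff : `|w4 - (2 * a - gh - b)| <= 4 * u * (P + `|b|) by rewrite /P; lra.
apply: (le_trans tri).
have -> : 4 * u * (P + `|b|) = 4 * (u * P) + 4 * (u * `|b|) by ring.
have q4 : u * ((1 + u) * ((1 + u) * P) + `|b|) = u * P + 2 * (u * u * P) + u * (u * u * P) +
  u * `|b| by ring.
have q3 : u * ((1 + u) * P) = u * P + u * u * P by ring.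
rewrite q4 in P4; rewrite q3 in P3.
have r12 : `|w1 - (a + a)| + `|w2 - gh| <= u * P by rewrite /P; lra.
lra.
Qed.

Definition start_entry (h a g : R) : R :=
  fl_bin M Defs.Sub a (fl_bin M Div g (fl_bin M Add h h)).

Lemma start_entry_err h a g : 0 < h ->
  `|start_entry h a g - (a - g / (2 * h))| <= 4 * u * `|a| + 4 * u / h * `|g|.
Proof.
move=> h0; rewrite /start_entry.
have := @flb Add h h I; move: (fl_bin M Add h h) => z rz.
have hh : 0 <= h + h by rewrite addr_ge0 // ltW.
have /andP[/= z1 z2] := rounds_pos hh rz.
have uh : u * h <= 1 / 16 * h by rewrite ler_wpM2r // ltW.
have z0 : 0 < z by apply: lt_le_trans z1; lra.
have z0' : z <> 0 by move=> e; rewrite e ltxx in z0.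
have r2 := rounds_err (@flb Div g z z0').
move: (fl_bin M Div g z) r2 => w2 /= r2.
have r3 := rounds_err (@flb Defs.Sub a w2 I).
move: (fl_bin M Defs.Sub a w2) r3 => w3 /= r3.
(* The denominator is itself a rounded [h + h]; its relative error is charged here. *)
have zi : `|g / z - g / (2 * h)| <= u * (`|g| / h).
  have -> : g / z - g / (2 * h) = (2 * h - z) / (z * 2) * (g / h).
    by field; rewrite !gt_eqF.
  rewrite normrM [`|g / h|]normrM normfV (gtr0_norm h0) ler_wpM2r //.
    by rewrite divr_ge0 // ltW.
  rewrite normrM normfV (gtr0_norm (_ : 0 < z * 2)) ?mulr_gt0 //.
  rewrite ler_pdivrMr ?mulr_gt0 // ler_norml.
  have : u * z >= u * h by rewrite ler_wpM2l ?(ltW u0) //; lra.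
  by move=> uz; apply/andP; split; lra.
pose P := `|g| / h.
have P0 : 0 <= P by rewrite divr_ge0 // ltW.
have gz : `|g / (2 * h)| = P / 2.
  rewrite normrM normfV (gtr0_norm (_ : 0 < 2 * h)) ?mulr_gt0 // /P; field.
  by rewrite gt_eqF.
have -> : 4 * u / h * `|g| = 4 * u * P by rewrite /P; ring.
rewrite -/P in zi; move: (g / z) (g / (2 * h)) zi gz r2 => q1 q2 zi gz r2.
have n1 : `|q1| <= `|q1 - q2| + `|q2| by rewrite -{1}(subrK q2 q1) ler_normD.
have n2 : `|w2| <= `|w2 - q1| + `|q1| by rewrite -{1}(subrK q1 w2) ler_normD.
have n3 := ler_normB a w2.
have u0' := ltW u0.
have tri : `|w3 - (a - q2)| <= `|w3 - (a - w2)| + (`|w2 - q1| + `|q1 - q2|).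
  have -> : w3 - (a - q2) = (w3 - (a - w2)) - ((w2 - q1) + (q1 - q2)) by ring.
  by rewrite (le_trans (ler_normB _ _)) // lerD2l ler_normD.
have uP : u * P <= 1 / 16 * P by rewrite ler_wpM2r.
have q1P : `|q1| <= P by lra.
have e2 : `|w2 - q1| <= u * P by rewrite (le_trans r2) // ler_wpM2l.
have w2P : `|w2| <= 2 * P by lra.
have e3 : `|w3 - (a - w2)| <= u * (`|a| + 2 * P).
  by rewrite (le_trans r3) // ler_wpM2l //; lra.
have ua := mulr_ge0 u0' (normr_ge0 a).
have uP0 := mulr_ge0 u0' P0.
by apply: (le_trans tri); lra.
Qed.

(** Extension by zero to all indices, which suits loops that run over natural numbers. *)
Definition ent (v : 'cV[R]_n) (j : nat) : R := if insub j is Some i then v i 0 else 0.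

Lemma ent_ord v (i : 'I_n) : ent v i = v i 0.
Proof. by rewrite /ent insubT //= => ?; congr (v _ _); apply: val_inj. Qed.

Fixpoint sqn (v : 'cV[R]_n) (m : nat) : R :=
  if m is j.+1 then fl_bin M Add (sqn v j) (fl_bin M Mul (ent v j) (ent v j)) else 0.

Lemma sqn_bounds v m :
  (1 - u) ^+ m.+1 * (\sum_(j < m) ent v j ^+ 2) <= sqn v m
    <= (1 + u) ^+ m.+1 * (\sum_(j < m) ent v j ^+ 2).
Proof.
have lo : 0 <= 1 - u by move: u1; lra.
have hi : 0 <= 1 + u by move: u0; lra.
elim: m => [|m IH]; first by rewrite big_ord0 !mulr0 lexx.
rewrite big_ord_recr /= [(1 - u) ^+ m.+2]exprS [(1 + u) ^+ m.+2]exprS.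
have l1 : 0 <= (1 - u) ^+ m.+1 <= 1 - u.
  rewrite exprn_ge0 //= exprS ler_piMr // exprn_ile1 //.
  by rewrite lerBlDr lerDl ltW.
have l2 : 1 + u <= (1 + u) ^+ m.+1.
  by rewrite exprS ler_peMr // exprn_ege1 // lerDl ltW.
move: ((1 - u) ^+ m.+1) ((1 + u) ^+ m.+1) l1 l2 IH => a b /andP[a0 a1] b1 /andP[h1 h2].
have X0 : 0 <= \sum_(j < m) ent v j ^+ 2 by apply: sumr_ge0 => j _; rewrite sqr_ge0.
move: (\sum_(j < m) ent v j ^+ 2) X0 h1 h2 => X X0 h1 h2.
have e0 : 0 <= ent v m * ent v m by rewrite -expr2 sqr_ge0.
have /andP[m1 m2] := rounds_pos e0 (@flb Mul (ent v m) (ent v m) I).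
have s0 : 0 <= sqn v m by apply: le_trans h1; rewrite mulr_ge0.
have t0 : 0 <= fl_bin M Mul (ent v m) (ent v m) by apply: le_trans m1; rewrite mulr_ge0.
have /andP[c1 c2] := rounds_pos (addr_ge0 s0 t0) (@flb Add (sqn v m) (fl_bin M Mul (ent v m)
  (ent v m)) I).
rewrite /= -?expr2 in m1 m2 c1 c2 e0.
move: (ent v m ^+ 2) e0 (fl_bin _ _ _ _) m1 m2 t0 c1 c2 => E e0 w m1 m2 t0 c1 c2.
have k1 := ler_wpM2r e0 a1; have k2 := ler_wpM2r e0 b1.
apply/andP; split.
  by apply: le_trans c1; rewrite -mulrA ler_wpM2l // mulrDr; lra.
by apply: (le_trans c2); rewrite -mulrA ler_wpM2l // mulrDr; lra.
Qed.

Lemma sqn_enorm v : n.+1%:R * u <= 1 / 16 ->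
  3 / 4 * enorm v ^+ 2 <= sqn v n <= 5 / 4 * enorm v ^+ 2.
Proof.
move=> nu; have /andP[h1 h2] := sqn_bounds v n.
have e : \sum_(j < n) ent v j ^+ 2 = enorm v ^+ 2.
  by rewrite sqr_enorm; apply: eq_bigr => i _; rewrite ent_ord expr2.
rewrite e in h1 h2; have e0 := sqr_ge0 (enorm v).
apply/andP; split.
  apply: le_trans h1; rewrite ler_wpM2r // (le_trans _ (pow1B_ge _ _)) //; first lra.
  by move: u0 u1 => a b; apply/andP; split; lra.
apply: (le_trans h2); rewrite ler_wpM2r // (le_trans (pow1D_le (ltW u0) _)) //; lra.
Qed.

(** The exponent [3 / 2] is relaxed to [2], so that real powers disappear from the rest. *)
Lemma mv_err v : enorm (fl_mv M v - A *m v)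
  <= 2 * n%:R ^+ 2 * specnorm A * enorm v * u.
Proof.
case: prec => _ _ _ /(_ v) h; apply: (le_trans h).
have s0 := specnorm_ge0 A; have e0 := enorm_ge0 v.
rewrite !ler_wpM2r ?(ltW u0) //.
have [->|n0] := posnP n; first by rewrite powR0 ?mulr0 ?mulr_ge0 // ; lra.
rewrite ler_wpM2l // -powR_mulrn // ler_powR ?ler1n //; lra.
Qed.

End Rounding.

(** The [ce k] approximate half of [g k], because the weight of [t 0] is halved instead of doubling
    all others; dividing by their sum removes the factor. The final division costs [9 / 7], the
    rounded sums [16 / 7] and the weights [16 / 7], together less than [6]. *)
Lemma normalize_err (R : realType) n K (g ce : nat -> R) (t : nat -> 'cV[R]_n)
    (Y out : 'cV[R]_n) (Sh tau B : R) :
  (forall k, (k < K)%N -> 0 <= g k) -> 0 < \sum_(k < K) g k ->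
  0 <= tau -> tau <= 1 / 8 -> 0 <= B ->
  (forall k, (k < K)%N -> `|2 * ce k - g k| <= tau * g k) ->
  (forall k, (k < K)%N -> enorm (t k) <= B) ->
  `|Sh - \sum_(k < K) ce k| <= tau * \sum_(k < K) ce k ->
  enorm (Y - \sum_(k < K) ce k *: t k) <= tau * B * \sum_(k < K) ce k ->
  (forall i, `|out i 0 - Y i 0 / Sh| <= tau * `|Y i 0 / Sh|) ->
  enorm (out - \sum_(k < K) (g k / \sum_(k < K) g k) *: t k) <= 6 * tau * B.
Proof.
move=> g0 S0 tau0 tau1 B0 hce ht hS hY hout.
set S := \sum_(k < K) g k in S0 *.
set s := \sum_(k < K) ce k in hS hY *.
set V := \sum_(k < K) ce k *: t k in hY *.
have tauB : 0 <= tau * B by rewrite mulr_ge0.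
have s2 : `|2 * s - S| <= tau * S.
  rewrite /s /S mulr_sumr -sumrB [leRHS]mulr_sumr.
  by rewrite (le_trans (ler_norm_sum _ _ _)) //; apply: ler_sum => k _; apply: hce.
move: (s2); rewrite ler_norml => /andP[s2a s2b].
have tS : tau * S <= 1 / 8 * S by rewrite ler_wpM2r // ltW.
have s0 : 0 < s by lra.
have ts : tau * s <= 1 / 8 * s by rewrite ler_wpM2r // ltW.
move: (hS); rewrite ler_norml => /andP[hSa hSb].
have Sh0 : 0 < Sh by lra.
have ce0 k : (k < K)%N -> 0 <= ce k.
  move=> kK; have := hce k kK; have gk := g0 k kK; rewrite ler_norml => /andP[h1 _].
  by have : tau * g k <= 1 / 8 * g k by [rewrite ler_wpM2r]; lra.
have ratio : s / Sh <= 8 / 7 by rewrite ler_pdivrMr //; lra.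
have VB : enorm V <= B * s.
  rewrite (le_trans (enorm_sum _ _ _)) // mulr_sumr; apply: ler_sum => k _.
  by rewrite enormZ ger0_norm ?ce0 // mulrC ler_wpM2r ?ce0 ?ht.
have tBs : tau * B * s <= 1 / 8 * (B * s).
  by rewrite -mulrA ler_wpM2r // mulr_ge0 // ltW.
have YB : enorm Y <= 9 / 8 * (B * s).
  rewrite -(subrK V Y) (le_trans (enormD _ _)) //; lra.
have e1 : enorm (out - Sh^-1 *: Y) <= 9 / 7 * (tau * B).
  apply: (@le_trans _ _ (tau * enorm (Sh^-1 *: Y))).
    rewrite -(ger0_norm tau0) -enormZ; apply: enorm_le_entry => i.
    have -> : (out - Sh^-1 *: Y) i 0 = out i 0 - Y i 0 / Sh by rewrite !mxE mulrC.
    by rewrite (le_trans (hout i)) // !mxE [leRHS]normrM (ger0_norm tau0) [Sh^-1 * _]mulrC.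
  rewrite enormZ (gtr0_norm (_ : 0 < Sh^-1)) ?invr_gt0 //.
  have : Sh^-1 * enorm Y <= 9 / 7 * B.
    rewrite mulrC ler_pdivrMr // (le_trans YB) //.
    have : B * s <= B * (8 / 7 * Sh) by rewrite ler_wpM2l // -ler_pdivrMr.
    lra.
  by move=> /(ler_wpM2l tau0); lra.
have e2 : enorm (Sh^-1 *: Y - s^-1 *: V) <= 16 / 7 * (tau * B).
  have -> : Sh^-1 *: Y - s^-1 *: V = Sh^-1 *: (Y - V) + ((s - Sh) / (Sh * s)) *: V.
    have -> : (s - Sh) / (Sh * s) = Sh^-1 - s^-1 by field; rewrite !gt_eqF.
    by rewrite scalerBr scalerBl addrA subrK.
  rewrite (le_trans (enormD _ _)) // !enormZ (gtr0_norm (_ : 0 < Sh^-1)) ?invr_gt0 //.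
  rewrite normrM distrC normfV (gtr0_norm (mulr_gt0 Sh0 s0)).
  apply: (@le_trans _ _ (Sh^-1 * (tau * B * s) + tau * s / (Sh * s) * (B * s))).
    rewrite lerD ?ler_wpM2l ?invr_ge0 ?(ltW Sh0) //.
    rewrite ler_pM ?enorm_ge0 ?mulr_ge0 ?invr_ge0 ?mulr_ge0 ?(ltW Sh0) ?(ltW s0) //.
    by rewrite ler_wpM2r // invr_ge0 mulr_ge0 ?(ltW Sh0) ?(ltW s0).
  have -> : Sh^-1 * (tau * B * s) + tau * s / (Sh * s) * (B * s) = 2 * (tau * B) * (s / Sh).
    by field; rewrite !gt_eqF.
  have tB2 : 0 <= 2 * (tau * B) by rewrite mulr_ge0.
  by apply: le_trans (ler_wpM2l tB2 ratio) _; lra.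
have e3 : enorm (s^-1 *: V - \sum_(k < K) (g k / S) *: t k) <= 16 / 7 * (tau * B).
  rewrite /V scaler_sumr -sumrB (le_trans (enorm_sum _ _ _)) //.
  apply: (@le_trans _ _ (\sum_(k < K) (16 / 7 * tau) * B * (g k / S))); last first.
    rewrite -mulr_sumr -mulr_suml -/S divff ?gt_eqF //; lra.
  apply: ler_sum => k _; rewrite scalerA -scalerBl enormZ mulrAC.
  rewrite ler_pM ?enorm_ge0 ?ht //.
  have -> : s^-1 * ce k - g k / S = ((2 * ce k - g k) * S - g k * (2 * s - S)) / (2 * s * S).
    by field; rewrite !gt_eqF.
  have gk := g0 k (ltn_ord k).
  rewrite normrM normfV (gtr0_norm (_ : 0 < 2 * s * S)) ?mulr_gt0 //.
  rewrite ler_pdivrMr ?mulr_gt0 //.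
  have -> : 16 / 7 * tau * (g k / S) * (2 * s * S) = 16 / 7 * tau * g k * (2 * s).
    by field; rewrite !gt_eqF.
  rewrite (le_trans (ler_normB _ _)) // !normrM (gtr0_norm S0) (ger0_norm gk).
  have a1 := ler_wpM2r (ltW S0) (hce k (ltn_ord k)).
  have a2 := ler_wpM2l gk s2.
  have tg : 0 <= tau * g k by rewrite mulr_ge0.
  have a3 : tau * g k * S <= tau * g k * (8 / 7 * (2 * s)) by rewrite ler_wpM2l //; lra.
  lra.
have -> : out - \sum_(k < K) (g k / S) *: t k = (out - Sh^-1 *: Y) +
    ((Sh^-1 *: Y - s^-1 *: V) + (s^-1 *: V - \sum_(k < K) (g k / S) *: t k)).
  by rewrite !addrA !subrK.
have e4 := enormD (Sh^-1 *: Y - s^-1 *: V) (s^-1 *: V - \sum_(k < K) (g k / S) *: t k).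
by apply: (le_trans (enormD _ _)); lra.
Qed.

(** * The values computed by the program *)

Section Model.
Context {R : realType} {n : nat}.
Variable M : machine R n.
Variables (x : 'cV[R]_n) (h : R) (K : nat).

(* [tpair k] is the pair of [t (k-1)] and [t k], with [t (-1)] set to [P x];
   [wcoef] halves the weight of [t 0], which occurs once in the symmetric sum. *)
Definition bcoef : nat -> R :=
  backseq 0 (fun k a b => fl_bin M Add
    (fl_bin M Mul (fl_bin M Div (fl_nat M k.+1) h) a) b) K (fl_nat M 1).

Definition wcoef (k : nat) : R :=
  if k is 0 then fl_bin M Div (bcoef 0) (fl_nat M 2) else bcoef k.

Definition stepv (a b : 'cV[R]_n) : 'cV[R]_n :=
  \col_i step_entry M h (a i 0) (fl_mv M a i 0) (b i 0).

Definition startv : 'cV[R]_n := \col_i start_entry M h (x i 0) (fl_mv M x i 0).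

Fixpoint tpair (k : nat) : 'cV[R]_n * 'cV[R]_n :=
  if k is j.+1 then ((tpair j).2, stepv (tpair j).2 (tpair j).1) else (startv, x).

Definition tv k := (tpair k).2.

Fixpoint yv (k : nat) : 'cV[R]_n :=
  if k is j.+1 then
    \col_i fl_bin M Add (yv j i 0) (fl_bin M Mul (wcoef j) (tv j i 0))
  else 0.

Fixpoint Sv (k : nat) : R :=
  if k is j.+1 then fl_bin M Add (Sv j) (wcoef j) else 0.

(** The index [K.+1] has weight zero; it is included so that [t K.+1] is tested too, whose norm
    multiplies the killed mass in [kwalk_approx]. *)
Definition outv : 'cV[R]_n := \col_i fl_bin M Div (yv K.+2 i 0) (Sv K.+2).

(** The threshold [8] leaves room on both sides: passing implies [|t k| <= 4 |x|] in spite of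
    rounding, and a norm of at most [1.01 |x|] is sure to pass. *)
Definition passes k := ~~ (fl_bin M Mul (fl_nat M 8) (sqn M x n) < sqn M (tv k) n).

End Model.

(** * Error analysis of one attempt, with [h] and [K] fixed *)

Section Attempt.
Context {R : realType} {n : nat}.
Variables (M : machine R n) (A : 'M[R]_n) (u al : R) (x : 'cV[R]_n) (h eps : R) (J K : nat).
Hypotheses (n0 : (0 < n)%N) (psdA : psd A) (prec : has_precision u A M).
Hypotheses (u0 : 0 < u) (h1 : 1 <= h) (al1 : 1 <= al) (Aal : specnorm A <= al).
Hypotheses (eps0 : 0 < eps) (eps1 : eps <= 1) (KE : K = (4 * J)%N) (J0 : (0 < J)%N).
(** [n ^ 2 * al * u] is the error of a matrix product, [K.+2 ^ 2] its growth in [chebyshev_stable],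
    and [h] stems from the factor [N * p = 2 * h] in [kwalk_approx]. *)
Hypothesis Big : 100 * 100 * (K.+2%:R ^+ 2 * n%:R ^+ 2 * al * h * u) <= eps.

Local Notation X := (enorm x).
Local Notation n2 := (n%:R ^+ 2 : R).
Local Notation tv := (tv M x h).
Local Notation P := (shrink A (2 * h)).

Let n21 : 1 <= n2. Proof. by rewrite exprn_ege1 // ler1n. Qed.

Let K21 : 36 <= K.+2%:R ^+ 2 :> R.
Proof.
have : 6 <= K.+2%:R :> R by rewrite ler_nat KE; case: (J) J0 => // j _; rewrite mulnS.
by move=> h6; have := ler_pM (ler0n R 6) (ler0n R 6) h6 h6; rewrite expr2; lra.
Qed.

Let nal1 : 1 <= n2 * al.
Proof. by have := ler_pM ler01 ler01 n21 al1; rewrite mulr1. Qed.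

Let nah1 : n2 * al <= n2 * al * h.
Proof. by rewrite ler_peMr // (le_trans ler01 nal1). Qed.

Let bK (b : R) : 0 <= b -> b <= n2 * al * h ->
  100 * 100 * (K.+2%:R ^+ 2 * (b * u)) <= eps.
Proof.
move=> b0 bb; apply: le_trans Big; rewrite ler_wpM2l ?mulr_ge0 //.
have -> : K.+2%:R ^+ 2 * n2 * al * h * u = K.+2%:R ^+ 2 * (n2 * al * h * u) by ring.
by rewrite ler_wpM2l ?exprn_ge0 // ler_wpM2r // ltW.
Qed.

Let Ku : 100 * 100 * (K.+2%:R ^+ 2 * u) <= eps.
Proof. by have := bK ler01 (le_trans nal1 nah1); rewrite mul1r. Qed.

Let Ku1 : 100 * 100 * (K.+2%:R * u) <= eps.
Proof.
apply: le_trans Ku; rewrite ler_wpM2l // ler_wpM2r ?(ltW u0) //.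
by rewrite expr2 ler_peMr // ler1n.
Qed.

Let u_small : u <= 1 / (100 * 100).
Proof.
have : u <= K.+2%:R * u by rewrite ler_peMl ?(ltW u0) // ler1n.
by move: Ku1 eps1; lra.
Qed.

Let u1 : u <= 1 / 16. Proof. by move: u_small; lra. Qed.

Let nu : n.+1%:R * u <= 1 / 16.
Proof.
have n2n : n%:R <= n2 * al * h.
  apply: le_trans nah1; apply: (@le_trans _ _ n2); last by rewrite ler_peMr // (le_trans
    ler01 n21).
  by rewrite expr2 ler_peMr // ler1n.
have := bK (ler0n _ n) n2n.
have : 36 * (n%:R * u) <= K.+2%:R ^+ 2 * (n%:R * u) by rewrite ler_wpM2r // mulr_ge0 // ltW.
by rewrite -[n.+1%:R]natr1; move: u_small eps1; lra.
Qed.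

Let h0 : 0 < h. Proof. by apply: lt_le_trans h1. Qed.

Let mv_div_err v (hh : R) : h <= hh ->
  enorm (hh^-1 *: fl_mv M v - hh^-1 *: (A *m v)) <= 2 * (n2 * al * u) * enorm v.
Proof.
move=> hhh; have hh0 : 0 < hh by apply: lt_le_trans hhh.
rewrite -scalerBr enormZ gtr0_norm ?invr_gt0 //.
have v0 := enorm_ge0 v.
apply: (@le_trans _ _ (1 * (2 * n2 * specnorm A * enorm v * u))).
  apply: ler_pM; rewrite ?invr_ge0 ?enorm_ge0 ?(ltW hh0) ?mv_err //.
  by rewrite invf_le1 // (le_trans h1).
have -> : 2 * (n2 * al * u) * enorm v = 1 * (2 * n2 * al * enorm v * u) by ring.
by rewrite !ler_wpM2l ?ler_wpM2r ?ler_wpM2l ?mulr_ge0 ?(ltW u0) ?exprn_ge0.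
Qed.

Let mv_div v : u / h * enorm (fl_mv M v) <= 2 * (n2 * al * u) * enorm v.
Proof.
have e := mv_err prec u0 v.
have v0 := enorm_ge0 v; have s0 := specnorm_ge0 A.
have f : enorm (fl_mv M v) <= 2 * (n2 * al) * enorm v.
  rewrite -(subrK (A *m v) (fl_mv M v)) (le_trans (enormD _ _)) //.
  have sv := specnormP A v.
  have a1 : specnorm A * enorm v <= n2 * al * enorm v.
    by rewrite ler_wpM2r // (le_trans Aal) // ler_peMl // (le_trans ler01).
  have a3 := ler_wpM2l (le_trans ler01 n21) (ler_wpM2r v0 Aal).
  have a4 : 0 <= n2 * (specnorm A * enorm v) by rewrite !mulr_ge0 ?exprn_ge0.
  have a2 := ler_pM a4 (ltW u0) a3 u1.
  have : 0 <= n2 * al * enorm v by rewrite mulr_ge0 // (le_trans ler01 nal1).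
  lra.
apply: (@le_trans _ _ (u * (2 * (n2 * al) * enorm v))); last by rewrite le_eqVlt; apply/orP;
  left; apply/eqP; ring.
rewrite ler_pM ?enorm_ge0 ?divr_ge0 ?(ltW u0) ?(ltW h0) //.
by rewrite ler_pdivrMr // ler_peMr // ltW.
Qed.

Lemma stepv_err a b :
  enorm (stepv M h a b - (2 *: P a - b))
    <= 18 * (n2 * al * u) * enorm a + 4 * u * enorm b.
Proof.
set g := fl_mv M a.
have -> : stepv M h a b - (2 *: P a - b) =
    (stepv M h a b - (2 *: a - h^-1 *: g - b)) - (h^-1 *: g - h^-1 *: (A *m a)).
  have -> : 2 *: P a = 2 *: a - h^-1 *: (A *m a).
    rewrite /shrink scalerBr scalerA invfM mulrA divff ?mul1r //.
  by move: (stepv M h a b) (A *m a) => s w; apply/colP => i; rewrite !mxE; ring.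
have e1 : enorm (stepv M h a b - (2 *: a - h^-1 *: g - b))
   <= 8 * u * enorm a + 4 * u / h * enorm g + 4 * u * enorm b.
  have u0' := ltW u0; apply: enorm_le3; rewrite ?mulr_ge0 ?invr_ge0 ?(ltW h0) //.
  move=> i; have := step_entry_err prec u0 u1 (a i 0) (g i 0) (b i 0) h0.
  have -> : (stepv M h a b - (2 *: a - h^-1 *: g - b)) i 0 =
    step_entry M h (a i 0) (g i 0) (b i 0) - (2 * a i 0 - g i 0 / h - b i 0).
    by rewrite !mxE /g [_ / h]mulrC.
  by [].
have e2 := mv_div_err a (lexx h); have e3 := mv_div a.
have a0 := enorm_ge0 a.
have e4 : u * enorm a <= n2 * al * u * enorm a.
  by rewrite ler_wpM2r // ler_peMl // ltW.
rewrite -/g in e2 e3; rewrite (le_trans (enormB _ _)) //.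
have e5 : 4 * u / h * enorm g = 4 * (u / h * enorm g) by ring.
rewrite e5 in e1; lra.
Qed.

Lemma startv_err : enorm (startv M x h - P x) <= 14 * (n2 * al * u) * X.
Proof.
set g := fl_mv M x.
have -> : startv M x h - P x = (startv M x h - (x - (2 * h)^-1 *: g))
   - ((2 * h)^-1 *: g - (2 * h)^-1 *: (A *m x)).
  rewrite /shrink; move: (startv M x h) (A *m x) => s w.
  by apply/colP => i; rewrite !mxE; ring.
have e1 : enorm (startv M x h - (x - (2 * h)^-1 *: g))
   <= 4 * u * X + 4 * u / h * enorm g + 0 * X.
  have u0' := ltW u0; apply: enorm_le3; rewrite ?mulr_ge0 ?invr_ge0 ?(ltW h0) //.
  move=> i; have := start_entry_err prec u0 u1 (x i 0) (g i 0) h0.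
  have -> : (startv M x h - (x - (2 * h)^-1 *: g)) i 0 =
    start_entry M h (x i 0) (g i 0) - (x i 0 - g i 0 / (2 * h)).
    by rewrite !mxE /g [_ / (2 * h)]mulrC.
  by rewrite mul0r addr0.
have h2 : h <= 2 * h by have := h0; lra.
have e2 := mv_div_err x h2; have e3 := mv_div x.
have a0 := enorm_ge0 x.
have e4 : u * X <= n2 * al * u * X.
  by rewrite ler_wpM2r // ler_peMl // ltW.
rewrite -/g in e2 e3; rewrite (le_trans (enormB _ _)) //.
have e5 : 4 * u / h * enorm g = 4 * (u / h * enorm g) by ring.
rewrite e5 in e1; lra.
Qed.

Let xi := 96 * (n2 * al * u) * X.

(** [t 1] is computed as [2 P x] minus the approximation [startv] of [P x]. No contraction is
    available for small [h], so the size of [P x] is bounded through [|A|]. *)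
Lemma tv1_err : enorm (tv 1%N - P (tv 0%N)) <= xi.
Proof.
have e1 := stepv_err x (startv M x h); have e2 := startv_err.
have X0 := enorm_ge0 x.
have Px : enorm (P x) <= 2 * (n2 * al) * X.
  rewrite /shrink (le_trans (enormB _ _)) // enormZ.
  have -> : `|(2 * h)^-1| = (2 * h)^-1 by rewrite gtr0_norm // invr_gt0 mulr_gt0.
  have : (2 * h)^-1 * enorm (A *m x) <= 1 * (n2 * al * X).
    rewrite ler_pM ?enorm_ge0 ?invr_ge0 ?mulr_ge0 ?(ltW h0) //.
      by rewrite invf_le1 ?mulr_gt0 //; move: h1; lra.
    rewrite (le_trans (specnormP _ _)) // ler_wpM2r // (le_trans Aal) // ler_peMl //.
    by rewrite (le_trans ler01).
  have : X <= n2 * al * X by rewrite ler_peMl.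
  lra.
have uN : 0 <= n2 * al * u by rewrite mulr_ge0 ?(ltW u0) // (le_trans ler01 nal1).
have s3 : enorm (startv M x h) <= 3 * (n2 * al) * X.
  rewrite -(subrK (P x) (startv M x h)) (le_trans (enormD _ _)) //.
  have : 14 * (n2 * al * u) * X <= 14 * (n2 * al * (1 / 16)) * X.
    rewrite ler_wpM2r // ler_wpM2l // ler_wpM2l // (le_trans ler01 nal1) //.
  have : 0 <= n2 * al * X by rewrite mulr_ge0 // (le_trans ler01 nal1).
  lra.
have us : u * enorm (startv M x h) <= u * (3 * (n2 * al) * X) by rewrite ler_wpM2l // ltW.
have -> : tv 1%N - P (tv 0%N) =
   (stepv M h x (startv M x h) - (2 *: P x - startv M x h)) - (startv M x h - P x).
  rewrite -[tv 1%N]/(stepv M h x (startv M x h)) -[tv 0%N]/x.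
  move: (stepv M h x (startv M x h)) (startv M x h) (P x) => a b c.
  by apply/colP => i; rewrite !mxE; ring.
rewrite (le_trans (enormB _ _)) // /xi.
have : 0 <= n2 * al * u * X by rewrite mulr_ge0.
lra.
Qed.

Lemma tvS_err k : enorm (tv k.+1) <= 4 * X -> enorm (tv k) <= 4 * X ->
  enorm (tv k.+2 - (2 *: P (tv k.+1) - tv k)) <= xi.
Proof.
move=> h4 h5; apply: (le_trans (stepv_err (tv k.+1) (tv k))).
have X0 := enorm_ge0 x.
have uN : 0 <= n2 * al * u by rewrite mulr_ge0 ?(ltW u0) // (le_trans ler01 nal1).
have uu : u <= n2 * al * u by rewrite ler_peMl // ltW.
have a1 := ler_wpM2l uN h4; have a2 := ler_wpM2l (ltW u0) h5.
have a3 := ler_wpM2r X0 uu; have a4 := mulr_ge0 uN X0.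
rewrite /xi; lra.
Qed.

Let xi0 : 0 <= xi.
Proof.
rewrite /xi !mulr_ge0 ?(ltW u0) ?enorm_ge0 // ?exprn_ge0 //.
exact: le_trans ler01 al1.
Qed.

Let xiK : K.+2%:R ^+ 2 * xi <= 1 / 100 * X.
Proof.
have X0 := enorm_ge0 x.
have := bK (le_trans ler01 nal1) nah1 => e.
have -> : K.+2%:R ^+ 2 * xi = 96 * (K.+2%:R ^+ 2 * (n2 * al * u)) * X by rewrite /xi; ring.
by rewrite ler_wpM2r //; move: eps1; lra.
Qed.

Let hxi : 2 * h * xi <= eps / 3 * X.
Proof.
have X0 := enorm_ge0 x.
have nah0 : 0 <= n2 * al * h by rewrite (le_trans ler01) // (le_trans nal1).
have := bK nah0 (lexx _) => e.
have e2 : 36 * (n2 * al * h * u) <= K.+2%:R ^+ 2 * (n2 * al * h * u).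
  by rewrite ler_wpM2r // mulr_ge0 // ltW.
have -> : 2 * h * xi = 192 * (n2 * al * h * u) * X by rewrite /xi; ring.
by rewrite ler_wpM2r //; move: eps0; lra.
Qed.

Local Notation th := (fl_bin M Mul (fl_nat M 8) (sqn M x n)).

Let th_bounds : 5 * X ^+ 2 <= th <= 11 * X ^+ 2.
Proof.
have X2 := sqr_ge0 X.
have /andP[s1 s2] := sqn_enorm prec u0 u1 x nu.
have s0 : 0 <= sqn M x n by apply: le_trans s1; lra.
case: (prec) => flb _ fln _.
have /andP[e1 e2] := rounds_pos (ler0n R 8) (fln 8%N).
have e0 : 0 <= fl_nat M 8 by apply: le_trans e1; move: u1; lra.
have /andP[f1 f2] := rounds_pos (mulr_ge0 e0 s0) (flb Mul (fl_nat M 8) (sqn M x n) I).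
rewrite /= in f1 f2.
have g1 : 7 * (3 / 4 * X ^+ 2) <= fl_nat M 8 * sqn M x n.
  rewrite ler_pM //; first lra.
  by move: u1; lra.
have g2 : fl_nat M 8 * sqn M x n <= (17 / 2) * (5 / 4 * X ^+ 2).
  rewrite ler_pM //; by move: u1; lra.
have g0 : 0 <= fl_nat M 8 * sqn M x n by rewrite mulr_ge0.
have ug : u * (fl_nat M 8 * sqn M x n) <= 1 / (100 * 100) * (fl_nat M 8 * sqn M x n).
  by rewrite ler_wpM2r.
by apply/andP; split; lra.
Qed.

Lemma passes_le k : passes M x h k -> enorm (tv k) <= 4 * X.
Proof.
rewrite /passes -leNgt => ps.
have X0 := enorm_ge0 x; have t0 := enorm_ge0 (tv k).
have /andP[s1 _] := sqn_enorm prec u0 u1 (tv k) nu.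
have /andP[_ h2] := th_bounds.
rewrite -ler_sqr ?nnegrE ?mulr_ge0 // exprMn.
have := le_trans s1 (le_trans ps h2); rewrite -natrX; have := sqr_ge0 X; lra.
Qed.

(** For [|A| <= 4 * h] the map [P] is a contraction. The tests passed so far bound the local errors
    by [xi], and [chebyshev_stable] then keeps the next norm below [1.01 |x|]. *)
Lemma passes_of_norm k : specnorm A <= 4 * h -> (k <= K.+1)%N ->
  (forall j, (j < k)%N -> passes M x h j) -> passes M x h k.
Proof.
move=> Ah kK ps.
have X0 := enorm_ge0 x; have t0 := enorm_ge0 (tv k).
have tk : enorm (tv k) <= 101 / 100 * X.
  case: k kK ps t0 => [|k] kK ps t0; first by rewrite /= /tv /=; lra.
  have Pc v : enorm (P v) <= enorm v by apply: shrink_le => //; [rewrite mulr_gt0 | rewrite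
    mulrA -natrM].
  apply: le_trans (chebyshev_stable psdA Pc (ltn0Sn k) tv1_err _) _.
    by move=> j jk; apply: tvS_err; apply: passes_le; apply: ps => //; apply: ltnW.
  have : k.+1%:R ^+ 2 * xi <= K.+2%:R ^+ 2 * xi.
    by rewrite ler_wpM2r // -!natrX ler_nat leq_sqr leqW.
  by move: xiK; rewrite /tv /=; lra.
rewrite /passes -leNgt.
have /andP[h2 _] := th_bounds; apply: le_trans h2.
have /andP[_ s1] := sqn_enorm prec u0 u1 (tv k) nu; apply: (le_trans s1).
have := ler_pM t0 t0 tk tk; rewrite -!expr2 exprMn; have := sqr_ge0 X.
rewrite (_ : (101 / 100) ^+ 2 = 101 * 101 / (100 * 100)); last by field.
lra.
Qed.

(** * Accuracy of an attempt in which every vector passes the test *)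

Section Accuracy.
Variables (kap H : R).
Hypotheses (kap0 : 0 < kap) (kap1 : kap <= 1).
Hypotheses (kapz : kap ^+ 2 * (2 * h) <= 2 * H) (kapJ : 4 * H <= kap * J%:R).
Hypotheses (kapJz : kap * (2 * h) <= 2 * J%:R) (He : 20 * 30 * expR (- (2 * H)) <= eps).
Hypothesis all_pass : forall k, (k <= K.+1)%N -> passes M x h k.

Local Notation ch := (bcoef M h K).
Local Notation ce := (wcoef M h K).

Let flb : forall o a b, bin_dom o b -> rounds_to u (bin_exact o a b) (fl_bin M o a b).
Proof. by case: prec. Qed.
Let fln : forall k : nat, rounds_to u k%:R (fl_nat M k).
Proof. by case: prec. Qed.

Let ch_top : 0 < ch K.
Proof.
rewrite /bcoef backseq_top; have /andP[e _] := rounds_pos ler01 (fln 1%N).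
by apply: lt_le_trans e; move: u1; lra.
Qed.

Let ch_out : ch K.+1 = 0. Proof. exact: backseq_out. Qed.

(** Four roundings: conversion, division, product and sum; [(1 + u) ^ 4 <= 1 + 6 * u]. *)
Let fl_step k a b : 0 <= a -> 0 <= b ->
  let w := fl_bin M Add (fl_bin M Mul (fl_bin M Div (fl_nat M k.+1) h) a) b in
  (1 - 6 * u) * (k.+1%:R / h * a + b) <= w <= (1 + 6 * u) * (k.+1%:R / h * a + b).
Proof.
move=> a0 b0 /=.
have k0 : 0 <= k.+1%:R :> R by [].
have /andP[e1 e2] := rounds_pos k0 (fln k.+1).
move: (fl_nat M k.+1) e1 e2 => w1 e1 e2.
have lo : 0 <= 1 - u by move: u1; lra.
have hi : 0 <= 1 + u by move: u0; lra.
have w10 : 0 <= w1 by apply: le_trans e1; rewrite mulr_ge0.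
have hn : h <> 0 by move=> e; move: h0; rewrite e ltxx.
have w1h : 0 <= w1 / h by rewrite divr_ge0 // ltW.
have /andP[f1 f2] := rounds_pos w1h (@flb Div w1 h hn).
move: (fl_bin M Div w1 h) f1 f2 => w2 /= f1 f2.
have w20 : 0 <= w2 by apply: le_trans f1; rewrite mulr_ge0.
have w2a : 0 <= w2 * a by rewrite mulr_ge0.
have /andP[g1 g2] := rounds_pos w2a (@flb Mul w2 a I).
move: (fl_bin M Mul w2 a) g1 g2 => w3 /= g1 g2.
have w30 : 0 <= w3 by apply: le_trans g1; rewrite mulr_ge0.
have w3b : 0 <= w3 + b by rewrite addr_ge0.
have /andP[d1 d2] := rounds_pos w3b (@flb Add w3 b I).
move: (fl_bin M Add w3 b) d1 d2 => w4 /= d1 d2.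
pose E := k.+1%:R / h * a.
have E0 : 0 <= E by rewrite /E mulr_ge0 // divr_ge0 // ltW.
have hi0 : 0 <= h^-1 by rewrite invr_ge0 ltW.
have q1 : (1 - u) * ((1 - u) * ((1 - u) * E)) <= w3.
  apply: le_trans g1; rewrite ler_wpM2l //.
  apply: le_trans (ler_wpM2r a0 f1).
  have -> : (1 - u) * (w1 / h) * a = (1 - u) * (w1 * h^-1 * a) by ring.
  have -> : (1 - u) * E = (1 - u) * k.+1%:R * h^-1 * a by rewrite /E; ring.
  by rewrite !ler_wpM2l // !ler_wpM2r.
have q2 : w3 <= (1 + u) * ((1 + u) * ((1 + u) * E)).
  apply: (le_trans g2); rewrite ler_wpM2l //.
  apply: (le_trans (ler_wpM2r a0 f2)).
  have -> : (1 + u) * (w1 / h) * a = (1 + u) * (w1 * h^-1 * a) by ring.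
  have -> : (1 + u) * E = (1 + u) * k.+1%:R * h^-1 * a by rewrite /E; ring.
  by rewrite !ler_wpM2l // !ler_wpM2r.
rewrite -/E.
have r1 := ler_wpM2l lo (lerD q1 (lexx b)).
have r2 := ler_wpM2l hi (lerD q2 (lexx b)).
have p4 : (1 - u) ^+ 4 >= 1 - 4 * u by apply: pow1B_ge; move: u0 u1 => ? ?; apply/andP;
  split; lra.
have p4' : (1 + u) ^+ 4 <= 1 + 6 * u.
  have uu : u * u <= u * (1 / 16) by rewrite ler_wpM2l ?(ltW u0).
  have uuu := ler_wpM2l (mulr_ge0 (ltW u0) (ltW u0)) u1.
  have uuuu := ler_wpM2l (mulr_ge0 (mulr_ge0 (ltW u0) (ltW u0)) (ltW u0)) u1.
  have -> : (1 + u) ^+ 4 = 1 + 4 * u + 6 * (u * u) + 4 * (u * u * u) + u * u * u * u by ring.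
  move: u_small u0; lra.
have s1 := ler_wpM2r E0 p4; have s2 := ler_wpM2r E0 p4'.
have ub : 0 <= u * b by rewrite mulr_ge0 // ltW.
have uE : 0 <= u * E by rewrite mulr_ge0 // ltW.
apply/andP; split.
  apply: (le_trans _ (le_trans r1 d1)).
  have -> : (1 - u) * ((1 - u) * ((1 - u) * ((1 - u) * E)) + b) = (1 - u) ^+ 4 * E + (1 - u)
    * b by ring.
  lra.
apply: (le_trans (le_trans d2 r2)).
have -> : (1 + u) * ((1 + u) * ((1 + u) * ((1 + u) * E)) + b) = (1 + u) ^+ 4 * E + (1 + u) *
  b by ring.
lra.
Qed.

Let ch_ge0 k : (k <= K.+1)%N -> 0 <= ch k.
Proof.
apply: ge0_of_rec; rewrite ?ch_out ?(ltW ch_top) // => j jK a1 a2.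
rewrite /bcoef backseq_rec -/ch //; have /andP[g _] := fl_step j a1 a2.
apply: le_trans g; rewrite mulr_ge0 //; first by move: u1; lra.
by rewrite addr_ge0 // mulr_ge0 // divr_ge0 // ltW.
Qed.

Let ch_rec k : (k < K)%N ->
  (1 - 6 * u) * (k.+1%:R / h * ch k.+1 + ch k.+2) <= ch k
   <= (1 + 6 * u) * (k.+1%:R / h * ch k.+1 + ch k.+2).
Proof.
move=> kK; have -> : ch k = fl_bin M Add (fl_bin M Mul
    (fl_bin M Div (fl_nat M k.+1) h) (ch k.+1)) (ch k.+2) by apply: backseq_rec.
by apply: fl_step; apply: ch_ge0 => //; apply: ltnW.
Qed.

Let ce_ge0 k : (k <= K.+1)%N -> 0 <= ce k.
Proof.
case: k => [|k] kK; last exact: ch_ge0.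
have c0 := ch_ge0 (leq0n K.+1).
have /andP[f1 f2] := rounds_pos (ler0n R 2) (fln 2%N).
have f0 : 0 < fl_nat M 2 by apply: lt_le_trans f1; move: u1; lra.
have fn : fl_nat M 2 <> 0 by move=> e; rewrite e ltxx in f0.
have q0 : 0 <= ch 0 / fl_nat M 2 by rewrite divr_ge0 // ltW.
have /andP[g1 _] := rounds_pos q0 (@flb Div (ch 0) (fl_nat M 2) fn).
by apply: le_trans g1; rewrite mulr_ge0 //; move: u1; lra.
Qed.

(** One bound for all the relative errors of the final quotient: twice the [16 * K.+2 * u] of
    Miller's weights, which leaves room for the halved weight and the accumulated sums. *)
Let tau := 32 * (K.+2%:R * u).

Let tau0 : 0 <= tau. Proof. by rewrite !mulr_ge0 // ltW. Qed.

Let u_tau : u <= tau.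
Proof.
have : u <= K.+2%:R * u by rewrite ler_peMl ?(ltW u0) // ler1n.
by move: u0; rewrite /tau; lra.
Qed.

Let ce_close (c : nat -> R) k : (forall k, 0 <= c k) -> (k <= K)%N ->
  (forall k, (k <= K)%N -> `|ch k - c k| <= K%:R * (16 * u) * c k) ->
  `|2 * ce k - wt k * c k| <= tau * (wt k * c k).
Proof.
move=> c0 kK cc; have Ku16 : K%:R * (16 * u) <= 16 * (K.+2%:R * u).
  have : K%:R * u <= K.+2%:R * u by rewrite ler_wpM2r ?(ltW u0) // ler_nat leqW.
  lra.
have h2 j : (j <= K)%N -> `|ch j - c j| <= 16 * (K.+2%:R * u) * c j.
  by move=> jK; apply: le_trans (cc j jK) _; rewrite ler_wpM2r.
case: k kK => [|k] kK /=; last first.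
  rewrite -mulrBr normrM ger0_norm // /tau; have := h2 k.+1 kK.
  have : 0 <= K.+2%:R * u * c k.+1 by rewrite !mulr_ge0 // ltW.
  lra.
have a := h2 0%N kK; rewrite mul1r.
have ch0 := ch_ge0 (leq0n K.+1).
have /andP[f1 f2] := rounds_pos (ler0n R 2) (fln 2%N).
move: (fl_nat M 2) f1 f2 => f f1 f2.
have f0 : 0 < f by apply: lt_le_trans f1; move: u1; lra.
have fn : f <> 0 by move=> e; rewrite e ltxx in f0.
have q0 : 0 <= ch 0 / f by rewrite divr_ge0 // ltW.
have /andP[g1 g2] := rounds_pos q0 (@flb Div (ch 0) f fn).
move: (fl_bin M Div (ch 0) f) g1 g2 => w /= g1 g2.
have qE : ch 0 / f * f = ch 0 by rewrite divfK // gt_eqF.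
have us := u_small; have u0' := u0; have u1' := u1.
have qu : 0 <= ch 0 / f * u by rewrite mulr_ge0 // ltW.
have b1 := ler_wpM2l q0 f1; have b2 := ler_wpM2l q0 f2; rewrite qE in b1 b2.
have quu := ler_wpM2l qu u1.
move: (ch 0 / f) q0 g1 g2 qE qu b1 b2 quu => q q0 g1 g2 qE qu b1 b2 quu.
have d : `|2 * w - ch 0| <= 4 * (q * u).
  by rewrite ler_norml; apply/andP; split; lra.
have Kuc : K.+2%:R * u * c 0%N <= 1 / (100 * 100) * c 0%N.
  by rewrite ler_wpM2r //; move: Ku1 eps1; lra.
have chc : ch 0 <= 2 * c 0%N.
  by move: a; rewrite ler_norml => /andP[_ a2]; have := c0 0%N; lra.
have qc : q <= 2 * c 0%N.
  have : q * u <= q * (1 / 16) by rewrite ler_wpM2l.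
  lra.
have quc : q * u <= 2 * (u * c 0%N).
  by rewrite mulrC [leRHS]mulrCA ler_wpM2l // ltW.
have uc : u * c 0%N <= K.+2%:R * u * c 0%N.
  by rewrite -mulrA ler_peMl ?ler1n // mulr_ge0 // ltW.
have := ler_normD (2 * w - ch 0) (ch 0 - c 0%N); rewrite addrA subrK /tau.
have : 0 <= u * c 0%N by rewrite mulr_ge0 // ltW.
have K2 : 2 * (u * c 0%N) <= K.+2%:R * u * c 0%N.
  by rewrite -mulrA ler_wpM2r ?ler_nat // mulr_ge0 // ltW.
lra.
Qed.

Let Sv_err m : (m <= K.+2)%N ->
  `|Sv M h K m - \sum_(k < m) ce k| <= ((1 + u) ^+ m - 1) * \sum_(k < m) ce k.
Proof.
elim: m => [|m IH] mK; first by rewrite /= !big_ord0 subrr normr0 mulr0.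
have {}IH := IH (ltnW mK).
rewrite big_ord_recr /=.
have s0 : 0 <= \sum_(k < m) ce k.
  by apply: sumr_ge0 => k _; apply: ce_ge0; rewrite -ltnS (leq_trans _ mK) // ltnW // ltnS.
have c0 : 0 <= ce m by apply: ce_ge0.
have th1 : 1 <= (1 + u) ^+ m by rewrite exprn_ege1 // lerDl ltW.
have r := rounds_err (@flb Add (Sv M h K m) (ce m) I).
rewrite exprS; move: ((1 + u) ^+ m) th1 IH => T th1 IH.
move: (\sum_(k < m) ce k) (ce m) (Sv M h K m) s0 c0 IH r => s c S s0 c0 IH.
move: (fl_bin M Add S c) => w /= r.
have u0' := ltW u0.
have n1 : `|S + c| <= `|S - s| + (s + c).
  have -> : S + c = (S - s) + (s + c) by ring.
  by rewrite (le_trans (ler_normD _ _)) // [`|s + c|]ger0_norm // addr_ge0.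
have -> : w - (s + c) = (w - (S + c)) + (S - s) by ring.
rewrite (le_trans (ler_normD _ _)) //.
have m1 := le_trans r (ler_wpM2l u0' n1).
have m2 := ler_wpM2l u0' IH.
have t1 : 0 <= (T - 1) * c by rewrite mulr_ge0 // subr_ge0.
have t2 := mulr_ge0 u0' t1.
lra.
Qed.

(** Two roundings per term, hence the exponent [2 * m]. The terms may cancel, so the error is
    measured against [4 * X] times the sum of the weights, which is where the tests enter. *)
Let yv_err m : (m <= K.+2)%N ->
  enorm (yv M x h K m - \sum_(k < m) ce k *: tv k)
    <= ((1 + u) ^+ (2 * m) - 1) * (4 * X) * \sum_(k < m) ce k.
Proof.
elim: m => [|m IH] mK.
  by rewrite /= !big_ord0 subrr enorm0 mulr0.
have {}IH := IH (ltnW mK).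
have s0 : 0 <= \sum_(k < m) ce k.
  by apply: sumr_ge0 => k _; apply: ce_ge0; rewrite -ltnS (leq_trans _ mK) // ltnW // ltnS.
have B0 : 0 <= 4 * X by rewrite mulr_ge0 ?enorm_ge0.
have VB : enorm (\sum_(k < m) ce k *: tv k) <= 4 * X * \sum_(k < m) ce k.
  rewrite (le_trans (enorm_sum _ _ _)) // mulr_sumr; apply: ler_sum => k _.
  have kK : (k <= K.+1)%N by rewrite -ltnS (leq_trans _ mK) // ltnW // ltnS.
  by rewrite enormZ ger0_norm ?ce_ge0 // mulrC ler_wpM2r ?ce_ge0 // passes_le // all_pass.
have tB : enorm (tv m) <= 4 * X by apply: passes_le; apply: all_pass.
rewrite !big_ord_recr.
have c0 : 0 <= ce m by apply: ce_ge0.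
have th1 : 1 <= (1 + u) ^+ (2 * m) by rewrite exprn_ege1 // lerDl ltW.
have u0' := ltW u0.
set V := \sum_(k < m) ce k *: tv k in VB IH *.
set y := yv M x h K m in IH *.
have e : enorm (yv M x h K m.+1 - (V + ce m *: tv m)) <=
   (1 + u) * enorm (y - V) + u * enorm V + ((2 * u + u * u) * ce m) * enorm (tv m).
  apply: enorm_le3; rewrite ?mulr_ge0 ?addr_ge0 ?mulr_ge0 // => i.
  have -> : (yv M x h K m.+1 - (V + ce m *: tv m)) i 0 =
    fl_bin M Add (y i 0) (fl_bin M Mul (ce m) (tv m i 0)) - (V i 0 + ce m * tv m i 0).
    by rewrite !mxE.
  have -> : (y - V) i 0 = y i 0 - V i 0 by rewrite !mxE.
  have r1 := rounds_err (@flb Mul (ce m) (tv m i 0) I).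
  have r2 := rounds_err (@flb Add (y i 0) (fl_bin M Mul (ce m) (tv m i 0)) I).
  move: (y i 0) (V i 0) (tv m i 0) (ce m) c0 r1 r2 => yi Vi ti c c0.
  move: (fl_bin M Mul c ti) => m1; move: (fl_bin M Add yi m1) => w /= r1 r2.
  have cE : `|c * ti| = c * `|ti| by rewrite normrM ger0_norm.
  rewrite cE in r1.
  have n1 : `|yi + m1| <= `|yi - Vi| + (`|Vi| + (`|m1 - c * ti| + c * `|ti|)).
    have -> : yi + m1 = (yi - Vi) + (Vi + ((m1 - c * ti) + c * ti)) by ring.
    rewrite (le_trans (ler_normD _ _)) // lerD2l (le_trans (ler_normD _ _)) // lerD2l.
    by rewrite (le_trans (ler_normD _ _)) // cE.
  have n2' : `|w - (Vi + c * ti)| <= `|w - (yi + m1)| + (`|yi - Vi| + `|m1 - c * ti|).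
    have -> : w - (Vi + c * ti) = (w - (yi + m1)) + ((yi - Vi) + (m1 - c * ti)) by ring.
    by rewrite (le_trans (ler_normD _ _)) // lerD2l ler_normD.
  have a1 := le_trans r2 (ler_wpM2l u0' n1); have a2 := ler_wpM2l u0' r1.
  lra.
apply: (le_trans e).
rewrite mulnS exprD expr2.
move: ((1 + u) ^+ (2 * m)) th1 IH => T th1 IH.
move: (\sum_(k < m) ce k) (ce m) s0 c0 VB IH => s c s0 c0 VB IH.
have u1p : 0 <= 1 + u by rewrite addr_ge0.
have a1 := ler_wpM2l u1p IH; have a2 := ler_wpM2l u0' VB.
have uu0 : 0 <= (2 * u + u * u) * c by rewrite mulr_ge0 // addr_ge0 ?mulr_ge0.
have a3 := ler_wpM2l uu0 tB.
apply: (le_trans (lerD (lerD a1 a2) a3)).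
move: (4 * X) B0 => B B0.
have T1 : 0 <= T - 1 by rewrite subr_ge0.
have t1 : 0 <= u * (T - 1) * (B * s) by rewrite !mulr_ge0.
have t2 : 0 <= u * (B * s) by rewrite !mulr_ge0.
have t3 : 0 <= (1 + u) * (1 + u) * (T - 1) * (B * c) by rewrite !mulr_ge0.
have t4 : 0 <= u * u * (T - 1) * (B * s) by rewrite !mulr_ge0.
have t5 : 0 <= u * u * (B * s) by rewrite !mulr_ge0.
have -> : ((1 + u) * (1 + u) * T - 1) * B * (s + c) =
   (1 + u) * ((T - 1) * B * s) + u * (B * s) + (2 * u + u * u) * c * B
   + (u * (T - 1) * (B * s) + u * (B * s) + u * u * (T - 1) * (B * s) + u * u * (B * s))
   + (1 + u) * (1 + u) * (T - 1) * (B * c) by ring.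
lra.
Qed.

Lemma outv_close (g : nat -> R) :
  (forall k, (k <= K)%N -> 0 <= g k) -> 0 < \sum_(k < K.+1) g k ->
  (forall k, (k <= K)%N -> `|2 * ce k - g k| <= tau * g k) ->
  enorm (outv M x h K - \sum_(k < K.+1) (g k / \sum_(k < K.+1) g k) *: tv k)
   <= 6 * tau * (4 * X).
Proof.
move=> g0 S0 hce.
have tau8 : tau <= 1 / 8 by rewrite /tau; move: Ku1 eps1; lra.
have B0 : 0 <= 4 * X by rewrite mulr_ge0 ?enorm_ge0.
have s0 : 0 <= \sum_(k < K.+1) ce k.
  by apply: sumr_ge0 => k _; apply: ce_ge0; rewrite ltnW // ltnS.
have sE : \sum_(k < K.+2) ce k = \sum_(k < K.+1) ce k.
  by rewrite big_ord_recr /= ch_out addr0.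
have VE : \sum_(k < K.+2) ce k *: tv k = \sum_(k < K.+1) ce k *: tv k.
  by rewrite big_ord_recr /= ch_out scale0r addr0.
have Sv' : `|Sv M h K K.+2 - \sum_(k < K.+1) ce k| <= tau * \sum_(k < K.+1) ce k.
  have := Sv_err (leqnn _); rewrite sE => /le_trans; apply.
  rewrite ler_wpM2r // lerBlDl (le_trans (pow1D_le (ltW u0) _)) //.
    by move: Ku1 eps1; lra.
  have := mulr_ge0 (ler0n R K.+2) (ltW u0); rewrite /tau; lra.
apply: (normalize_err (Sh := Sv M h K K.+2) (Y := yv M x h K K.+2) (ce := ce)) => //.
- by move=> k kK; apply: passes_le; apply: all_pass; apply: ltnW.
- have := yv_err (leqnn _); rewrite sE VE => /le_trans; apply.
  rewrite ler_wpM2r // ler_wpM2r // lerBlDl (le_trans (pow1D_le (ltW u0) _)) //;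
  rewrite natrM; first by move: Ku1 eps1; lra.
  have := mulr_ge0 (ler0n R K.+2) (ltW u0); rewrite /tau; lra.
- move=> i; rewrite mxE.
  have sn : Sv M h K K.+2 <> 0.
    have := Sv'; rewrite ler_norml => /andP[+ _] e; rewrite e.
    have sp : 0 < \sum_(k < K.+1) ce k.
      have e2 : 2 * \sum_(k < K.+1) ce k >= (1 - tau) * \sum_(k < K.+1) g k.
        rewrite !mulr_sumr; apply: ler_sum => k _.
        have := hce k (ltn_ord k); rewrite ler_norml => /andP[+ _]; lra.
      have : 0 < (1 - tau) * \sum_(k < K.+1) g k by rewrite mulr_gt0 // subr_gt0 (le_lt_trans
        tau8) //; lra.
      lra.
    have : tau * \sum_(k < K.+1) ce k <= 1 / 8 * \sum_(k < K.+1) ce k by rewrite ler_wpM2r.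
    lra.
  apply: le_trans (rounds_err (@flb Div (yv M x h K K.+2 i 0) (Sv M h K K.+2) sn)) _.
  by rewrite /= ler_wpM2r.
Qed.

Lemma outv_accurate : enorm (expmx (- A) *m x - outv M x h K) <= eps * X.
Proof.
apply/ler_addgt0Pr => eta eta0.
have [N0 hN0] := shrink_iter_cvg A x eta0.
(* Three demands on [N]: to be within [eta] of the exponential, to make the [O(1/N)] terms of the
   recurrence smaller than [u], and to make [1 - A / N] a contraction. *)
pose N := maxn (maxn N0 1) (maxn (Num.truncn ((2 * h + 2 * K%:R + 2) * 2 / u)).+1 (Num.truncn
  al).+1).
have NN0 : (N0 <= N)%N by rewrite /N !leq_max leqnn.
have N1 : (0 < N)%N by rewrite /N !leq_max ltnSn orbT.
have Nbig : (2 * h + 2 * K%:R + 2) * 2 <= N%:R * u.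
  rewrite -ler_pdivrMr // (le_trans (ltW (truncnS_gt _))) // ler_nat.
  by rewrite /N !leq_max leqnn !orbT.
have Nal : specnorm A <= 2 * N%:R.
  have : al <= N%:R.
    rewrite (le_trans (ltW (truncnS_gt _))) // ler_nat.
    by rewrite /N !leq_max leqnn !orbT.
  by move: Aal al1; lra.
have Np : 0 < N%:R :> R by rewrite ltr0n.
clearbody N.
have X0 := enorm_ge0 x.
have Ku8 : K%:R * (8 * u) <= 1 / 4.
  have : K%:R * u <= K.+2%:R * u by rewrite ler_wpM2r ?(ltW u0) // ler_nat leqW.
  by move: Ku1 eps1; lra.
have E0 := expR_gt0 (- (2 * H)).
have He16 : 16 * expR (- (2 * H)) <= 1 by move: He eps1; lra.
have [c [c0 c00 cc cw hit]] := @miller_accuracy R h kap H u (2 * h) (2 * h / N%:R) J K N ch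
  KE erefl erefl J0 h0 kap0 kap1 kapz kapJ kapJz He16 u0 Ku8 Nbig ch_top ch_out ch_rec.
pose g k := wt k * c k.
set S := \sum_(k < K.+1) wt k * c k in cw.
have S0 : 0 < S.
  rewrite /S big_ord_recl /= mul1r ltr_pwDl // sumr_ge0 // => k _.
  by rewrite mulr_ge0 ?wt_ge0.
have zN : 2 * h < N%:R.
  have : N%:R * u <= N%:R * (1 / 16) by rewrite ler_wpM2l.
  by move: Nbig h0; have := ler0n R K; lra.
have z0 : 0 < 2 * h by rewrite mulr_gt0.
have Nc v : enorm (shrink A N%:R v) <= enorm v by apply: shrink_le.
have all4 k : (k <= K.+1)%N -> enorm (tv k) <= 4 * X.
  by move=> kK; apply: passes_le; apply: all_pass.
have ap := @kwalk_approx R n A (2 * h) xi (4 * X) (2 * h / N%:R) N K tv N z0 zN Nc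
   tv1_err (fun k kK => tvS_err (all4 k.+1 (leqW kK)) (all4 k (leqW (ltnW kK)))) (all4 _
     (leqnn _)) erefl.
have oc := @outv_close g (fun k _ => mulr_ge0 (wt_ge0 R k) (c0 k)) S0 (fun k kK => ce_close
  c0 kK cc).
rewrite -/S in oc.
set p := 2 * h / N%:R in cw hit ap.
have cmp : enorm (\sum_(k < K.+1) (g k / S) *: tv k - \sum_(k < K.+1) (wt k * kwalk p K N k)
  *: tv k)
   <= 66 * expR (- (2 * H)) * (4 * X).
  rewrite -sumrB (le_trans (enorm_sum _ _ _)) //.
  apply: (@le_trans _ _ (\sum_(k < K.+1) (wt k * `|c k / S - kwalk p K N k|) * (4 * X)));
    last first.
    by rewrite -mulr_suml ler_wpM2r // mulr_ge0.
  apply: ler_sum => k _; rewrite -scalerBl enormZ.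
  have -> : g k / S - wt k * kwalk p K N k = wt k * (c k / S - kwalk p K N k) by rewrite /g;
    ring.
  rewrite normrM (ger0_norm (wt_ge0 R k)) ler_wpM2l ?mulr_ge0 ?wt_ge0 //.
  by apply: all4; rewrite ltnW // ltnS.
have ex := hN0 N NN0.
rewrite (_ : tv 0%N = x) // in ap.
set V1 := expmx (- A) *m x in ex *; set V2 := iter N _ x in ex ap.
set V3 := \sum_(k < K.+1) _ in ap cmp.
set V4 := \sum_(k < K.+1) _ in cmp oc.
have -> : V1 - outv M x h K = (V1 - V2) - ((outv M x h K - V4) + ((V4 - V3) + (V3 - V2))).
  by rewrite !addrA !subrK opprB addrA subrK.
have t1 := enormB (V1 - V2) ((outv M x h K - V4) + ((V4 - V3) + (V3 - V2))).
have t2 := enormD (outv M x h K - V4) ((V4 - V3) + (V3 - V2)).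
have t3 := enormD (V4 - V3) (V3 - V2).
have hit4 : (1 - kmass p K N) * (4 * X) <= 2 * expR (- (2 * H)) * (4 * X).
  by rewrite ler_wpM2r // mulr_ge0.
have pN : N%:R * (p * xi) = 2 * h * xi by rewrite /p; field; rewrite gt_eqF.
rewrite pN in ap.
have HeX := ler_wpM2r X0 He.
have taue : 100 * 100 * tau * X <= 32 * eps * X.
  by rewrite ler_wpM2r // /tau; move: Ku1; lra.
have eX : 0 <= eps * X by rewrite mulr_ge0 // ltW.
have hx := hxi.
(* Relative to [|x|], the weights and the killed mass cost [(66 + 2) * 4 * exp (- 2 H)], less than
   [eps / 2]; the recurrence for [t] costs [eps / 3], and the summation [24 * tau], less than
   [eps / 10]. *)
apply: (le_trans t1); lra.
Qed.

End Accuracy.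
End Attempt.

(** * The program *)

Fixpoint block (i : instr) (l : seq instr) : prog :=
  if l is j :: l' then Seq (Do i) (block j l') else Do i.

(** * Total correctness with time bounds *)

Section Runs.
Context {R : realType} {n : nat} (M : machine R n).
Implicit Types (s : store R) (Q : store R -> Prop).

Definition runs (p : prog) s (T : nat) Q : Prop :=
  exists t s', [/\ exec M p s t s', (t <= T)%N & Q s'].

Lemma runs_weaken p s T T' Q Q' : runs p s T Q -> (T <= T')%N ->
  (forall s', Q s' -> Q' s') -> runs p s T' Q'.
Proof.
move=> [t [s' [e le q]]] TT QQ; exists t, s'; split => //; last exact: QQ.
exact: leq_trans TT.
Qed.

Lemma runs_seq p q s T1 T2 Q :
  runs p s T1 (fun s1 => runs q s1 T2 Q) -> runs (Seq p q) s (T1 + T2) Q.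
Proof.
move=> [t1 [s1 [e1 le1 [t2 [s2 [e2 le2 qs]]]]]].
by exists (t1 + t2)%N, s2; split => //; [exact: ExecSeq e1 e2 | exact: leq_add].
Qed.

Lemma runs_if b p q s T Q :
  (holds b s -> runs p s T Q) -> (~~ holds b s -> runs q s T Q) ->
  runs (If b p q) s T.+1 Q.
Proof.
move=> hp hq; have [hb|hb] := boolP (holds b s).
  by have [t [s' [e le qs]]] := hp hb; exists t.+1, s'; split => //; apply: ExecThen.
by have [t [s' [e le qs]]] := hq hb; exists t.+1, s'; split => //; apply: ExecElse.
Qed.

Lemma runs_block i l s (Q : store R -> Prop) :
  Q (foldl (fun s op => step M op s) s (i :: l)) ->
  runs (block i l) s (sumn (map (cost M) (i :: l))) Q.
Proof.
elim: l i s => [|j l IH] i s /= q.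
  by exists (cost M i), (step M i s); rewrite addn0; split => //; apply: ExecDo.
apply: runs_seq; exists (cost M i), (step M i s); split => //; first exact: ExecDo.
exact: IH.
Qed.

(** The variant [m] may drop by more than one, as it does when a failed test cuts a loop short. *)
Lemma runs_while b p T (I : nat -> store R -> Prop) :
  (forall m s, I m s -> holds b s ->
     runs p s T (fun s' => exists2 m', (m' < m)%N & I m' s')) ->
  forall m s, I m s ->
  runs (While b p) s (m * T.+1 + 1) (fun s' => ~~ holds b s' /\ exists m', I m' s').
Proof.
move=> body m; elim/ltn_ind: m => m IH s Is.
have [hb|hb] := boolP (holds b s); last first.
  exists 1%N, s; split; [exact: ExecStop | by rewrite addn1 | by split => //; exists m].
have [t1 [s1 [e1 le1 [m' mm Is1]]]] := body m s Is hb.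
have [t2 [s2 [e2 le2 q]]] := IH m' mm s1 Is1.
exists (t1 + t2).+1, s2; split => //; first exact: ExecLoop e1 e2.
have : (m'.+1 * T.+1 <= m * T.+1)%N by rewrite leq_mul2r mm orbT.
by rewrite mulSn; lia.
Qed.

(* Register 7 runs over the entries of the vectors, register 0 holds [n] and
   register 2 the constant 1. *)
Lemma runs_for i l (I : nat -> store R -> Prop) :
  (forall j s, I j s -> ireg s 0%N = n /\ ireg s 7%N = j) ->
  (forall j s, (j < n)%N -> I j s ->
     I j.+1 (foldl (fun s op => step M op s) s (i :: l))) ->
  forall s, I 0%N s ->
  runs (While (ILt 7 0) (block i l)) s
    (n * (sumn (map (cost M) (i :: l))).+1 + 1) (I n).
Proof.
move=> reg body s I0.
pose I' m s := exists2 j, (m = n - j)%N /\ (j <= n)%N & I j s.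
apply: (runs_weaken (runs_while (I := I') (m := n) _ _) (leqnn _)).
- move=> m s1 [j [-> jn] Ij]; have [r0 r7] := reg j s1 Ij.
  rewrite /= r0 r7 => lt; apply: runs_block; exists (n - j.+1)%N; first by lia.
  by exists j.+1; [split | apply: body].
- by exists 0%N; rewrite ?subn0.
- move=> s1 [+ [m [j [_ jn] Ij]]]; have [r0 r7] := reg j s1 Ij.
  rewrite /= r0 r7 -leqNgt => nj.
  by have -> : n = j by apply/eqP; rewrite eqn_leq nj jn.
Qed.

End Runs.

(* Register 1 always holds 0.  Scalars: 3 is the logarithm [H] of the accuracy,
   4 is [h], 5 the threshold for the squared norms, 6 a squared norm, 16 the sum
   of the weights, 17 zero, the others are temporary.  Arrays: 0 is [x], 11 the
   weights, 12 and 13 are [t (k-1)] and [t k], 14 is [A (t k)], 15 the weighted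
   sum.  Registers: 3 is the flag of a failed attempt, 4 is [J], 5 is [K = 4 J],
   6 is [k], 7 runs over the entries of vectors. *)
Definition sc (a : nat) : cell := (a, 1%N).

Section Program.
Local Open Scope nat_scope.

(** [H] is the computed [ln (1200 / eps)]. Starting [h] from [H] ensures [h >= H] later, so that
    [kap = sqrt (H / h)] is at most [1]. *)
Definition prog_init : prog :=
  Seq (block (IConst 2 1) [:: IConst 3 1; IConst 10 1200; ROfNat (sc 18) 10;
         RBin Div (sc 18) (sc 18) (sc 1); RUn Ln (sc 3) (sc 18);
         RCopy (sc 4) (sc 3); IConst 7 0])
  (Seq (While (ILt 7 0)
         (block (RBin Mul (sc 9) (0, 7) (0, 7))
                [:: RBin Add (sc 6) (sc 6) (sc 9); IAdd 7 7 2]))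
       (block (IConst 10 8) [:: ROfNat (sc 5) 10; RBin Mul (sc 5) (sc 5) (sc 6)])).

(** A real cannot be turned into a register, so [J], of order [sqrt (32 * h * H)], is found by
    counting; this takes time [O(J)]. *)
Definition prog_degree : prog :=
  Seq (block (RBin Add (sc 4) (sc 4) (sc 4))
         [:: IConst 10 32; ROfNat (sc 7) 10; RBin Mul (sc 7) (sc 7) (sc 4);
             RBin Mul (sc 7) (sc 7) (sc 3); IConst 4 0; RCopy (sc 8) (sc 17)])
      (While (RLt (sc 8) (sc 7))
         (block (IAdd 4 4 2) [:: ROfNat (sc 8) 4; RBin Mul (sc 8) (sc 8) (sc 8)])).

Definition prog_coef : prog :=
  Seq (block (IAdd 5 4 4) [:: IAdd 5 5 5; IAdd 8 5 2; RCopy (11, 8) (sc 17);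
         ROfNat (11, 5) 2; IAdd 6 5 1])
  (Seq (While (ILt 1 6)
         (block (ROfNat (sc 9) 6)
            [:: RBin Div (sc 9) (sc 9) (sc 4); RBin Mul (sc 9) (sc 9) (11, 6);
                RBin Add (sc 9) (sc 9) (11, 8); IAdd 8 6 1; ISub 6 6 2;
                RCopy (11, 6) (sc 9)]))
       (block (IConst 10 2)
          [:: ROfNat (sc 9) 10; RBin Div (sc 11) (sc 11) (sc 9)])).

Definition prog_start : prog :=
  Seq (block (RBin Add (sc 9) (sc 4) (sc 4)) [:: MatVec 14 0; IConst 7 0])
  (Seq (While (ILt 7 0)
         (block (RBin Div (sc 10) (14, 7) (sc 9))
            [:: RBin Defs.Sub (12, 7) (0, 7) (sc 10); RCopy (13, 7) (0, 7);
                RCopy (15, 7) (sc 17); IAdd 7 7 2]))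
       (block (RCopy (sc 16) (sc 17))
          [:: IConst 6 0; IConst 3 0; IAdd 9 5 2; IAdd 9 9 2])).

Definition prog_entry : prog :=
  block (RBin Mul (sc 9) (13, 7) (13, 7))
    [:: RBin Add (sc 6) (sc 6) (sc 9);
        RBin Mul (sc 9) (11, 6) (13, 7); RBin Add (15, 7) (15, 7) (sc 9);
        RBin Add (sc 9) (13, 7) (13, 7); RBin Div (sc 10) (14, 7) (sc 4);
        RBin Defs.Sub (sc 9) (sc 9) (sc 10); RBin Defs.Sub (sc 9) (sc 9) (12, 7);
        RCopy (12, 7) (13, 7); RCopy (13, 7) (sc 9); IAdd 7 7 2].

(** A failed test raises the flag in register 3 and moves [k] to the final value in register 9,
    which leaves the loop; the other branch is a dummy instruction. *)
Definition prog_step : prog :=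
  Seq (block (MatVec 14 13) [:: RCopy (sc 6) (sc 17); IConst 7 0])
  (Seq (While (ILt 7 0) prog_entry)
  (Seq (block (RBin Add (sc 16) (sc 16) (11, 6)) [:: IAdd 6 6 2])
       (If (RLt (sc 5) (sc 6)) (block (IConst 3 1) [:: IAdd 6 9 1])
           (Do (IConst 10 0))))).

Definition prog_attempt : prog :=
  Seq prog_degree (Seq prog_coef (Seq prog_start (While (ILt 6 9) prog_step))).

Definition prog_out : prog :=
  Seq (Do (IConst 7 0))
      (While (ILt 7 0) (block (RBin Div (2, 7) (15, 7) (sc 16)) [:: IAdd 7 7 2])).

Definition prog_exp : prog :=
  Seq prog_init (Seq (While (ILt 1 3) prog_attempt) prog_out).

End Program.

(** * Execution of the program *)

Section Correct.
Context {R : realType} {n : nat} (M : machine R n) (x : 'cV[R]_n).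
Implicit Types (s : store R).

Lemma ent_col (f : 'I_n -> R) j (jn : (j < n)%N) : ent (\col_i f i) j = f (Ordinal jn).
Proof. by rewrite -[j]/(nat_of_ord (Ordinal jn)) ent_ord mxE. Qed.

Lemma ent_Ordinal (v : 'cV[R]_n) j (jn : (j < n)%N) : ent v j = v (Ordinal jn) 0.
Proof. by rewrite -[j]/(nat_of_ord (Ordinal jn)) ent_ord. Qed.

Lemma vget_ent s a (v : 'cV[R]_n) :
  (forall j, (j < n)%N -> rarr s a j = ent v j) -> vget s a = v.
Proof. by move=> h; apply/colP => i; rewrite mxE h ?ltn_ord // ent_ord. Qed.

Definition thr : R := fl_bin M Mul (fl_nat M 8) (sqn M x n).

(* The store outside the work space of one attempt, [H] being the logarithm of
   the accuracy. *)
Definition base (H : R) s : Prop :=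
  [/\ ireg s 0%N = n, ireg s 1%N = 0%N, ireg s 2%N = 1%N,
      forall j, (j < n)%N -> rarr s 0%N j = ent x j &
      [/\ rarr s 17%N 0%N = 0, rarr s 3%N 0%N = H & rarr s 5%N 0%N = thr]].

Definition Hval (eps : R) : R := fl_un M Ln (fl_bin M Div (fl_nat M 1200) eps).

Lemma init_runs eps :
  runs M prog_init (input x eps) (12 + n * 4)%N
    (fun s => [/\ base (Hval eps) s, ireg s 3%N = 1%N & rarr s 4%N 0%N = Hval eps]).
Proof.
pose I j s := [/\ [/\ ireg s 0%N = n, ireg s 1%N = 0%N, ireg s 2%N = 1%N,
      forall j, (j < n)%N -> rarr s 0%N j = ent x j &
      [/\ rarr s 17%N 0%N = 0, rarr s 3%N 0%N = Hval eps & rarr s 4%N 0%N = Hval eps]],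
      ireg s 7%N = j, ireg s 3%N = 1%N & rarr s 6%N 0%N = sqn M x j].
rewrite (_ : 12 + n * 4 = 8 + ((n * 4 + 1) + 3))%N; last by lia.
apply: runs_seq; apply: runs_block; apply: runs_seq.
apply: (runs_weaken (runs_for (I := I) _ _ _) (leqnn _)).
- by move=> j s [[? _ _ _ _] ? _ _].
- move=> j s jn [[r0 r1 r2 a0 [a17 a3 a4]] r7 r3 a6].
  rewrite /I /= /rget /= r0 r1 r2 r3 r7 ?eqxx /= a6 a3 a4 a17 (a0 j jn).
  by split => //; rewrite addn1.
- by rewrite /I /= /rget /=; split.
move=> s [[r0 r1 r2 a0 [a17 a3 a4]] r7 r3 a6].
apply: runs_block; rewrite /base /= /rget /= r0 r1 r2 r3 ?eqxx /= a6 a3 a4 a17.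
by split.
Qed.

Section OneAttempt.
Variables (H h : R).

(** At [0] the cell holds a copied exact zero rather than a rounded product. *)
Definition sqj (j : nat) : R :=
  if j is 0 then 0 else fl_bin M Mul (fl_nat M j) (fl_nat M j).

Definition target : R := fl_bin M Mul (fl_bin M Mul (fl_nat M 32) h) H.

(** The loop cannot get past any [Jm] at which its test fails, so one such index bounds both the
    time and the [J] found. *)
Lemma degree_runs h' s Jm : base H s -> rarr s 4%N 0%N = h' ->
  fl_bin M Add h' h' = h -> ~~ (sqj Jm < target) ->
  runs M prog_degree s (7 + (Jm * 4 + 1))
    (fun s => [/\ base H s, rarr s 4%N 0%N = h, (ireg s 4%N <= Jm)%N &
                  ~~ (sqj (ireg s 4%N) < target)]).
Proof.
move=> [r0 r1 r2 a0 [a17 a3 a5]] a4 hE tJ.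
pose I m s := [/\ base H s, rarr s 4%N 0%N = h, m = (Jm - ireg s 4%N)%N,
   (ireg s 4%N <= Jm)%N &
   rarr s 8%N 0%N = sqj (ireg s 4%N) /\ rarr s 7%N 0%N = target].
apply: runs_seq; apply: runs_block.
apply: (runs_weaken (runs_while (I := I) (m := Jm) (T := 3) _ _) (leqnn _)).
- move=> m s1 [[q0 q1 q2 b0 [b17 b3 b5]] b4 mE le [b8 b7]].
  move=> lt; rewrite /= /rget /= q1 b8 b7 in lt.
  have jJ : (ireg s1 4%N < Jm)%N.
    rewrite ltn_neqAle le andbT; apply/eqP => e; rewrite e in lt.
    by rewrite lt in tJ.
  apply: runs_block; exists (Jm - (ireg s1 4%N).+1)%N; first by rewrite mE; lia.
  rewrite /I /base /= /rget /= q0 q1 q2 ?eqxx /= addn1 b17 b3 b5 b4 b7.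
  by split => //.
- rewrite /I /base /= /rget /= r0 r1 r2 ?eqxx /= a17 a3 a5 a4 hE subn0.
  by split => //.
move=> s1 [+ [m [[q0 q1 q2 b0 [b17 b3 b5]] b4 mE le [b8 b7]]]].
by rewrite /= /rget /= q1 b8 b7 => lt; split.
Qed.

Variable K : nat.
Local Notation ch := (bcoef M h K).
Local Notation ce := (wcoef M h K).
Local Notation tv := (tv M x h).
Local Notation tp k := (tpair M x h k).1.
Local Notation yv := (yv M x h K).
Local Notation Sv := (Sv M h K).

Definition ready s : Prop :=
  [/\ base H s, rarr s 4%N 0%N = h, ireg s 5%N = K &
      forall i, (i <= K.+1)%N -> rarr s 11%N i = ce i].

Lemma coef_runs J s : base H s -> rarr s 4%N 0%N = h -> ireg s 4%N = J ->
  K = (4 * J)%N -> runs M prog_coef s (6 + (K * 8 + 1 + 3)) ready.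
Proof.
move=> [r0 r1 r2 a0 [a17 a3 a5]] a4 r4 KE.
pose I m s := [/\ base H s, rarr s 4%N 0%N = h, ireg s 5%N = K &
   [/\ ireg s 6%N = m, ireg s 8%N = m.+1, (m <= K)%N &
       forall i, (m <= i <= K.+1)%N -> rarr s 11%N i = ch i]].
apply: runs_seq; apply: runs_block.
apply: runs_seq.
apply: (runs_weaken (runs_while (I := I) (m := K) (T := 7) _ _) (leqnn _)).
- move=> m s1 [[q0 q1 q2 b0 [b17 b3 b5]] b4 q5 [q6 q8 mK b11]].
  move=> hb; rewrite /= q1 q6 in hb; case: m hb q6 q8 mK b11 => // m _ q6 q8 mK b11.
  apply: runs_block; exists m => //.
  rewrite /I /base /= /rget /= q0 q1 q2 q5 q6 q8 ?eqxx /= b17 b3 b5 b4 subn1 addn0.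
  split => //; split => //; first exact: ltnW.
  move=> i /andP[mi iK]; have [->|im] := eqVneq i m; last first.
    by apply: b11; rewrite iK andbT ltn_neqAle eq_sym im.
  have e1 : rarr s1 11%N m.+1 = ch m.+1 by apply: b11; rewrite leqnn leqW.
  have e2 : rarr s1 11%N m.+2 = ch m.+2 by apply: b11; rewrite leqnSn.
  by rewrite e1 e2; apply/esym; apply: backseq_rec.
- have KJ : (J + J + (J + J) = K)%N by rewrite KE; lia.
  rewrite /I /base /= /rget /= r0 r1 r2 r4 ?eqxx /= KJ a17 a3 a5 a4 ?addn0 ?addn1.
  split => //; split => // i /andP[Ki iK].
  have [->|iK'] := eqVneq i K; first by rewrite /bcoef backseq_top.
  have -> : i = K.+1 by lia.
  by rewrite eqxx /bcoef backseq_out.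
move=> s1 [hb [m [[q0 q1 q2 b0 [b17 b3 b5]] b4 q5 [q6 q8 mK b11]]]].
rewrite /= q1 q6 -leqNgt leqn0 in hb; rewrite (eqP hb) in b11.
apply: runs_block.
rewrite /ready /base /= /rget /= q0 q1 q2 q5 ?eqxx /= b17 b3 b5 b4.
split => // i iK; case: i iK => [|i] iK /=; first by rewrite b11.
by rewrite b11.
Qed.

Definition loaded k s : Prop :=
  [/\ forall j, (j < n)%N -> rarr s 12%N j = ent (tp k) j,
      forall j, (j < n)%N -> rarr s 13%N j = ent (tv k) j,
      forall j, (j < n)%N -> rarr s 15%N j = ent (yv k) j &
      rarr s 16%N 0%N = Sv k].

Lemma start_runs s : ready s ->
  runs M prog_start s (mvtime M + 2 + (n * 6 + 1 + 5))
    (fun s => [/\ ready s, loaded 0 s &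
       [/\ ireg s 3%N = 0%N, ireg s 6%N = 0%N & ireg s 9%N = K.+2]]).
Proof.
move=> [[r0 r1 r2 a0 [a17 a3 a5]] a4 r5 a11].
pose I j s := [/\ ready s, ireg s 7%N = j,
   forall i, (i < n)%N -> rarr s 14%N i = ent (fl_mv M x) i,
   rarr s 9%N 0%N = fl_bin M Add h h &
   forall i, (i < j)%N -> (i < n)%N -> [/\ rarr s 12%N i = ent (startv M x h) i,
     rarr s 13%N i = ent x i & rarr s 15%N i = 0]].
rewrite (_ : mvtime M + 2 = 1 + (mvtime M + (1 + 0)))%N; last by lia.
apply: runs_seq; apply: runs_block.
apply: runs_seq.
apply: (runs_weaken (runs_for (I := I) _ _ _) (leqnn _)).
- by move=> j s1 [[[? _ _ _ _] _ _ _] ? _ _ _].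
- move=> j s1 jn [[[q0 q1 q2 b0 [b17 b3 b5]] b4 q5 b11] q7 b14 b9 bi].
  rewrite /I /ready /base /= /rget /= q0 q1 q2 q5 q7 ?eqxx /= b17 b3 b5 b4 b9 addn1.
  split => // i ij iN; have [->|ne] := eqVneq i j; last first.
    by apply: bi => //; rewrite ltn_neqAle ne -ltnS.
  split => //; last exact: b0.
  by rewrite b14 // b0 // /startv ent_col !ent_Ordinal.
- rewrite /I /ready /base /= /rget /= r0 r1 r2 r5 ?eqxx /= a17 a3 a5 a4.
  by split => // i iN; rewrite (vget_ent (v := x)) // /ent insubT.
move=> s1 [[[q0 q1 q2 b0 [b17 b3 b5]] b4 q5 b11] q7 b14 b9 bi].
apply: runs_block.
rewrite /ready /base /loaded /= /rget /= q0 q1 q2 q5 ?eqxx /= b17 b3 b5 b4 !addn1.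
split => //; split => // j jn; have [e12 e13 e15] := bi j jn jn => //.
by rewrite e15 /ent insubT mxE.
Qed.

Lemma entry_runs k s : ready s -> loaded k s -> (k <= K.+1)%N ->
  ireg s 6%N = k -> ireg s 9%N = K.+2 -> ireg s 3%N = 0%N -> ireg s 7%N = 0%N ->
  rarr s 6%N 0%N = 0 -> (forall i, (i < n)%N -> rarr s 14%N i = ent (fl_mv M (tv k)) i) ->
  runs M (While (ILt 7 0) prog_entry) s (n * 12 + 1)
   (fun s => [/\ ready s,
     [/\ forall j, (j < n)%N -> rarr s 12%N j = ent (tp k.+1) j,
      forall j, (j < n)%N -> rarr s 13%N j = ent (tv k.+1) j,
      forall j, (j < n)%N -> rarr s 15%N j = ent (yv k.+1) j &
      rarr s 16%N 0%N = Sv k],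
     [/\ ireg s 6%N = k, ireg s 9%N = K.+2 & ireg s 3%N = 0%N] &
     rarr s 6%N 0%N = sqn M (tv k) n]).
Proof.
move=> [[r0 r1 r2 a0 [a17 a3 a5]] a4 r5 a11] [a12 a13 a15 a16] kK r6 r9 r3 r7 a6 a14.
(* The arrays are overwritten in place: the entries below [j] already belong to index [k.+1], the
   others still to [k]. *)
pose I j s := [/\ ready s, [/\ ireg s 7%N = j, ireg s 6%N = k, ireg s 9%N = K.+2 & ireg s 3%N
  = 0%N],
   rarr s 6%N 0%N = sqn M (tv k) j,
   (forall i, (i < n)%N -> rarr s 14%N i = ent (fl_mv M (tv k)) i) /\ rarr s 16%N 0%N = Sv k &
   forall i, (i < n)%N -> [/\ rarr s 12%N i = ent (tp (if (i < j)%N then k.+1 else k)) i,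
     rarr s 13%N i = ent (tv (if (i < j)%N then k.+1 else k)) i &
     rarr s 15%N i = ent (yv (if (i < j)%N then k.+1 else k)) i]].
apply: (runs_weaken (runs_for (I := I) _ _ _) (leqnn _)).
- by move=> j s1 [[[? _ _ _ _] _ _ _] [? _ _ _] _ _ _].
- move=> j s1 jn [[[q0 q1 q2 b0 [b17 b3 b5]] b4 q5 b11] [q7 q6 q9 q3] b6 [b14 b16] bi].
  have [e12 e13 e15] := bi j jn; rewrite ltnn in e12 e13 e15.
  rewrite /I /ready /base /= /rget /= q0 q1 q2 q3 q5 q6 q7 q9 ?eqxx /=.
  rewrite b17 b3 b5 b4 b16 b6 e12 e13 e15 b14 // b11 // addn1.
  split => // i iN; have [->|ne] := eqVneq i j.
    rewrite ltnSn; split => //.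
      by rewrite /tv /= /stepv ent_col !ent_Ordinal.
    by rewrite /= ent_col !ent_Ordinal.
  have -> : (i < j.+1)%N = (i < j)%N by rewrite ltnS leq_eqVlt (negPf ne).
  exact: bi.
- split => // i iN; rewrite ltn0; split; [exact: a12 | exact: a13 | exact: a15].
move=> s1 [rd [q7 q6 q9 q3] b6 [b14 b16] bi]; split => //.
by split => // j jn; have [e12 e13 e15] := bi j jn; rewrite jn in e12 e13 e15.
Qed.

Definition running k s : Prop :=
  [/\ ready s, loaded k s,
    [/\ ireg s 3%N = 0%N, ireg s 6%N = k & ireg s 9%N = K.+2],
    (k <= K.+2)%N & forall j, (j < k)%N -> passes M x h j].

(** The first failing index is recorded, because [passes_of_norm] asks that all earlier ones
    pass. *)
Definition aborted s : Prop :=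
  [/\ ready s, [/\ ireg s 3%N = 1%N, ireg s 6%N = K.+2 & ireg s 9%N = K.+2] &
    exists k, [/\ (k <= K.+1)%N, ~~ passes M x h k &
      forall j, (j < k)%N -> passes M x h j]].

Lemma step_runs k s : running k s -> (k <= K.+1)%N ->
  runs M prog_step s (mvtime M + 2 + (n * 12 + 1 + (2 + 3)))
    (fun s => running k.+1 s \/ aborted s).
Proof.
move=> [[[r0 r1 r2 a0 [a17 a3 a5]] a4 r5 a11] [a12 a13 a15 a16] [r3 r6 r9] _ ps] kK.
rewrite (_ : mvtime M + 2 = mvtime M + (1 + (1 + 0)))%N; last by lia.
apply: runs_seq; apply: runs_block.
apply: runs_seq.
apply: (runs_weaken (entry_runs (k := k) _ _ _ _ _ _ _ _ _) (leqnn _)); last first.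
  move=> s1 [[[q0 q1 q2 b0 [b17 b3 b5]] b4 q5 b11] [b12 b13 b15 b16] [q6 q9 q3] b6].
  apply: runs_seq; apply: runs_block.
  apply: runs_if => ht; rewrite /= /rget /= q1 /= b5 b6 in ht.
    apply: runs_block; right.
    rewrite /aborted /ready /base /= /rget /= q0 q1 q2 q5 q9 ?eqxx /= b17 b3 b5 b4 addn0.
    split => //; exists k; split => //.
    by rewrite /passes negbK.
  exists 1%N, (step M (IConst 10 0) (foldl (fun s op => step M op s) s1
    [:: RBin Add (sc 16) (sc 16) (11%N, 6%N); IAdd 6 6 2])).
  split; [exact: ExecDo | by [] | left].
  rewrite /running /ready /base /loaded /= /rget /= q0 q1 q2 q3 q5 q6 q9 ?eqxx /= b17 b3 b5
    b4 b16 b11 // addn1.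
  split => // j; rewrite ltnS leq_eqVlt => /orP[/eqP -> //|]; exact: ps.
all: rewrite /ready /base /loaded /= /rget /= ?r0 ?r1 ?r2 ?r3 ?r5 ?r6 ?r9 ?eqxx /= ?a17 ?a3
  ?a5 ?a4 //.
by move=> i iN; rewrite (vget_ent (v := tv k)) // /ent insubT.
Qed.

Lemma steps_runs s : ready s -> loaded 0 s ->
  [/\ ireg s 3%N = 0%N, ireg s 6%N = 0%N & ireg s 9%N = K.+2] ->
  runs M (While (ILt 6 9) prog_step) s
    (K.+2 * (mvtime M + 2 + (n * 12 + 1 + (2 + 3))).+1 + 1)
    (fun s => running K.+2 s \/ aborted s).
Proof.
move=> rd ld rg.
pose I m s := (exists2 k, running k s & m = (K.+2 - k)%N) \/ (aborted s /\ m = 0%N).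
apply: (runs_weaken (runs_while (I := I) (m := K.+2) _ _) (leqnn _)).
- move=> m s1 [[k rk ->]|[[_ [q3 q6 q9] _] _]]; last by rewrite /= q6 q9 ltnn.
  have [_ _ [q3 q6 q9] _ _] := rk; rewrite /= q6 q9 ltnS => kK.
  apply: (runs_weaken (step_runs rk kK) (leqnn _)) => s2 [rk2|ab].
    by exists (K.+2 - k.+1)%N; [lia | left; exists k.+1].
  by exists 0%N; [lia | right].
- by left; exists 0%N; rewrite ?subn0.
move=> s1 [+ [m [[k rk _]|[ab _]]]]; last by right.
have [_ _ [q3 q6 q9] kK _] := rk; rewrite /= q6 q9 -leqNgt => Kk.
by left; have -> : K.+2 = k by apply/eqP; rewrite eqn_leq Kk kK.
Qed.

End OneAttempt.

Definition attempt_time (J : nat) : nat :=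
  7 + (J * 4 + 1) + (6 + (4 * J * 8 + 1 + 3) + (mvtime M + 2 + (n * 6 + 1 + 5) +
  ((4 * J).+2 * (mvtime M + 2 + (n * 12 + 1 + (2 + 3))).+1 + 1))).

Lemma attempt_runs H h' s Jm : base H s -> rarr s 4%N 0%N = h' ->
  let h := fl_bin M Add h' h' in ~~ (sqj Jm < target H h) ->
  runs M prog_attempt s (attempt_time Jm)
    (fun s => exists J, [/\ (J <= Jm)%N, ~~ (sqj J < target H h) &
        running H h (4 * J) (4 * J).+2 s \/ aborted H h (4 * J) s]).
Proof.
move=> bs a4 h tJ.
rewrite /attempt_time; apply: runs_seq.
apply: (runs_weaken (degree_runs bs a4 erefl tJ) (leqnn _)).
move=> s1 [bs1 b4 JJ tj]; set J := ireg s1 4%N in JJ tj.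
apply: runs_seq.
have := coef_runs bs1 b4 (erefl J) erefl => /runs_weaken; apply.
  by rewrite !leq_add // ?leq_mul.
move=> s2 rd; apply: runs_seq.
apply: (runs_weaken (start_runs rd) (leqnn _)) => s3 [rd3 ld3 rg3].
apply: (runs_weaken (steps_runs rd3 ld3 rg3)).
  by rewrite leq_add2r leq_mul // !ltnS leq_mul.
by move=> s4 res; exists J.
Qed.

Lemma out_runs H h K s : running H h K K.+2 s ->
  runs M prog_out s (1 + (n * 3 + 1)) (fun s => output n s = outv M x h K).
Proof.
move=> [[[r0 r1 r2 a0 [a17 a3 a5]] a4 r5 a11] [a12 a13 a15 a16] _ _ _].
pose I j s := [/\ ireg s 0%N = n, ireg s 1%N = 0%N, ireg s 2%N = 1%N, ireg s 7%N = j &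
  [/\ rarr s 16%N 0%N = Sv M h K K.+2,
  forall i, (i < n)%N -> rarr s 15%N i = ent (yv M x h K K.+2) i &
  forall i, (i < j)%N -> (i < n)%N -> rarr s 2%N i = ent (outv M x h K) i]].
apply: runs_seq; exists 1%N, (step M (IConst 7 0) s); split => //; first exact: ExecDo.
apply: (runs_weaken (runs_for (I := I) _ _ _) (leqnn _)).
- by move=> j s1 [? _ _ ? _].
- move=> j s1 jn [q0 q1 q2 q7 [b16 b15 bi]].
  rewrite /I /= /rget /= q0 q1 q2 q7 ?eqxx /= b16 addn1; split => //; split => //.
  move=> i ij iN; have [->|ne] := eqVneq i j; last first.
    by apply: bi => //; rewrite ltn_neqAle ne -ltnS.
  by rewrite b15 // /outv ent_col ent_Ordinal.
- by rewrite /I /=; split.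
move=> s1 [q0 q1 q2 q7 [b16 b15 bi]]; apply/colP => i.
by rewrite mxE bi ?ltn_ord // ent_ord.
Qed.

End Correct.

(** * Constants *)

Section Log.
Context {R : realType}.

Lemma expR1_ge2 : 2 <= expR 1 :> R.
Proof. by have := expR_ge1Dx (1 : R); lra. Qed.

Lemma expR_log1_ge (y : R) : 0 < y -> y <= expR (log1 y).
Proof.
move=> y0; rewrite -{1}(@lnK R y) ?posrE // ler_expR /log1.
by rewrite le_max lexx orbT.
Qed.

Lemma log1_ge1 (y : R) : 1 <= log1 y.
Proof. by rewrite /log1 le_max lexx. Qed.

Lemma le_log1 (y z : R) : 0 < y -> y <= z -> log1 y <= log1 z.
Proof.
move=> y0 yz; rewrite /log1 ge_max le_max lexx /= le_max.
by rewrite ler_ln ?posrE // ?yz ?orbT // (lt_le_trans y0).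
Qed.

(** As [exp (1 / 2) <= 2], a unit of the exponent costs at most two bits. *)
Lemma precision_le (L : R) (c b : nat) : (2 * c)%:R * L <= b%:R ->
  2 ^- b <= (expR L ^+ c)^-1.
Proof.
move=> h; rewrite lef_pV2 ?posrE ?exprn_gt0 ?expR_gt0 //.
have e2 : expR (1 / 2) <= 2 :> R.
  by apply: le_trans (expR_half_le (kap := 1) _) _; rewrite ?ler01 ?lexx.
apply: (@le_trans _ _ (expR (1 / 2) ^+ b)); last first.
  by rewrite lerXn2r ?nnegrE ?expR_ge0.
by rewrite -!expRM_natl ler_expR; move: h; rewrite natrM; lra.
Qed.

(** A rounded doubling multiplies [h] by at least [3 / 2]; this turns the number of doublings into a
    logarithm. *)
Lemma three_half_pow (m : nat) (L : R) : 3 * L <= m%:R -> expR L <= (3 / 2) ^+ m.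
Proof.
move=> h; have e : expR (1 / 3) <= 3 / 2 :> R.
  have := expR_ge1Dx (- (1 / 3) : R); rewrite expRN => h1.
  have e0 := expR_gt0 (1 / 3 : R).
  have : (1 + - (1 / 3)) * expR (1 / 3) <= 1 :> R by rewrite -ler_pdivlMr // [1 / expR _]mul1r.
  lra.
apply: (@le_trans _ _ (expR (1 / 3) ^+ m)); last first.
  by rewrite lerXn2r ?nnegrE ?expR_ge0.
by rewrite -expRM_natl ler_expR; lra.
Qed.

End Log.

Lemma attempt_time_le (R : realType) (n : nat) (M : machine R n) J :
  (0 < J)%N -> (0 < n)%N ->
  ((attempt_time M J).+1 <= 20 * 10 * (J * (mvtime M + n)))%N.
Proof. by rewrite /attempt_time; move: (mvtime M) => mv J0 n0; nia. Qed.

Lemma total_time_le (m T V k : nat) :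
  (0 < k)%N -> (T <= 20 * 10 * V)%N -> (k <= V)%N ->
  (12 + k * 4 + (m.+1 * T + 1 + (1 + (k * 3 + 1))) <= 20 * 10 * (m + 2) * V)%N.
Proof. by move=> k0 TV kV; nia. Qed.

(** * Choice of the precision, doubling of [h], and total time *)

Section Final.
Context {R : realType} {n : nat}.
Variables (M : machine R n) (A : 'M[R]_n) (x : 'cV[R]_n) (eps u : R).
Hypotheses (n0 : (0 < n)%N) (psdA : psd A) (eps0 : 0 < eps) (eps1 : eps < 1).
Let al := Num.max (specnorm A) 1.
Let L := log1 (n%:R * al / eps).
Let l := log1 (1 / eps).
(** The unit of the precision analysis: [n], [al], [1 / eps] and [L] are at most [Lam], and
    numerical constants are absorbed by powers of it through [2 <= Lam]. *)
Let Lam := expR L.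
Hypotheses (u0 : 0 < u) (uLam : u <= (Lam ^+ 52)^-1) (prec : has_precision u A M).
Let H := Hval M eps.

Let al1 : 1 <= al. Proof. by rewrite le_max lexx orbT. Qed.
Let Aal : specnorm A <= al. Proof. by rewrite le_max lexx. Qed.
Let n1 : 1 <= n%:R :> R. Proof. by rewrite ler1n. Qed.
Let L1 : 1 <= L. Proof. exact: log1_ge1. Qed.
Let l1 : 1 <= l. Proof. exact: log1_ge1. Qed.
Let Lam0 : 0 < Lam. Proof. exact: expR_gt0. Qed.

Let Lam2 : 2 <= Lam.
Proof. by apply: le_trans expR1_ge2 _; rewrite ler_expR. Qed.

Let ieps : 1 <= 1 / eps. Proof. by rewrite ler_pdivlMr // mul1r ltW. Qed.

Let naleps : n%:R * al / eps <= Lam.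
Proof. by apply: expR_log1_ge; rewrite divr_gt0 // mulr_gt0 ?ltr0n // (lt_le_trans ltr01). Qed.

Let nal1 : 1 <= n%:R * al.
Proof. by rewrite -[leLHS]mulr1 ler_pM. Qed.

Let Lam_ieps : 1 / eps <= Lam.
Proof. by apply: le_trans naleps; rewrite ler_wpM2r // invr_ge0 ltW. Qed.

Let Lam_nal : n%:R * al <= Lam.
Proof.
apply: le_trans naleps; rewrite ler_peMr ?(le_trans ler01 nal1) //.
by rewrite -[eps^-1]mul1r.
Qed.

Let Lam_al : al <= Lam.
Proof. by apply: le_trans Lam_nal; rewrite ler_peMl // (le_trans ler01). Qed.

Let Lam_n : n%:R <= Lam.
Proof. by apply: le_trans Lam_nal; rewrite ler_peMr. Qed.

Let lL : l <= L.
Proof.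
apply: le_log1; first by rewrite divr_gt0.
by rewrite ler_wpM2r // invr_ge0 ltW.
Qed.

Let L_Lam : L <= Lam.
Proof. by rewrite (le_trans _ (expR_ge1Dx L)) // lerDr. Qed.

Let Lam_pow k m : (k <= m)%N -> Lam ^+ k <= Lam ^+ m.
Proof. by move=> km; rewrite ler_weXn2l // (le_trans _ Lam2) //; lra. Qed.

Let pw k : 2 ^+ k <= Lam ^+ k.
Proof. by rewrite lerXn2r ?nnegrE ?(ltW Lam0). Qed.

Let u_small : u <= 1 / 16.
Proof.
apply: (le_trans uLam); have h : 16 <= Lam ^+ 52.
  apply: le_trans (Lam_pow (isT : (4 <= 52)%N)); apply: le_trans (pw 4).
  by rewrite -natrX ler_nat.
by rewrite -div1r ler_pdivrMr ?exprn_gt0 //; lra.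
Qed.

Let flb : forall o a b, bin_dom o b -> rounds_to u (bin_exact o a b) (fl_bin M o a b).
Proof. by case: prec. Qed.
Let fln : forall k : nat, rounds_to u k%:R (fl_nat M k).
Proof. by case: prec. Qed.

Let H_facts : [/\ 1 <= H, H <= 24 * l & 20 * 30 * expR (- (2 * H)) <= eps].
Proof.
rewrite /H /Hval.
rewrite (_ : 1200 = 30 * 40)%N //.
have /andP[] := rounds_pos (ler0n R (30 * 40)) (fln (30 * 40)).
rewrite natrM; move: (fl_nat M (30 * 40)) => f f1 f2.
have us := u_small; have u0' := u0.
have f1' : 30 * 37 <= f by lra.
have f2' : f <= 30 * 43 by lra.
have f0 : 0 <= f by lra.
have en : eps <> 0 by move=> e; move: eps0; rewrite e ltxx.
have fe0 : 0 <= f / eps by rewrite divr_ge0 // ltW.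
have /andP[g1 g2] := rounds_pos fe0 (@flb Div f eps en).
move: (fl_bin M Div f eps) g1 g2 => y /= g1 g2.
pose E := 1 / eps; have fE : f / eps = f * E by rewrite /E div1r.
have E1 : 1 <= E := ieps.
rewrite fE in g1 g2 fe0.
have E0 : 0 <= E by lra.
have h1 := ler_wpM2r E0 f1'; have h2 := ler_wpM2r E0 f2'.
have ufE : u * (f * E) <= 1 / 16 * (f * E) by rewrite ler_wpM2r.
have y1 : 30 * 30 * E <= y by lra.
have y2 : y <= 30 * 50 * E by lra.
have y0 : 0 < y by lra.
have prec_un : rounds_to u (ln y) (fl_un M Ln y) by case: prec => _ /(_ Ln y y0).
have ln2 : 2 <= ln y.
  rewrite -ler_expR lnK ?posrE //.
  have h : expR 2 <= 16 :> R.
    have e2 : expR (1 / 2) <= 2 :> R.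
      by apply: le_trans (expR_half_le (kap := 1) _) _; rewrite ?ler01 ?lexx.
    have -> : 2 = 4%:R * (1 / 2) :> R by field.
    rewrite expRM_natl; apply: (@le_trans _ _ (2 ^+ 4)).
      by rewrite lerXn2r ?nnegrE ?expR_ge0.
    by rewrite -natrX ler_nat.
  lra.
have lny0 : 0 <= ln y by lra.
have /andP[k1 k2] := rounds_pos lny0 prec_un.
move: (fl_un M Ln y) k1 k2 => h k1 k2.
have uln : u * ln y <= 1 / 16 * ln y by rewrite ler_wpM2r.
split; first lra.
  have lE : E <= expR l by apply: expR_log1_ge; rewrite divr_gt0.
  have : ln y <= 11 + l.
    rewrite -ler_expR lnK ?posrE // expRD.
    have e11 : 32 * 64 <= expR 11 :> R.
      have -> : 11 = 11%:R * 1 :> R by rewrite mulr1.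
      rewrite expRM_natl; apply: (@le_trans _ _ (2 ^+ 11)); first by rewrite -natrX -natrM
        ler_nat.
      by rewrite lerXn2r ?nnegrE ?expR_ge0 // expR1_ge2.
    have := ler_pM (mulr_ge0 (ler0n R 32) (ler0n R 64)) E0 e11 lE.
    lra.
  move: l1; lra.
(* The [2] in the exponent absorbs the relative error of the computed logarithm: [2 * h >= ln y],
   where [y >= 900 / eps]. *)
have e1 : expR (- (2 * h)) <= y^-1.
  rewrite -[y](@lnK R) ?posrE // -expRN ler_expR; lra.
have yi : y^-1 * (30 * 30 * E) <= 1 by rewrite mulrC ler_pdivrMr // mul1r.
have yi2 : 30 * 30 * y^-1 <= eps.
  have eE : E * eps = 1 by rewrite /E divfK // gt_eqF.
  have := ler_wpM2r (ltW eps0) yi.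
  have -> : y^-1 * (30 * 30 * E) * eps = 30 * 30 * y^-1 * (E * eps) by ring.
  by rewrite eE mulr1 mul1r.
have := expR_gt0 (- (2 * h)); lra.
Qed.

Let H1 : 1 <= H. Proof. by case: H_facts. Qed.
Let Hl : H <= 24 * l. Proof. by case: H_facts. Qed.
Let He : 20 * 30 * expR (- (2 * H)) <= eps. Proof. by case: H_facts. Qed.

(** Bounds every [h] in use: a failure at [h] means [4 * h < |A|], so each attempt starts from at
    most [H + al], and a rounded doubling at most triples. *)
Let hm : R := 3 * (H + al).
(** Stops the search for [J]: the computed square is at least [Jm ^ 2 / 2], hence at least
    [40 * hm * H], and the computed target is at most [40 * h * H]. *)
Let Jm : nat := (Num.truncn (Num.sqrt (80 * (hm * H)))).+1.

Let hmH : 80 * (hm * H) <= 20 * 20 * (20 * 20) * ((l + al) * l).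
Proof.
have a0 : 0 <= al by rewrite (le_trans ler01).
have b0 : 0 <= H by rewrite (le_trans ler01 H1).
have l0 : 0 <= l by rewrite (le_trans ler01 l1).
have h : (H + al) * H <= (24 * (l + al)) * (24 * l).
  rewrite ler_pM ?addr_ge0 //; move: Hl; lra.
have := mulr_ge0 (addr_ge0 l0 a0) l0; rewrite /hm; lra.
Qed.

Let hmH0 : 0 <= 80 * (hm * H).
Proof.
have b0 : 0 <= H by rewrite (le_trans ler01 H1).
by rewrite !mulr_ge0 ?addr_ge0 // (le_trans ler01 al1).
Qed.

Let Jm_le : Jm%:R <= Num.sqrt (80 * (hm * H)) + 1.
Proof.
rewrite /Jm -natr1 lerD2r -truncn_ge_nat ?leqnn //; exact: sqrtr_ge0.
Qed.

Let Jm_ge : 80 * (hm * H) <= Jm%:R ^+ 2.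
Proof.
rewrite -{1}(sqr_sqrtr hmH0) ler_sqr ?nnegrE ?sqrtr_ge0 // ltW //.
exact: truncnS_gt.
Qed.

Let Jm_Lam : Jm%:R <= 21 * 20 * Lam.
Proof.
apply: (le_trans Jm_le).
have : Num.sqrt (80 * (hm * H)) <= 20 * 20 * Lam.
  have L400 : 0 <= 20 * 20 * Lam by move: Lam0; lra.
  rewrite -(ger0_norm L400) -sqrtr_sqr.
  rewrite ler_sqrt ?sqr_ge0 //.
  have a0 : 0 <= al by rewrite (le_trans ler01).
  have b0 : 0 <= H by rewrite (le_trans ler01 H1).
  have HL : H <= 24 * Lam by move: Hl lL L_Lam; lra.
  have h : (H + al) * H <= (25 * Lam) * (24 * Lam).
    rewrite ler_pM ?addr_ge0 //; move: Lam_al; lra.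
  have -> : (20 * 20 * Lam) ^+ 2 = 20 * 20 * (20 * 20) * (Lam * Lam) by ring.
  have := mulr_ge0 (ltW Lam0) (ltW Lam0); rewrite /hm; lra.
by move: Lam2; lra.
Qed.

(** The origin of [52]: in powers of [Lam], the constant takes [14], the square of the degree [26],
    [n ^ 2] takes [2], [al] one, [h] eight, and [1 / eps] the last one. *)
Let J_scale (J : nat) (h : R) : (J <= Jm)%N -> 0 < h -> h <= hm ->
  100 * 100 * ((4 * J).+2%:R ^+ 2 * n%:R ^+ 2 * al * h * u) <= eps.
Proof.
move=> JJ h0 hh.
have c12 : 64 * 64 <= Lam ^+ 12.
  by apply: le_trans (pw 12); rewrite -natrX -natrM ler_nat.
have c7 : 64 * 2 <= Lam ^+ 7 by apply: le_trans (pw 7); rewrite -natrX -natrM ler_nat.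
have d7 : 0 <= 64 * 2 :> R by rewrite mulr_ge0.
have K : (4 * J).+2%:R <= Lam ^+ 13.
  have : (4 * J).+2%:R <= 4 * Jm%:R + 2 :> R.
    by rewrite -addn2 natrD natrM lerD2r ler_wpM2l // ler_nat.
  have := ler_wpM2r (ltW Lam0) c12; rewrite -exprSr.
  by move: Jm_Lam Lam2; lra.
have hL : h <= Lam ^+ 8.
  have := ler_wpM2r (ltW Lam0) c7; rewrite -exprSr.
  by move: hh Hl lL L_Lam Lam_al Lam0; rewrite /hm; lra.
have c14 : 100 * 100 <= Lam ^+ 14.
  by have := ler_pM d7 d7 c7 c7; rewrite -exprD; lra.
have a0 : 0 <= al by rewrite (le_trans ler01).
have P0 k : 0 <= Lam ^+ k by rewrite exprn_ge0 // ltW.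
have K2 : (4 * J).+2%:R ^+ 2 <= Lam ^+ 26.
  by rewrite -[26%N]/(13 * 2)%N exprM lerXn2r ?nnegrE.
have N2 : n%:R ^+ 2 <= Lam ^+ 2 by rewrite lerXn2r ?nnegrE // ltW.
have big : 100 * 100 * ((4 * J).+2%:R ^+ 2 * n%:R ^+ 2 * al * h) <= Lam ^+ 14 * (Lam ^+ 26 *
  Lam ^+ 2 * Lam * Lam ^+ 8).
  have k0 : 0 <= (4 * J).+2%:R ^+ 2 :> R by rewrite exprn_ge0.
  have m0 : 0 <= n%:R ^+ 2 :> R by rewrite exprn_ge0.
  have b1 := ler_pM k0 m0 K2 N2.
  have b2 := ler_pM (mulr_ge0 k0 m0) a0 b1 Lam_al.
  have b3 := ler_pM (mulr_ge0 (mulr_ge0 k0 m0) a0) (ltW h0) b2 hL.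
  apply: ler_pM c14 b3; first by rewrite mulr_ge0.
  exact: mulr_ge0 (mulr_ge0 (mulr_ge0 k0 m0) a0) (ltW h0).
have big2 : 100 * 100 * ((4 * J).+2%:R ^+ 2 * n%:R ^+ 2 * al * h) * u <= Lam ^+ 51 * (Lam ^+
  52)^-1.
  rewrite ler_pM ?(ltW u0) ?mulr_ge0 ?exprn_ge0 ?(ltW h0) //.
  by apply: (le_trans big); rewrite -[Lam in X in _ * (X * _)]expr1 -!exprD.
have -> : 100 * 100 * ((4 * J).+2%:R ^+ 2 * n%:R ^+ 2 * al * h * u) =
  100 * 100 * ((4 * J).+2%:R ^+ 2 * n%:R ^+ 2 * al * h) * u by ring.
apply: (le_trans big2).
have -> : Lam ^+ 51 * (Lam ^+ 52)^-1 = Lam^-1.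
  by rewrite [Lam ^+ 52]exprS invfM mulrCA divff ?mulr1 // expf_neq0 // gt_eqF.
rewrite -[Lam^-1]div1r ler_pdivrMr // -ler_pdivrMl // mulrC.
exact: Lam_ieps.
Qed.

Let target_bounds h : 0 <= h ->
  20 * (h * H) <= target M H h <= 40 * (h * H).
Proof.
move=> h0; have b0 : 0 <= H by rewrite (le_trans ler01 H1).
rewrite /target; have us := u_small; have u0' := u0.
have /andP[f1 f2] := rounds_pos (ler0n R 32) (fln 32).
move: (fl_nat M 32) f1 f2 => f f1 f2.
have f1' : 30 <= f by lra.
have f2' : f <= 34 by lra.
have f0 : 0 <= f by lra.
have fh := mulr_ge0 f0 h0.
have /andP[g1 g2] := rounds_pos fh (@flb Mul f h I).
move: (fl_bin M Mul f h) g1 g2 => g /= g1 g2.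
have ug : u * (f * h) <= 1 / 16 * (f * h) by rewrite ler_wpM2r.
have a1 := ler_wpM2r h0 f1'; have a2 := ler_wpM2r h0 f2'.
have g1' : 28 * h <= g by lra.
have g2' : g <= 37 * h by lra.
have g0 : 0 <= g by lra.
have gH := mulr_ge0 g0 b0.
have /andP[k1 k2] := rounds_pos gH (@flb Mul g H I).
move: (fl_bin M Mul g H) k1 k2 => k /= k1 k2.
have uk : u * (g * H) <= 1 / 16 * (g * H) by rewrite ler_wpM2r.
have c1 := ler_wpM2r b0 g1'; have c2 := ler_wpM2r b0 g2'.
have hH := mulr_ge0 h0 b0.
by apply/andP; split; lra.
Qed.

Let sqj_bounds J : 1 / 2 * J%:R ^+ 2 <= sqj M J <= 5 / 4 * J%:R ^+ 2.
Proof.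
case: J => [|J]; first by rewrite /= expr0n !mulr0 lexx.
rewrite /sqj; have us := u_small; have u0' := u0.
have J0 : 0 <= J.+1%:R :> R by [].
have /andP[f1 f2] := rounds_pos J0 (fln J.+1).
move: (fl_nat M J.+1) f1 f2 J0; move: (J.+1%:R : R) => j f f1 f2 J0.
have uj : u * j <= 1 / 16 * j by rewrite ler_wpM2r.
have f1' : 15 / 16 * j <= f by lra.
have f2' : f <= 17 / 16 * j by lra.
have j15 : 0 <= 15 / 16 * j by lra.
have f0 : 0 <= f by lra.
have q1 := ler_pM j15 j15 f1' f1'; have q2 := ler_pM f0 f0 f2' f2'.
have ff := mulr_ge0 f0 f0.
have /andP[g1 g2] := rounds_pos ff (@flb Mul f f I).
move: (fl_bin M Mul f f) g1 g2 => g /= g1 g2.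
have uf : u * (f * f) <= 1 / 16 * (f * f) by rewrite ler_wpM2r.
have uf0 : 0 <= u * (f * f) by rewrite mulr_ge0 // ltW.
have jj := mulr_ge0 J0 J0.
by rewrite expr2; apply/andP; split; lra.
Qed.

Let Jm_stop h : 0 <= h -> h <= hm -> ~~ (sqj M Jm < target M H h).
Proof.
move=> h0 hh; rewrite -leNgt.
have /andP[_ t2] := target_bounds h0; have /andP[s1 _] := sqj_bounds Jm.
have b0 : 0 <= H by rewrite (le_trans ler01 H1).
have := ler_wpM2r b0 hh; move: Jm_ge; lra.
Qed.

Let accurate (s : store R) : Prop := exists h J,
  running M x H h (4 * J) (4 * J).+2 s /\
  enorm (expmx (- A) *m x - outv M x h (4 * J)) <= eps * enorm x.

Let attempt_ok h' s : base M x H s -> rarr s 4%N 0%N = h' -> H <= h' -> h' <= H + al ->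
  let h := fl_bin M Add h' h' in
  [/\ 3 / 2 * h' <= h, h <= hm &
  runs M prog_attempt s (attempt_time (n := n) M Jm) (fun s =>
    accurate s \/
    [/\ base M x H s, rarr s 4%N 0%N = h, ireg s 3%N = 1%N & 4 * h < specnorm A])].
Proof.
move=> bs a4 Hh' h'm h.
have h'0 : 0 <= h' + h' by rewrite addr_ge0 // (le_trans _ Hh') // (le_trans ler01 H1).
have us := u_small; have u0' := u0.
have /andP[g1 g2] := rounds_pos h'0 (@flb Add h' h' I).
rewrite /= -/h in g1 g2.
have uh : u * (h' + h') <= 1 / 16 * (h' + h') by rewrite ler_wpM2r.
have hl : 3 / 2 * h' <= h by lra.
have hu : h <= hm by rewrite /hm; lra.
split => //.
have b0 : 1 <= H := H1.
have h1 : 1 <= h by lra.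
have h0 : 0 < h by lra.
apply: (runs_weaken (attempt_runs bs a4 (Jm_stop (ltW h0) hu)) (leqnn _)).
move=> s1 [J [JJ tJ out]]; rewrite -leNgt in tJ.
have /andP[t1 _] := target_bounds (ltW h0); have /andP[_ s2] := sqj_bounds J.
have hH0 : 0 < h * H by rewrite mulr_gt0 //; lra.
(* [16] is [20 / (5 / 4)], the lower bound for the target over the upper bound for the computed
   square. With [kap ^ 2 = H / h] it yields both [4 * H <= kap * J] and [kap * (2 * h) <= 2 * J]. *)
have J16 : 16 * (h * H) <= J%:R ^+ 2 by lra.
have J0 : (0 < J)%N.
  by rewrite lt0n; apply/eqP => e; move: J16; rewrite e mulr0n expr0n /=; lra.
have Big := J_scale JJ h0 hu.
have eps1' := ltW eps1.
case: out => [run|ab]; last first.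
  right; move: ab => [[bs1 b4 _ _] [q3 _ _] [k [kK np ps]]]; split => //.
  rewrite ltNge; apply/negP => Ah.
  by have := passes_of_norm n0 psdA prec u0 h1 al1 Aal eps1' erefl J0 Big Ah kK ps; rewrite
    (negPf np).
left; exists h, J; split => //.
have ps k : (k <= (4 * J).+1)%N -> passes M x h k by case: run => _ _ _ _ ps kK; apply: ps.
pose kap := Num.sqrt (H / h).
have Hh0 : 0 < H / h by rewrite divr_gt0 //; lra.
have kap0 : 0 < kap by rewrite sqrtr_gt0.
have kap2 : kap ^+ 2 = H / h by rewrite sqr_sqrtr // ltW.
have kap1 : kap <= 1.
  rewrite -(@ler_sqr _ kap 1) ?nnegrE ?(ltW kap0) // kap2 expr1n ler_pdivrMr // mul1r; lra.
have kapz : kap ^+ 2 * (2 * h) <= 2 * H.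
  by rewrite kap2 mulrCA divfK // gt_eqF.
have J0' : 0 <= J%:R :> R by [].
have kapJ : 4 * H <= kap * J%:R.
  have H4 : 0 <= 4 * H by lra.
  have kJ : 0 <= kap * J%:R by rewrite mulr_ge0 // ltW.
  rewrite -ler_sqr ?nnegrE //.
  rewrite !exprMn kap2.
  have := ler_wpM2l (ltW Hh0) J16; apply: le_trans.
  have -> : H / h * (16 * (h * H)) = 16 * (H * H) by field; rewrite gt_eqF.
  by rewrite -expr2 ler_wpM2r ?sqr_ge0 // -natrX ler_nat.
have kapJz : kap * (2 * h) <= 2 * J%:R.
  have h2 : 0 <= kap * (2 * h) by rewrite mulr_ge0 ?(ltW kap0) //; lra.
  have J2 : 0 <= 2 * J%:R :> R by rewrite mulr_ge0.
  rewrite -ler_sqr ?nnegrE //.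
  rewrite !exprMn kap2.
  have -> : H / h * (2 ^+ 2 * h ^+ 2) = 2 ^+ 2 * (h * H) by field; rewrite gt_eqF.
  by rewrite ler_wpM2l ?sqr_ge0 //; lra.
exact: (outv_accurate n0 psdA prec u0 h1 al1 Aal eps0 eps1' erefl J0 Big kap0 kap1 kapz kapJ
  kapJz He ps).
Qed.

(** Chosen so that [(3 / 2) ^ m0 >= Lam >= al], the initial value of [h] being [H >= 1]. *)
Let m0 : nat := (Num.truncn (3 * L)).+1.

Let exp_time : nat :=
  (12 + n * 4 + (m0.+1 * (attempt_time (n := n) M Jm).+1 + 1 + (1 + (n * 3 + 1))))%N.

Let exp_runs : runs M prog_exp (input x eps) exp_time
  (fun s => enorm (expmx (- A) *m x - output n s) <= eps * enorm x).
Proof.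
apply: runs_seq; apply: (runs_weaken (init_runs M x eps) (leqnn _)).
rewrite -/H => s [bs r3 a4]; apply: runs_seq.
(* At most [k] failures are still possible: for [k = 0] one has [al <= h'], while a failure would
   give [4 * h < al] with [h >= 3 / 2 * h']. *)
pose I m s := (m = 0%N /\ accurate s /\ ireg s 3%N = 0%N) \/
  exists h' k, [/\ m = k.+1, base M x H s, rarr s 4%N 0%N = h', ireg s 3%N = 1%N &
    [/\ H <= h', h' <= H + al & al <= (3 / 2) ^+ k * h']].
have a0 : 0 <= al by rewrite (le_trans ler01).
apply: (runs_weaken (runs_while (I := I) (m := m0.+1) (T := attempt_time (n := n) M Jm) _ _)
  (leqnn _)).
- move=> m s1 [[_ [[h [J [[[[_ q1 _ _ _] _ _ _] _ _ _ _] _]]] q3]]|]; first by rewrite /= q1 q3.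
  move=> [h' [k [-> bs1 b4 q3 [Hh' h'm kh']]]] _.
  have [hl hu run] := attempt_ok bs1 b4 Hh' h'm.
  move: run; set h := fl_bin M Add h' h' in hl hu * => run.
  apply: (runs_weaken run (leqnn _)) => s2 [ac|[bs2 c4 p3 Ah]].
    exists 0%N => //; left; split => //; split => //.
    by case: ac => g [J [[_ _ [? _ _] _ _] _]].
  have b0 : 1 <= H := H1.
  have hal : 4 * h < al := lt_le_trans Ah Aal.
  case: k kh' => [|k] kh'; first by exfalso; move: kh'; rewrite expr0 mul1r; lra.
  exists k.+1 => //; right; exists h, k; split => //; split; [lra | lra |].
  have k32 : 0 <= (3 / 2 : R) ^+ k by rewrite exprn_ge0 // divr_ge0.
  by apply: (le_trans kh'); rewrite exprSr -mulrA; apply: ler_wpM2l k32 _ _ hl.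
- right; exists H, m0; split => //; split => //; first by rewrite lerDl.
  apply: (le_trans Lam_al); apply: le_trans (_ : (3 / 2) ^+ m0 <= _).
    by apply: three_half_pow; rewrite ltW // truncnS_gt.
  by rewrite ler_peMr // exprn_ge0 // divr_ge0.
move=> s1 [nb [m [[_ [[h [J [run ac]]] _]]|]]]; last first.
  move=> [h' [k [_ [_ q1 _ _ _] _ q3 _]]].
  by rewrite /= q1 q3 in nb.
apply: (runs_weaken (out_runs run) (leqnn _)) => s2 ->.
exact: ac.
Qed.

(** All attempts, [O(L)] in number, are charged as the dearest one, whose degree is
    [O(sqrt (hm * H))]; this is [O(l * sqrt (|A| / l + 1))], since [hm * H] is [O((l + al) * l)]. *)
Let time_bound : exp_time%:R <= 100 * 100 * 100 *
   ((((mvtime M)%:R + n%:R) * L * Num.sqrt (specnorm A / l + 1) + L ^+ 2) * l).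
Proof.
pose W : R := (mvtime M)%:R + n%:R.
pose sq := Num.sqrt (specnorm A / l + 1).
have l0 : 0 < l by apply: lt_le_trans l1.
have A0 := specnorm_ge0 A.
have sq2 : sq ^+ 2 = specnorm A / l + 1.
  by rewrite sqr_sqrtr // addr_ge0 // divr_ge0 // ltW.
have sq1 : 1 <= sq.
  rewrite -(@ler_sqr _ 1) ?nnegrE ?sqrtr_ge0 // sq2 expr1n lerDr.
  by rewrite divr_ge0 // ltW.
have W1 : 1 <= W by rewrite /W -[leLHS]add0r lerD.
have Jl : Jm%:R <= 31 * 20 * (l * sq).
  apply: (le_trans Jm_le).
  have lsq : 1 <= l * sq by rewrite -[leLHS]mulr1 ler_pM.
  have : Num.sqrt (80 * (hm * H)) <= 30 * 20 * (l * sq).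
    have ls0 : 0 <= 30 * 20 * (l * sq) by rewrite mulr_ge0 //; lra.
    rewrite -(ger0_norm ls0) -sqrtr_sqr ler_sqrt ?sqr_ge0 // (le_trans hmH) //.
    have -> : (30 * 20 * (l * sq)) ^+ 2 = 30 * 20 * (30 * 20) * (l * (l * sq ^+ 2)) by ring.
    have -> : l * sq ^+ 2 = specnorm A + l by rewrite sq2 mulrDr mulr1 mulrC divfK // gt_eqF.
    have alA : al <= specnorm A + l.
      by rewrite /al ge_max lerDl (ltW l0) /=; move: l1; lra.
    have : (l + al) * l <= (2 * (specnorm A + l)) * l by rewrite ler_wpM2r ?(ltW l0) //; lra.
    have : 0 <= (specnorm A + l) * l by rewrite mulr_ge0 ?addr_ge0 ?(ltW l0).
    lra.
  lra.
have m0L : m0%:R + 2 <= 6 * L.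
  have : m0%:R <= 3 * L + 1.
    rewrite /m0 -natr1 lerD2r -truncn_ge_nat ?leqnn // mulr_ge0 //.
    by rewrite (le_trans ler01 L1).
  by move: L1; lra.
have Jm1 : 1 <= Jm%:R :> R by rewrite ler1n.
have nat_bound : (exp_time <= 20 * 10 * (m0 + 2) * (Jm * (mvtime M + n)))%N.
  apply: total_time_le n0 (attempt_time_le M (isT : (0 < Jm)%N) n0) _.
  by rewrite (leq_trans (leq_addl (mvtime M) n)) // leq_pmull.
have step1 : exp_time%:R <= 20 * 10 * (m0%:R + 2) * (Jm%:R * W).
  by move: nat_bound; rewrite -(ler_nat R) !natrM !natrD.
have m2 : 0 <= 20 * 10 * (m0%:R + 2) :> R by rewrite mulr_ge0 // addr_ge0.
have W0 : 0 <= W by lra.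
apply: (le_trans step1).
apply: (@le_trans _ _ (20 * 10 * (6 * L) * (31 * 20 * (l * sq) * W))).
  rewrite ler_pM ?mulr_ge0 //; first by rewrite ler_wpM2l.
  by rewrite ler_wpM2r.
rewrite -/W -/sq.
have p1 : 0 <= W * L * sq * l.
  by rewrite !mulr_ge0 ?(ltW l0) ?(le_trans ler01 L1) ?(le_trans ler01 sq1).
have p2 : 0 <= L ^+ 2 * l by rewrite mulr_ge0 ?sqr_ge0 ?(ltW l0).
have -> : 20 * 10 * (6 * L) * (31 * 20 * (l * sq) * W) = 20 * 10 * 6 * (31 * 20) * (W * L *
  sq * l) by ring.
lra.
Qed.

Lemma prog_exp_correct : exists (t : nat) (s : store R),
  exec M prog_exp (input x eps) t s /\
  enorm (expmx (- A) *m x - output n s) <= eps * enorm x /\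
  t%:R <= 100 * 100 * 100 *
   ((((mvtime M)%:R + n%:R) * L * Num.sqrt (specnorm A / l + 1) + L ^+ 2) * l).
Proof.
have [t [s [e le acc]]] := exp_runs; exists t, s; split => //; split => //.
by apply: le_trans time_bound; rewrite ler_nat.
Qed.

End Final.

Theorem corollary17 (R : realType) :
  exists (P : prog) (cbits ctime : R),
    0 < cbits /\ 0 < ctime /\
    forall (n : nat) (A : 'M[R]_n) (x : 'cV[R]_n) (eps : R)
      (b : nat) (M : machine R n),
      (0 < n)%N -> psd A -> 0 < eps -> eps < 1 ->
      let L := log1 (n%:R * Num.max (specnorm A) 1 / eps) in
      cbits * L <= b%:R ->
      has_precision (2 ^- b) A M ->
      exists (t : nat) (s : store R),
        exec M P (input x eps) t s /\
        enorm (expmx (- A) *m x - output n s) <= eps * enorm x /\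
        t%:R <= ctime *
          ((((mvtime M)%:R + n%:R) * L
              * Num.sqrt (specnorm A / log1 (1 / eps) + 1)
            + L ^+ 2) * log1 (1 / eps)).
Proof.
exists prog_exp, (2 * 52)%:R, (100 * 100 * 100); split; first by rewrite ltr0n.
split; first by rewrite !mulr_gt0.
move=> n A x eps b M n0 psdA eps0 eps1 L bL prec.
have u0 : 0 < 2 ^- b :> R by rewrite invr_gt0 exprn_gt0.
exact: prog_exp_correct n0 psdA eps0 eps1 u0 (precision_le bL) prec.
Qed.
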